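(* For any state $\rho_{AB}$ on a finite-dimensional bipartite system $AB$, \[ E_{d,\mathrm{err}}(\rho_{AB}) = \mathrm{Sanov}(\rho_{AB}\,\|\,\mathcal{S}_{A:B}) = D(\mathcal{S}_{A:B}\,\|\,\rho_{AB}), \] where $D(\mathcal{S}_{A:B}\|\rho_{AB})=\min_{\sigma_{AB}\in\mathcal{S}_{A:B}}D(\sigma_{AB}\|\rho_{AB})$ is the reverse relative entropy of entanglement.
   Context: $D(\sigma\|\rho)=\mathrm{Tr}\,\sigma(\log\sigma-\log\rho)$ is the Umegaki relative entropy (equal to $+\infty$ if the support of $\sigma$ is not contained in that of $\rho$). $\mathcal{S}_{A:B}$ denotes the set of separable states on $AB$; $\mathcal{S}_{A^n:B^n}$ the separable states on $A^nB^n$ for the cut $A_1\cdots A_n:B_1\cdots B_n$. Let $\Phi_m=|\Phi_+\rangle\langle\Phi_+|^{\otimes m}$, $|\Phi_+\rangle=(|00\rangle+|11\rangle)/\sqrt2$, a state of $m$ qubits for Alice and $m$ for Bob. A channel $\Lambda_n$ from $A^nB^n$ to this $2m$-qubit system is non-entangling (NE) if it maps separable states to separable states. $F(\rho,\sigma)=\|\sqrt\rho\sqrt\sigma\|_1^2$. $E^{(m)}_{d,\mathrm{err}}(\rho_{AB})=\sup\{\liminf_{n}-\tfrac1n\log\varepsilon_n: F(\Lambda_n(\rho_{AB}^{\otimes n}),\Phi_m)\ge1-\varepsilon_n,\ \Lambda_n\in\mathrm{NE}\}$ (supremum over sequences of NE channels) and $E_{d,\mathrm{err}}=\lim_{m\to\infty}E^{(m)}_{d,\mathrm{err}}$.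 $D_H^\varepsilon(\sigma\|\rho)=-\log\min\{\mathrm{Tr}M\rho:0\le M\le\mathbb 1,\ \mathrm{Tr}(\mathbb 1-M)\sigma\le\varepsilon\}$, $D_H^\varepsilon(\mathcal F\|\rho)=\inf_{\sigma\in\mathcal F}D_H^\varepsilon(\sigma\|\rho)$, and $\mathrm{Sanov}(\rho_{AB}\|\mathcal{S}_{A:B})=\lim_{\varepsilon\to0^+}\liminf_{n\to\infty}\tfrac1nD_H^\varepsilon(\mathcal{S}_{A^n:B^n}\|\rho_{AB}^{\otimes n})$. *)

(* Defs.v *)
From Stdlib Require Import ClassicalEpsilon.
From mathcomp Require Import all_boot all_order all_algebra.
From mathcomp Require Import all_classical all_reals all_analysis.
From mathcomp Require Import complex.
Set Implicit Arguments. Unset Strict Implicit. Unset Printing Implicit Defensive.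
Import Order.TTheory GRing.Theory Num.Theory.
Local Open Scope ring_scope.
Local Open Scope classical_set_scope.

Section QDefs.
Variable R : realType.
Local Notation C := R[i].

Definition rC (x : R) : C := Complex x 0.

Definition op (T : finType) := T -> T -> C.

Definition opmul (T : finType) (X Y : op T) : op T :=
  fun i j => \sum_(k : T) X i k * Y k j.
Definition opadd (T : finType) (X Y : op T) : op T := fun i j => X i j + Y i j.
Definition opopp (T : finType) (X : op T) : op T := fun i j => - X i j.
Definition opscale (T : finType) (a : C) (X : op T) : op T := fun i j => a * X i j.
Definition opid (T : finType) : op T := fun i j => if i == j then 1 else 0.
Definition opadj (T : finType) (X : op T) : op T := fun i j => conjc (X j i).
Definition optr (T : finType) (X : op T) : C := \sum_(i : T) X i i.
(* real part of the trace (the trace is real in all uses below) *)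
Definition rtr (T : finType) (X : op T) : R := complex.Re (optr X).
Definition opapp (T : finType) (X : op T) (v : T -> C) : T -> C :=
  fun i => \sum_(j : T) X i j * v j.
Definition ketbra (T : finType) (u v : T -> C) : op T := fun i j => u i * conjc (v j).

Definition hermitian (T : finType) (X : op T) : Prop := opadj X = X.
Definition psd (T : finType) (X : op T) : Prop :=
  hermitian X /\
  forall v : T -> C, 0 <= complex.Re (\sum_(i : T) conjc (v i) * opapp X v i)
                     /\ complex.Im (\sum_(i : T) conjc (v i) * opapp X v i) = 0.
Definition state (T : finType) (X : op T) : Prop := psd X /\ optr X = 1.

Definition supp_incl (T : finType) (X Y : op T) : Prop :=
  forall v : T -> C, (exists w, opapp X w = v) -> (exists w, opapp Y w = v).

Definition spectral_dec (T : finType) (X : op T) (d : (T -> R) * (T -> T -> C)) : Prop :=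
  (forall s t : T, \sum_(i : T) conjc (d.2 s i) * d.2 t i = if s == t then 1 else 0) /\
  X = (fun i j => \sum_(t : T) rC (d.1 t) * ketbra (d.2 t) (d.2 t) i j).

Definition some_spectral_dec (T : finType) (X : op T) : (T -> R) * (T -> T -> C) :=
  epsilon (inhabits ((fun _ => 0), (fun _ _ => 0))) (spectral_dec X).

(* f(X) := \sum_t f(lam_t) |u_t><u_t| (independent of the chosen
   decomposition for Hermitian X) *)
Definition fcalc (T : finType) (f : R -> R) (X : op T) : op T :=
  let d := some_spectral_dec X in
  fun i j => \sum_(t : T) rC (f (d.1 t)) * ketbra (d.2 t) (d.2 t) i j.

(* logarithm on the support (eigenvalue 0 is sent to 0: 0 log 0 = 0) *)
Definition oplog (T : finType) (X : op T) : op T :=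
  fcalc (fun x => if 0 < x then ln x else 0) X.
Definition opsqrt (T : finType) (X : op T) : op T := fcalc (@Num.sqrt R) X.

Definition relent (T : finType) (s r : op T) : \bar R :=
  if `[< supp_incl s r >] then
    (rtr (opmul s (opadd (oplog s) (opopp (oplog r)))))%:E
  else +oo%E.

Definition trnorm (T : finType) (X : op T) : R := rtr (opsqrt (opmul (opadj X) X)).
Definition fidelity (T : finType) (r s : op T) : R :=
  trnorm (opmul (opsqrt r) (opsqrt s)) ^+ 2.

Definition tens (X Y : finType) (a : op X) (b : op Y) : op (X * Y)%type :=
  fun xy xy' => a xy.1 xy'.1 * b xy.2 xy'.2.

Definition separable (X Y : finType) (s : op (X * Y)%type) : Prop :=
  exists (K : nat) (p : 'I_K -> R) (a : 'I_K -> op X) (b : 'I_K -> op Y),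
    (forall k, 0 <= p k) /\ \sum_(k < K) p k = 1 /\
    (forall k, state (a k) /\ state (b k)) /\
    s = (fun xy xy' => \sum_(k < K) rC (p k) * tens (a k) (b k) xy xy').

Definition An (A : finType) (n : nat) := {ffun 'I_n -> A}.

(* rho^{\otimes n}, written on (A_1...A_n)(B_1...B_n) *)
Definition tpow (A B : finType) (rho : op (A * B)%type) (n : nat) : op (An A n * An B n)%type :=
  fun ab ab' => \prod_(k < n) rho (ab.1 k, ab.2 k) (ab'.1 k, ab'.2 k).

(* m qubits for Alice and m for Bob; Phi_m = |Phi_+><Phi_+|^{\otimes m} *)
Definition qubits (m : nat) := An bool m.
Definition Phi (m : nat) : op (qubits m * qubits m)%type :=
  fun ab ab' => \prod_(k < m)
    (if (ab.1 k == ab.2 k) && (ab'.1 k == ab'.2 k) then rC (2^-1) else 0).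

Definition linear_map (X Y : finType) (L : op X -> op Y) : Prop :=
  forall (a : C) (P Q : op X), L (opadd (opscale a P) Q) = opadd (opscale a (L P)) (L Q).
Definition trace_preserving (X Y : finType) (L : op X -> op Y) : Prop :=
  forall P : op X, optr (L P) = optr P.
(* L \otimes id_k *)
Definition ampl (X Y : finType) (L : op X -> op Y) (k : nat) :
  op (X * 'I_k)%type -> op (Y * 'I_k)%type :=
  fun P yi yi' => L (fun x x' => P (x, yi.2) (x', yi'.2)) yi.1 yi'.1.
Definition positive_map (X Y : finType) (L : op X -> op Y) : Prop :=
  forall P, psd P -> psd (L P).
Definition completely_positive (X Y : finType) (L : op X -> op Y) : Prop :=
  forall k : nat, positive_map (@ampl X Y L k).
Definition channel (X Y : finType) (L : op X -> op Y) : Prop :=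
  linear_map L /\ trace_preserving L /\ completely_positive L.

Definition non_entangling (X1 Y1 X2 Y2 : finType) (L : op (X1 * Y1)%type -> op (X2 * Y2)%type) : Prop :=
  channel L /\ forall s, separable s -> separable (L s).

Definition rate (n : nat) (eps : R) : \bar R :=
  if eps <= 0 then +oo%E else ((- ln eps) / n%:R)%:E.

Definition Ed_err_m (A B : finType) (rho : op (A * B)%type) (m : nat) : \bar R :=
  ereal_sup [set v | exists (L : forall n : nat,
                                 op (An A n * An B n)%type -> op (qubits m * qubits m)%type)
                            (eps : nat -> R),
     (forall n, non_entangling (L n)) /\
     (forall n, fidelity (L n (@tpow A B rho n)) (@Phi m) >= 1 - eps n) /\
     v = limn_einf (fun n => rate n (eps n))].

Definition eneglog (x : R) : \bar R := if x <= 0 then +oo%E else (- ln x)%:E.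

Definition DH (T : finType) (eps : R) (s r : op T) : \bar R :=
  eneglog (inf [set x | exists M : op T,
     psd M /\ psd (opadd (@opid T) (opopp M)) /\
     rtr (opmul (opadd (@opid T) (opopp M)) s) <= eps /\
     x = rtr (opmul M r)]).

Definition DH_sep (A B : finType) (eps : R) (rho : op (A * B)%type) (n : nat) : \bar R :=
  ereal_inf [set DH eps s (@tpow A B rho n) | s in [set s | separable s]].

(* eps |-> liminf_n (1/n) D_H^eps(S_{A^n:B^n} || rho^{\otimes n});
   Sanov(rho || S_{A:B}) is its limit as eps -> 0+ *)
Definition sanov_eps (A B : finType) (rho : op (A * B)%type) (eps : R) : \bar R :=
  limn_einf (fun n => ((n%:R)^-1)%:E * DH_sep eps rho n)%E.

Definition rev_rel_ent (A B : finType) (rho : op (A * B)%type) : \bar R :=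
  ereal_inf [set relent s rho | s in [set s | separable s]].

End QDefs.

(* Main.v *)
(** Achievability.  A near-minimiser of [D(s || rho + eta)] over the separable states [s]
    supplies a positive [y] such that [ln y - ln (rho + eta)] has expectation at least [c] on
    every separable state, and this bound is additive on [k] copies.  Pinching [y^(x)k] with
    respect to the polynomially many eigenvalues of [(rho + eta)^(x)k] makes the two logarithms
    commute, which leaves an observable [T] with [tr rho^(x)k exp T <= 1] and
    [tr s T >= k c - O(log k)].  On many blocks of length [k] the total value of [T] is tested
    against a threshold.  Chernoff's bound applies to arbitrary, correlated separable states
    because [exp (- e T)] is close to the identity for small [e], hence lies in the cone of
    separable operators: measuring it on one block leaves a separable state on the others.
    The outcome of the test decides between preparing [Phi_m] and preparing an orthogonal
    separable state; this channel is non-entangling since a small admixture of [Phi_m] keeps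
    that state separable.

    Converse.  For a fixed separable [s] the Nussbaum-Szkola distributions and Markov's
    inequality show that a test with error below a constant on [s^(x)n] has probability at
    least [exp (- n (D(s || rho) + del))] on [rho^(x)n].  A non-entangling channel gives such a
    test as soon as [2^-m] is below the constant, because separable states have overlap at
    most [2^-m] with [Phi_m]. *)
Require Import Defs.
From mathcomp Require Import all_boot all_order all_algebra.
From mathcomp Require Import all_classical all_reals all_analysis.
From mathcomp Require Import complex.
From mathcomp Require Import zify ring lra.
Set Implicit Arguments. Unset Strict Implicit. Unset Printing Implicit Defensive.
Import Order.TTheory GRing.Theory Num.Theory numFieldNormedType.Exports.
Local Open Scope ring_scope.
Local Open Scope classical_set_scope.
Import Defs.

(** * Operators on a finite-dimensional space *)

(** Separable states on [n] copies may be correlated, so the worst state cannot be assumed to be a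
    product: every bound has to be linear in the state and to survive conditioning on other copies.
    Hence the search for a single dual operator, and the demand that the exponentiated observable
    lie in the separable cone. What is available is that the identity is an interior point of that
    cone. The width around it depends on the block length [k], so [k] is fixed first, the exponent
    is scaled next, and only then does the number of blocks grow. Pinching is needed because [ln y]
    and [ln (rho + eta)] have no common eigenbasis, while a test is read off from eigenvalues. The
    shift by [eta] keeps the logarithm finite on the kernel of [rho]; compactness of the separable
    states shows that a small shift is harmless, also when the minimum is infinite. In place of a
    minimax theorem, first-order optimality of a near-minimiser, combined with operator monotonicity
    of [ln], gives the dual operator. Both limits are approached from above: the lower bounds hold
    for every [m >= 1] and every [eps > 0], and only the converse uses the limits. *)

Section ComplexScalars.
Variable R : realType.
Local Notation C := R[i].
Implicit Types z w : C.

Lemma ReD z w : complex.Re (z + w) = complex.Re z + complex.Re w.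
Proof. by case: z; case: w. Qed.

Lemma ReN z : complex.Re (- z) = - complex.Re z.
Proof. by case: z. Qed.

Lemma Re_sum (I : Type) (r : seq I) (P : pred I) (F : I -> C) :
  complex.Re (\sum_(i <- r | P i) F i) = \sum_(i <- r | P i) complex.Re (F i).
Proof. by elim/big_rec2: _ => //= i x y _ <-; rewrite ReD. Qed.

Lemma rCE (x : R) : rC x = real_complex R x. Proof. by []. Qed.

Lemma rC0 : rC (0 : R) = 0. Proof. by []. Qed.
Lemma rC1 : rC (1 : R) = 1. Proof. by []. Qed.
Lemma rCD (x y : R) : rC (x + y) = rC x + rC y.
Proof. by rewrite !rCE rmorphD. Qed.
Lemma rCN (x : R) : rC (- x) = - rC x.
Proof. by rewrite !rCE rmorphN. Qed.
Lemma rCM (x y : R) : rC (x * y) = rC x * rC y.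
Proof. by rewrite !rCE rmorphM. Qed.
Lemma rC_sum (I : Type) (r : seq I) (P : pred I) (F : I -> R) :
  rC (\sum_(i <- r | P i) F i) = \sum_(i <- r | P i) rC (F i).
Proof. by rewrite rCE rmorph_sum. Qed.
Lemma rC_prod (I : Type) (r : seq I) (P : pred I) (F : I -> R) :
  rC (\prod_(i <- r | P i) F i) = \prod_(i <- r | P i) rC (F i).
Proof. by rewrite rCE rmorph_prod. Qed.
Lemma rC_inj : injective (@rC R).
Proof. by move=> x y []. Qed.

Lemma Re_rCM (x : R) z : complex.Re (rC x * z) = x * complex.Re z.
Proof. by case: z => a b /=; rewrite mul0r subr0. Qed.

Lemma conjc_rC (x : R) : conjc (rC x) = rC x.
Proof. by rewrite /rC /= oppr0. Qed.

Lemma conjc_fix z : conjc z = z -> z = rC (complex.Re z).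
Proof.
case: z => a b /= [] h; congr Complex.
lra.
Qed.

Lemma conjc_sum (I : Type) (r : seq I) (P : pred I) (F : I -> C) :
  @conjc R (\sum_(i <- r | P i) F i) = \sum_(i <- r | P i) conjc (F i).
Proof. by rewrite rmorph_sum. Qed.

Lemma conjcM z w : @conjc R (z * w) = conjc z * conjc w.
Proof. exact: rmorphM. Qed.
Lemma conjcD z w : @conjc R (z + w) = conjc z + conjc w.
Proof. exact: rmorphD. Qed.
Lemma conjcN z : @conjc R (- z) = - conjc z.
Proof. exact: rmorphN. Qed.

Lemma conjc_if (b : bool) : @conjc R (if b then 1 else 0 : C) = if b then 1 else 0.
Proof. by case: b; rewrite ?conjc1 ?conjc0. Qed.

Definition nsq z : R := complex.Re z ^+ 2 + complex.Im z ^+ 2.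

Lemma nsq_ge0 z : 0 <= nsq z.
Proof. by rewrite addr_ge0 ?sqr_ge0. Qed.

Lemma mulJc z : conjc z * z = rC (nsq z).
Proof. by case: z => a b; rewrite /nsq /rC; simpc; congr Complex; rewrite /=; ring. Qed.

Lemma mulcJ z : z * conjc z = rC (nsq z).
Proof. by rewrite mulrC mulJc. Qed.

Lemma nsq_eq0 z : (nsq z == 0) = (z == 0).
Proof.
case: z => a b; rewrite /nsq /= paddr_eq0 ?sqr_ge0 // !sqrf_eq0.
by rewrite eq_complex /=.
Qed.

Lemma nsqM z w : nsq (z * w) = nsq z * nsq w.
Proof. by case: z => a b; case: w => c d; rewrite /nsq /=; ring. Qed.

Lemma nsqJ z : nsq (conjc z) = nsq z.
Proof. by case: z => a b; rewrite /nsq /= sqrrN. Qed.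

Lemma nsq_rC (x : R) : nsq (rC x) = x ^+ 2.
Proof. by rewrite /nsq /= expr0n addr0. Qed.

Lemma nsqD_le z w : nsq (z + w) <= 2 * (nsq z + nsq w).
Proof.
case: z => a b; case: w => c d; rewrite /nsq /= -subr_ge0.
have -> : 2 * (a ^+ 2 + b ^+ 2 + (c ^+ 2 + d ^+ 2)) - ((a + c) ^+ 2 + (b + d) ^+ 2)
  = (a - c) ^+ 2 + (b - d) ^+ 2 by ring.
by rewrite addr_ge0 ?sqr_ge0.
Qed.

Lemma complexP z w : complex.Re z = complex.Re w -> complex.Im z = complex.Im w -> z = w.
Proof. by case: z => a b; case: w => c d /= -> ->. Qed.

Lemma sum_delta (T : finType) (V : pzSemiRingType) (i : T) (F : T -> V) :
  \sum_j (if i == j then 1 else 0) * F j = F i.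
Proof.
rewrite (bigD1 i) //= eqxx mul1r big1 ?addr0 // => j /negbTE h.
by rewrite eq_sym h mul0r.
Qed.

Lemma sum_delta2 (T : finType) (V : pzSemiRingType) (i : T) (F : T -> V) :
  \sum_j F j * (if j == i then 1 else 0) = F i.
Proof.
rewrite (bigD1 i) //= eqxx mulr1 big1 ?addr0 // => j /negbTE h.
by rewrite h mulr0.
Qed.

End ComplexScalars.

Lemma sum_enum_val (T : finType) (V : nmodType) (F : T -> V) :
  \sum_i F i = \sum_(k < #|T|) F (enum_val k).
Proof. exact: (reindex _ (onW_bij _ (@enum_val_bij T))). Qed.

Section Basics.
Variable R : realType.
Local Notation C := R[i].
Local Notation op := (@op R).

Section OneSpace.
Variable T : finType.
Implicit Types (v x y : T -> C) (X Y : op T).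

Definition ip u v : C := \sum_i conjc (u i) * v i.
Definition qf X v : R := complex.Re (ip v (opapp X v)).
Definition nrm v : R := \sum_i nsq (v i).

Lemma ipC u v : conjc (ip u v) = ip v u.
Proof.
by rewrite /ip conjc_sum; apply: eq_bigr => i _; rewrite conjcM conjcK mulrC.
Qed.

Lemma ip_nrm v : ip v v = rC (nrm v).
Proof. by rewrite /ip rC_sum; apply: eq_bigr => i _; rewrite mulJc. Qed.

Lemma nrm_ge0 v : 0 <= nrm v.
Proof. by apply: sumr_ge0 => i _; exact: nsq_ge0. Qed.

Lemma ip_sumr (I : Type) (r : seq I) (P : pred I) u (c : I -> C) (v : I -> T -> C) :
  ip u (fun i => \sum_(k <- r | P k) c k * v k i) = \sum_(k <- r | P k) c k * ip u (v k).
Proof.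
rewrite /ip; under eq_bigr do rewrite mulr_sumr.
rewrite exchange_big /=; apply: eq_bigr => k _; rewrite mulr_sumr.
by apply: eq_bigr => i _; ring.
Qed.

Lemma ipDr u v y : ip u (fun i => v i + y i) = ip u v + ip u y.
Proof. by rewrite /ip -big_split; apply: eq_bigr => i _; rewrite mulrDr. Qed.
Lemma ipDl u v y : ip (fun i => v i + y i) u = ip v u + ip y u.
Proof. by rewrite -[LHS]ipC ipDr conjcD !ipC. Qed.
Lemma ipZr u c v : ip u (fun i => c * v i) = c * ip u v.
Proof. by rewrite /ip mulr_sumr; apply: eq_bigr => i _; ring. Qed.
Lemma ipZl u c v : ip (fun i => c * v i) u = conjc c * ip v u.
Proof. by rewrite -[LHS]ipC ipZr conjcM !ipC. Qed.

Lemma ip_adj X u v : ip u (opapp X v) = ip (opapp (opadj X) u) v.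
Proof.
rewrite /ip /opapp /opadj.
under eq_bigr do rewrite mulr_sumr.
rewrite exchange_big /=; apply: eq_bigr => i _.
rewrite conjc_sum mulr_suml; apply: eq_bigr => j _.
by rewrite conjcM conjcK; ring.
Qed.

Lemma opapp_mul X Y v : opapp (opmul X Y) v = opapp X (opapp Y v).
Proof.
apply: funext => i; rewrite /opapp /opmul.
under eq_bigr do rewrite mulr_suml.
rewrite exchange_big /=; apply: eq_bigr => j _; rewrite mulr_sumr.
by apply: eq_bigr => k _; rewrite mulrA.
Qed.

Lemma opapp_id v : opapp (@opid R T) v = v.
Proof. by apply: funext => i; rewrite /opapp /opid sum_delta. Qed.

Lemma opmulA X Y (Z : op T) : opmul X (opmul Y Z) = opmul (opmul X Y) Z.
Proof.
apply: funext => i; apply: funext => j; rewrite /opmul.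
under eq_bigr do rewrite mulr_sumr.
rewrite exchange_big /=; apply: eq_bigr => k _; rewrite mulr_suml.
by apply: eq_bigr => l _; rewrite mulrA.
Qed.

Lemma opadjM X Y : opadj (opmul X Y) = opmul (opadj Y) (opadj X).
Proof.
apply: funext => i; apply: funext => j; rewrite /opadj /opmul conjc_sum.
by apply: eq_bigr => k _; rewrite conjcM mulrC.
Qed.

Lemma optr_mulC X Y : optr (opmul X Y) = optr (opmul Y X).
Proof.
rewrite /optr /opmul exchange_big /=.
by apply: eq_bigr => i _; apply: eq_bigr => j _; rewrite mulrC.
Qed.

Lemma hermitianP X : hermitian X -> forall i j, conjc (X j i) = X i j.
Proof. by move=> h i j; rewrite -{2}h. Qed.

Lemma ip_herm X u v : hermitian X -> ip u (opapp X v) = ip (opapp X u) v.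
Proof. by move=> h; rewrite ip_adj h. Qed.

Lemma qfE X v : hermitian X -> ip v (opapp X v) = rC (qf X v).
Proof. by move=> h; apply: conjc_fix; rewrite ipC -ip_herm. Qed.

Lemma psd_herm X : psd X -> hermitian X. Proof. by case. Qed.
Lemma psd_qf X v : psd X -> 0 <= qf X v. Proof. by case=> _ /(_ v) []. Qed.
Lemma psdP X : hermitian X -> (forall v, 0 <= qf X v) -> psd X.
Proof.
move=> hX h; split=> // v; split; first exact: h.
by rewrite -/(ip v (opapp X v)) qfE.
Qed.

(** Common form of spectral decompositions, mixtures and pinchings; real coefficients preserve
    hermiticity. *)
Definition osum (I : finType) (c : I -> R) (X : I -> op T) : op T :=
  fun i j => \sum_k rC (c k) * X k i j.

Lemma qf_osum (I : finType) (c : I -> R) (X : I -> op T) v :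
  qf (osum c X) v = \sum_k c k * qf (X k) v.
Proof.
rewrite /qf.
have -> : opapp (osum c X) v = fun i => \sum_k rC (c k) * opapp (X k) v i.
  apply: funext => i; rewrite /opapp /osum.
  under eq_bigr do rewrite mulr_suml.
  rewrite exchange_big /=; apply: eq_bigr => k _; rewrite mulr_sumr.
  by apply: eq_bigr => l _; rewrite mulrA.
by rewrite ip_sumr Re_sum; apply: eq_bigr => k _; rewrite Re_rCM.
Qed.

Lemma herm_osum (I : finType) (c : I -> R) (X : I -> op T) :
  (forall k, hermitian (X k)) -> hermitian (osum c X).
Proof.
move=> h; apply: funext => i; apply: funext => j; rewrite /opadj /osum conjc_sum.
by apply: eq_bigr => k _; rewrite conjcM conjc_rC hermitianP.
Qed.

Lemma psd_osum (I : finType) (c : I -> R) (X : I -> op T) :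
  (forall k, 0 <= c k) -> (forall k, psd (X k)) -> psd (osum c X).
Proof.
move=> hc h; apply: psdP; first by apply: herm_osum => k; case: (h k).
by move=> v; rewrite qf_osum; apply: sumr_ge0 => k _; rewrite mulr_ge0 ?psd_qf.
Qed.

Lemma qfD X Y v : qf (opadd X Y) v = qf X v + qf Y v.
Proof.
rewrite /qf -ReD -ipDr; congr (complex.Re (ip _ _)); apply: funext => i.
by rewrite /opapp -big_split; apply: eq_bigr => j _; rewrite mulrDl.
Qed.
Lemma qfN X v : qf (opopp X) v = - qf X v.
Proof.
rewrite /qf -ReN; congr (complex.Re _); rewrite /ip -sumrN; apply: eq_bigr => i _.
rewrite -mulrN; congr (_ * _); rewrite /opapp -sumrN.
by apply: eq_bigr => j _; rewrite mulNr.
Qed.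
Lemma qfZ a X v : qf (opscale (rC a) X) v = a * qf X v.
Proof.
rewrite /qf -Re_rCM -ipZr; congr (complex.Re (ip _ _)); apply: funext => i.
by rewrite /opapp mulr_sumr; apply: eq_bigr => j _; rewrite mulrA.
Qed.
Lemma qf_id v : qf (@opid R T) v = nrm v.
Proof. by rewrite /qf opapp_id ip_nrm. Qed.
Lemma qf_ketbra (u : T -> C) v : qf (ketbra u u) v = nsq (ip u v).
Proof.
rewrite /qf.
have -> : opapp (ketbra u u) v = fun i => ip u v * u i.
  apply: funext => i; rewrite /opapp /ip mulr_suml.
  by apply: eq_bigr => j _; rewrite /ketbra; ring.
by rewrite ipZr -(ipC u v) mulcJ.
Qed.
Lemma hermD X Y : hermitian X -> hermitian Y -> hermitian (opadd X Y).
Proof.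
move=> hX hY; apply: funext => i; apply: funext => j.
by rewrite /opadj /opadd conjcD !hermitianP.
Qed.
Lemma hermN X : hermitian X -> hermitian (opopp X).
Proof.
move=> hX; apply: funext => i; apply: funext => j.
by rewrite /opadj /opopp conjcN !hermitianP.
Qed.
Lemma hermZ a X : hermitian X -> hermitian (opscale (rC a) X).
Proof.
move=> hX; apply: funext => i; apply: funext => j.
by rewrite /opadj /opscale conjcM conjc_rC !hermitianP.
Qed.
Lemma herm_id : hermitian (@opid R T).
Proof.
by apply: funext => i; apply: funext => j; rewrite /opadj /opid conjc_if eq_sym.
Qed.
Lemma herm_ketbra (u : T -> C) : hermitian (ketbra u u).
Proof.
by apply: funext => i; apply: funext => j; rewrite /opadj /ketbra conjcM conjcK mulrC.
Qed.
Lemma psdD X Y : psd X -> psd Y -> psd (opadd X Y).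
Proof.
move=> hX hY; apply: psdP; first by apply: hermD; apply: psd_herm.
by move=> v; rewrite qfD addr_ge0 ?psd_qf.
Qed.
Lemma psdZ a X : 0 <= a -> psd X -> psd (opscale (rC a) X).
Proof.
move=> ha hX; apply: psdP; first by apply: hermZ; apply: psd_herm.
by move=> v; rewrite qfZ mulr_ge0 ?psd_qf.
Qed.
Lemma psd_id : psd (@opid R T).
Proof. by apply: psdP; [exact: herm_id|move=> v; rewrite qf_id nrm_ge0]. Qed.
Lemma psd_ketbra (u : T -> C) : psd (ketbra u u).
Proof.
by apply: psdP; [exact: herm_ketbra|move=> v; rewrite qf_ketbra nsq_ge0].
Qed.

(* Orthonormal and indexed by T itself, hence a basis. *)
Definition onb (u : T -> T -> C) :=
  forall s t, ip (u s) (u t) = if s == t then 1 else 0.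
Definition spec (a : T -> R) (u : T -> T -> C) : op T :=
  osum a (fun t => ketbra (u t) (u t)).

(** For square matrices [U V = 1] forces [V U = 1], which turns orthonormality into a resolution of
    the identity. *)
Lemma onb_complete u : onb u ->
  forall i j, \sum_t u t i * conjc (u t j) = if i == j then 1 else 0.
Proof.
move=> hu i j.
pose U : 'M[C]_#|T| := \matrix_(t, i) conjc (u (enum_val t) (enum_val i)).
pose V : 'M[C]_#|T| := \matrix_(i, t) u (enum_val t) (enum_val i).
have UV : U *m V = 1%:M.
  apply/matrixP => s t; rewrite !mxE.
  have := hu (enum_val s) (enum_val t).
  rewrite /ip sum_enum_val (inj_eq enum_val_inj) => E.
  transitivity (if s == t then 1 else 0 : C); last by case: eqP.
  by rewrite -E; apply: eq_bigr => k _; rewrite !mxE.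
have /matrixP/(_ (enum_rank i) (enum_rank j)) := mulmx1C UV.
rewrite !mxE (inj_eq enum_rank_inj) => E.
transitivity ((i == j)%:R : C); last by case: eqP.
rewrite -E sum_enum_val; apply: eq_bigr => k _.
by rewrite !mxE !enum_rankK.
Qed.

Lemma onb_expand u v : onb u -> v = fun i => \sum_t ip (u t) v * u t i.
Proof.
move=> hu; apply: funext => i.
rewrite /ip; under eq_bigr do rewrite mulr_suml.
rewrite exchange_big /= -[LHS](sum_delta2 i v).
apply: eq_bigr => j _; rewrite eq_sym -(onb_complete hu i j) mulr_sumr.
by apply: eq_bigr => t _; ring.
Qed.

Lemma parseval2 u v x : onb u -> ip v x = \sum_t ip v (u t) * ip (u t) x.
Proof.
move=> hu; rewrite {1}(onb_expand x hu) ip_sumr.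
by apply: eq_bigr => t _; rewrite mulrC.
Qed.

Lemma parseval u v : onb u -> nrm v = \sum_t nsq (ip (u t) v).
Proof.
move=> hu; apply: rC_inj; rewrite -ip_nrm (parseval2 _ _ hu) rC_sum.
by apply: eq_bigr => t _; rewrite -mulJc ipC.
Qed.

Lemma onb_nrm u t : onb u -> nrm (u t) = 1.
Proof. by move=> hu; apply: rC_inj; rewrite -ip_nrm hu eqxx. Qed.

Lemma qf_spec a u v : qf (spec a u) v = \sum_t a t * nsq (ip (u t) v).
Proof. by rewrite qf_osum; apply: eq_bigr => t _; rewrite qf_ketbra. Qed.

Lemma herm_spec a u : hermitian (spec a u).
Proof. by apply: herm_osum => t; exact: herm_ketbra. Qed.

Lemma psd_spec a u : (forall t, 0 <= a t) -> psd (spec a u).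
Proof. by move=> h; apply: psd_osum => // t; exact: psd_ketbra. Qed.

Lemma spec_app a u v : opapp (spec a u) v = fun i => \sum_t rC (a t) * ip (u t) v * u t i.
Proof.
apply: funext => i; rewrite /opapp /spec /osum.
under eq_bigr do rewrite mulr_suml.
rewrite exchange_big /=; apply: eq_bigr => t _.
rewrite /ip mulr_sumr mulr_suml; apply: eq_bigr => j _; rewrite /ketbra; ring.
Qed.

Lemma spec_eigen a u t : onb u -> opapp (spec a u) (u t) = fun i => rC (a t) * u t i.
Proof.
move=> hu; rewrite spec_app; apply: funext => i.
rewrite (bigD1 t) //= hu eqxx mulr1 big1 ?addr0 // => s /negbTE h.
by rewrite hu h mulr0 mul0r.
Qed.

Lemma qf_spec_basis a u t : onb u -> qf (spec a u) (u t) = a t.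
Proof.
by move=> hu; rewrite /qf spec_eigen // ipZr hu eqxx mulr1.
Qed.

Lemma psd_spec_ge0 a u t : onb u -> psd (spec a u) -> 0 <= a t.
Proof. by move=> hu /(psd_qf (u t)); rewrite qf_spec_basis. Qed.

Lemma spec1 u : onb u -> spec (fun=> 1) u = @opid R T.
Proof.
move=> hu; apply: funext => i; apply: funext => j; rewrite /spec /osum /opid.
by rewrite -(onb_complete hu); apply: eq_bigr => t _; rewrite mul1r.
Qed.

Lemma specD a b u : opadd (spec a u) (spec b u) = spec (fun t => a t + b t) u.
Proof.
apply: funext => i; apply: funext => j; rewrite /spec /osum /opadd -big_split.
by apply: eq_bigr => t _; rewrite rCD mulrDl.
Qed.

Lemma op_ext_onb X Y u : onb u -> (forall t, opapp X (u t) = opapp Y (u t)) -> X = Y.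
Proof.
move=> hu h; apply: funext => i; apply: funext => j.
have E (Z : op T) : Z i j = \sum_t opapp Z (u t) i * conjc (u t j).
  rewrite /opapp; under eq_bigr do rewrite mulr_suml.
  rewrite exchange_big /= -[LHS](sum_delta2 j (Z i)).
  apply: eq_bigr => k _; rewrite -(onb_complete hu) mulr_sumr.
  by apply: eq_bigr => t _; rewrite mulrA.
by rewrite !E; apply: eq_bigr => t _; rewrite h.
Qed.

Lemma specM a b u : onb u -> opmul (spec a u) (spec b u) = spec (fun t => a t * b t) u.
Proof.
move=> hu; apply: (op_ext_onb hu) => t.
rewrite opapp_mul !spec_eigen //; apply: funext => i.
rewrite {1}/opapp; under eq_bigr do rewrite mulrCA.
rewrite -mulr_sumr.
have -> : \sum_j spec a u i j * u t j = opapp (spec a u) (u t) i by [].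
by rewrite spec_eigen // rCM; ring.
Qed.

Lemma optr_onb X u : onb u -> optr X = \sum_t ip (u t) (opapp X (u t)).
Proof.
move=> hu; rewrite /ip /opapp.
under eq_bigr do under eq_bigr do rewrite mulr_sumr.
rewrite exchange_big /= /optr; apply: eq_bigr => i _.
rewrite exchange_big /= -[LHS](sum_delta2 i (X i)); apply: eq_bigr => j _.
rewrite -(onb_complete hu) mulr_sumr.
by apply: eq_bigr => t _; ring.
Qed.

Lemma rtr_onb X u : onb u -> rtr X = \sum_t qf X (u t).
Proof. by move=> hu; rewrite /rtr (optr_onb _ hu) Re_sum. Qed.

Lemma rtr_mul_spec X a u : onb u -> rtr (opmul X (spec a u)) = \sum_t a t * qf X (u t).
Proof.
move=> hu; rewrite (rtr_onb _ hu); apply: eq_bigr => t _.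
rewrite /qf opapp_mul spec_eigen //.
have -> : opapp X (fun i => rC (a t) * u t i) = fun i => rC (a t) * opapp X (u t) i.
  by apply: funext => i; rewrite /opapp mulr_sumr; apply: eq_bigr => j _; ring.
by rewrite ipZr Re_rCM.
Qed.

Lemma onb_std : onb (fun s i => if s == i then 1 else 0).
Proof.
move=> s t; rewrite /ip; under eq_bigr do rewrite conjc_if.
by rewrite sum_delta eq_sym.
Qed.

Lemma optr_herm X : hermitian X -> optr X = rC (rtr X).
Proof.
move=> h; apply: conjc_fix; rewrite /optr conjc_sum.
by apply: eq_bigr => i _; rewrite hermitianP.
Qed.

Lemma psd_rtr_ge0 X : psd X -> 0 <= rtr X.
Proof.
by move=> h; rewrite (rtr_onb _ onb_std); apply: sumr_ge0 => t _; exact: psd_qf.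
Qed.

End OneSpace.
End Basics.

(** * Spectral theorem, operator monotonicity of the logarithm, Klein's inequality *)

Section SpectralTheorem.
Variable R : realType.
Local Notation C := R[i].
Local Notation op := (@op R).
Variable T : finType.
Implicit Types (X Y : op T).

(** The spectral theorem for normal matrices, transported along the enumeration of [T]. The normal
    case is what joint diagonalisation of two Hermitian operators calls for. *)
Lemma normal_spectral (N : op T) : opmul N (opadj N) = opmul (opadj N) N ->
  exists (l : T -> C) (u : T -> T -> C), onb u /\
    N = fun i j => \sum_t l t * ketbra (u t) (u t) i j.
Proof.
move=> hN.
pose A : 'M[C]_#|T| := \matrix_(i, j) N (enum_val i) (enum_val j).
have nA : A \is normalmx.
  apply/normalmxP/matrixP => i j; rewrite !mxE.
  have /(congr1 (fun M : op T => M (enum_val i) (enum_val j))) := hN.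
  rewrite /opmul => E; rewrite sum_enum_val [RHS]sum_enum_val in E.
  transitivity (\sum_(k < #|T|) N (enum_val i) (enum_val k) *
                  opadj N (enum_val k) (enum_val j)).
    by apply: eq_bigr => k _; rewrite !mxE.
  by rewrite E; apply: eq_bigr => k _; rewrite !mxE.
pose P := spectralmx A.
have uP : P *m (P ^t (@Num.conj C))%sesqui = 1%:M.
  by apply/unitarymxP; exact: spectral_unitarymx.
have EA := orthomx_spectralP nA.
rewrite invmx_unitary ?spectral_unitarymx // in EA.
exists (fun t => spectral_diag A 0 (enum_rank t)).
(* The eigenvectors are the columns of the adjoint of [P], hence the conjugated rows of [P]. *)
exists (fun t i => conjc (P (enum_rank t) (enum_rank i))); split.
  move=> s t; have /matrixP/(_ (enum_rank s) (enum_rank t)) := uP.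
  rewrite !mxE (inj_eq enum_rank_inj) => E.
  transitivity ((s == t)%:R : C); last by case: eqP.
  rewrite -E /ip sum_enum_val; apply: eq_bigr => k _.
  by rewrite !mxE !enum_valK conjcK.
apply: funext => i; apply: funext => j.
have /matrixP/(_ (enum_rank i) (enum_rank j)) := EA.
rewrite !mxE !enum_rankK => ->.
rewrite [RHS]sum_enum_val; apply: eq_bigr => k _.
rewrite mxE (bigD1 k) //= big1 ?addr0; last first.
  by move=> l /negbTE hl; rewrite !mxE hl mulr0n mulr0.
rewrite !mxE !enum_valK eqxx mulr1n /ketbra conjcK.
by rewrite mulrCA mulrA.
Qed.

(** Commutation makes [X + iY] normal; an eigenbasis of it diagonalises both operators, with the
    real and imaginary parts of its eigenvalues. *)
Lemma commuting_spectral X Y : hermitian X -> hermitian Y -> opmul X Y = opmul Y X ->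
  exists a b u, onb u /\ X = spec a u /\ Y = spec b u.
Proof.
move=> hX hY hXY.
pose N : op T := fun i j => X i j + 'i%C * Y i j.
have ci : conjc 'i%C = - 'i%C :> C by rewrite /=; congr Complex; rewrite ?oppr0.
have aN : opadj N = fun i j => X i j - 'i%C * Y i j.
  apply: funext => i; apply: funext => j.
  by rewrite /opadj /N conjcD conjcM ci !hermitianP // mulNr.
have [|l [u [hu EN]]] := @normal_spectral N.
  apply: funext => i; apply: funext => j; rewrite aN /N /opmul.
  have /(congr1 (fun M : op T => M i j)) := hXY; rewrite /opmul => E.
  set XX := \sum_k X i k * X k j; set YY := \sum_k Y i k * Y k j.
  transitivity (XX - 'i%C * 'i%C * YY + 'i%C * (\sum_k Y i k * X k j - \sum_k X i k * Y k j)).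
    rewrite /XX /YY mulrBr !mulr_sumr -!sumrB -!big_split /=.
    apply: eq_bigr => k _ /=; ring.
  transitivity (XX - 'i%C * 'i%C * YY + 'i%C * (\sum_k X i k * Y k j - \sum_k Y i k * X k j)).
    by rewrite E !subrr.
  rewrite /XX /YY mulrBr !mulr_sumr -!sumrB -!big_split /=.
  by apply: eq_bigr => k _ /=; ring.
exists (fun t => complex.Re (l t)), (fun t => complex.Im (l t)), u; split=> //.
(* Entries of [X + iY] and of its adjoint [X - iY] are both known, and together they determine those
   of [X] and [Y]. *)
have key i j : X i j = spec (fun t => complex.Re (l t)) u i j /\
               Y i j = spec (fun t => complex.Im (l t)) u i j.
  set a' := spec _ u i j; set b' := spec _ u i j.
  have E1 : X i j + 'i%C * Y i j = a' + 'i%C * b'.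
    rewrite -/(N i j) EN /a' /b' /spec /osum mulr_sumr -big_split /=.
    apply: eq_bigr => t _ /=; rewrite mulrA -mulrDl; congr (_ * _).
    by case: (l t) => c d; rewrite /rC; simpc.
  have E2 : X i j - 'i%C * Y i j = a' - 'i%C * b'.
    have -> : X i j - 'i%C * Y i j = conjc (X j i + 'i%C * Y j i).
      by rewrite conjcD conjcM ci !hermitianP // mulNr.
    rewrite -/(N j i) EN conjc_sum /a' /b' /spec /osum mulr_sumr -sumrB.
    apply: eq_bigr => t _ /=; rewrite mulrA -mulrBl conjcM; congr (_ * _).
      by case: (l t) => c d; rewrite /rC; simpc.
    by rewrite /ketbra conjcM conjcK mulrC.
  move: E1 E2; case: (X i j) (Y i j) a' b' => a1 a2 [b1 b2] [a3 a4] [b3 b4].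
  simpc => -[] e1 e2 [] e3 e4.
  by split; congr Complex; lra.
by split; apply: funext => i; apply: funext => j; case: (key i j).
Qed.

Lemma hermitian_spectral X : hermitian X -> exists a u, onb u /\ X = spec a u.
Proof.
move=> hX; have [||a [_ [u [hu [E _]]]]] := @commuting_spectral X (@opid R T) hX.
- exact: herm_id.
- apply: (op_ext_onb (@onb_std R T)) => t.
  by rewrite !opapp_mul !opapp_id.
- by exists a, u.
Qed.

Lemma psd_spectral X : psd X -> exists a u, onb u /\ (forall t, 0 <= a t) /\ X = spec a u.
Proof.
move=> hX; have [a [u [hu E]]] := hermitian_spectral (psd_herm hX).
exists a, u; split=> //; split=> // t; apply: (psd_spec_ge0 _ hu); by rewrite -E.
Qed.

End SpectralTheorem.

Section Monotone.
Variable R : realType.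
Local Notation C := R[i].
Local Notation op := (@op R).
Variable T : finType.
Implicit Types (u w : T -> T -> C) (a b : T -> R).

Lemma nrm_herm_app (X : op T) (v : T -> C) : hermitian X ->
  nrm (opapp X v) = qf (opmul X X) v.
Proof. by move=> hX; rewrite /qf opapp_mul ip_herm // ip_nrm. Qed.

Lemma opappB (X Y : op T) (v : T -> C) :
  opapp (opadd X (opopp Y)) v = fun i => opapp X v i - opapp Y v i.
Proof.
apply: funext => i; rewrite /opapp /opadd /opopp -sumrB.
by apply: eq_bigr => j _; rewrite mulrBl.
Qed.

(** If [A - B] had a unit eigenvector [v] with eigenvalue [c > 0], then [A v = B v + c v], so the
    squared norm of [A v] would exceed that of [B v] by [2 c <v, B v> + c ^ 2 > 0], against
    [A ^ 2 <= B ^ 2]. *)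
Lemma sqrt_op_mono a u b w : onb u -> onb w -> (forall t, 0 <= a t) -> (forall t, 0 <= b t) ->
  (forall x, qf (spec a u) x <= qf (spec b w) x) ->
  forall x, qf (spec (fun t => Num.sqrt (a t)) u) x <= qf (spec (fun t => Num.sqrt (b t)) w) x.
Proof.
move=> hu hw ha hb hab x.
set A := spec _ u; set B := spec _ w.
have AA : opmul A A = spec a u.
  by rewrite specM //; congr spec; apply: funext => t; rewrite -expr2 sqr_sqrtr.
have BB : opmul B B = spec b w.
  by rewrite specM //; congr spec; apply: funext => t; rewrite -expr2 sqr_sqrtr.
have hA : hermitian A by exact: herm_spec.
have hB : hermitian B by exact: herm_spec.
have pB : psd B by apply: psd_spec => t; exact: sqrtr_ge0.
have [c [v [hv E]]] := hermitian_spectral (hermD hA (hermN hB)).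
suff hc t : c t <= 0.
  rewrite -subr_le0 -qfN -qfD E qf_spec; apply: sumr_le0 => t _.
  by rewrite mulr_le0_ge0 ?nsq_ge0.
rewrite leNgt; apply/negP => ct0.
have EA : opapp A (v t) = fun i => opapp B (v t) i + rC (c t) * v t i.
  have := spec_eigen c t hv; rewrite -E opappB => Ei.
  apply: funext => i; have := congr1 (fun f => f i) Ei; rewrite /= => <-.
  by rewrite addrC subrK.
have := hab (v t); rewrite -AA -BB -!nrm_herm_app //.
have -> : nrm (opapp A (v t)) = nrm (opapp B (v t)) + 2 * c t * qf B (v t) + c t ^+ 2.
  apply: rC_inj; rewrite -ip_nrm {1 2}EA ipDl !ipDr !ipZr !ipZl !conjc_rC ip_nrm.
  have -> : ip (v t) (v t) = rC 1 by rewrite hv eqxx.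
  rewrite -(ip_herm _ _ hB) !(qfE _ hB) expr2 -!rCM -!rCD.
  by congr rC; ring.
have := psd_qf (v t) pB; nra.
Qed.

Lemma iter_sqrtE (j : nat) (x : R) : 0 < x ->
  iter j Num.sqrt x = expR (ln x / 2 ^+ j).
Proof.
move=> x0; elim: j => [|j IH]; first by rewrite expr0 divr1 /= lnK.
rewrite iterS IH; apply: (@pexpIrn _ 2) => //; rewrite ?nnegrE ?sqrtr_ge0 ?expR_ge0 //.
rewrite sqr_sqrtr ?expR_ge0 // -expRM_natl; congr expR.
by rewrite exprS invfM mulrCA; field; rewrite ?expf_neq0.
Qed.

Lemma iter_sqrt_ge0 (j : nat) (x : R) : 0 <= x -> 0 <= iter j Num.sqrt x.
Proof. by case: j => //= j _; rewrite sqrtr_ge0. Qed.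

(** The quantities [2 ^ j * (x ^ (1 / 2 ^ j) - 1)] tend to [ln x] from above. They carry operator
    monotonicity from the square root to the logarithm. *)
Lemma ln_le_root (j : nat) (x : R) : 0 < x -> ln x <= 2 ^+ j * (iter j Num.sqrt x - 1).
Proof.
move=> x0; rewrite iter_sqrtE //; set y := ln x / _.
have -> : ln x = 2 ^+ j * y by rewrite /y; field; rewrite expf_neq0.
rewrite ler_pM2l ?exprn_gt0 //; have := expR_ge1Dx y; lra.
Qed.

(** With [y = ln x / 2 ^ j] the excess comes from [exp y - 1 <= y + y ^ 2 * exp |y|]; bounding [|y|]
    by [|ln x|] leaves an error of order [2 ^ - j]. *)
Lemma root_le_ln (j : nat) (x : R) : 0 < x ->
  2 ^+ j * (iter j Num.sqrt x - 1) <= ln x + ln x ^+ 2 * expR `|ln x| / 2 ^+ j.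
Proof.
move=> x0; rewrite iter_sqrtE //; set y := ln x / _.
have E : ln x = 2 ^+ j * y by rewrite /y; field; rewrite expf_neq0.
clearbody y.
have p0 : 0 < 2 ^+ j :> R by rewrite exprn_gt0.
have p1 : 1 <= 2 ^+ j :> R by apply: exprn_ege1; lra.
have -> : ln x + ln x ^+ 2 * expR `|ln x| / 2 ^+ j = 2 ^+ j * (y + y ^+ 2 * expR `|ln x|).
  by rewrite E; field; rewrite expf_neq0.
rewrite ler_pM2l //.
have yl : `|y| <= `|ln x|.
  by rewrite E normrM (ger0_norm (ltW p0)) ler_peMl.
have e1 : expR `|y| <= expR `|ln x| by rewrite ler_expR.
have e2 : expR y - 1 <= y * expR y.
  have := expR_ge1Dx (- y); rewrite expRN => h.
  have : (1 - y) * expR y <= 1.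
    rewrite -[leRHS](mulVf (lt0r_neq0 (expR_gt0 y))) ler_pM2r ?expR_gt0 //.
  lra.
have e3 := expR_ge1Dx y.
suff : y * expR y <= y + y ^+ 2 * expR `|y|.
  move=> h; have : y ^+ 2 * expR `|y| <= y ^+ 2 * expR `|ln x|.
    by rewrite ler_wpM2l // sqr_ge0.
  lra.
case: (lerP 0 y) => hy; first by move: e2; rewrite ger0_norm // expr2 -mulrA; nra.
have : 1 <= expR `|y| by rewrite -expR0 ler_expR.
have := sqr_ge0 y; nra.
Qed.

Lemma le_of_le_div2X (x y K : R) : (forall j : nat, x <= y + K / 2 ^+ j) -> x <= y.
Proof.
move=> h; apply/ler_addgt0Pr => e e0.
have [K0|K0] := lerP K 0.
  by have := h 0%N; rewrite expr0 divr1; lra.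
pose j := (Num.truncn (K / e)).+1.
apply: (le_trans (h j)); rewrite lerD2l ler_pdivrMr ?exprn_gt0 //.
have /ltW h1 : K / e < j%:R by rewrite /j; exact: truncnS_gt.
have h2 : j%:R <= 2 ^+ j :> R.
  by rewrite -natrX ler_nat; exact: ltnW (ltn_expl _ _).
by rewrite mulrC -ler_pdivrMr //; exact: le_trans h2.
Qed.

(** Iterating [sqrt_op_mono] gives the inequality for all dyadic roots; the logarithm is squeezed
    between them, eigenvalue by eigenvalue, with an error that vanishes for each fixed [x]. *)
Lemma ln_op_mono a u b w : onb u -> onb w -> (forall t, 0 < a t) -> (forall t, 0 < b t) ->
  (forall x, qf (spec a u) x <= qf (spec b w) x) ->
  forall x, qf (spec (fun t => ln (a t)) u) x <= qf (spec (fun t => ln (b t)) w) x.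
Proof.
move=> hu hw ha hb hab x.
have hj (j : nat) : qf (spec (fun t => iter j Num.sqrt (a t)) u) x
                 <= qf (spec (fun t => iter j Num.sqrt (b t)) w) x.
  elim: j x => [|j IH] x; first exact: hab.
  by apply: sqrt_op_mono => // t; apply: iter_sqrt_ge0; exact: ltW.
apply: (@le_of_le_div2X _ _ (\sum_t ln (b t) ^+ 2 * expR `|ln (b t)| * nsq (ip (w t) x))) => j.
have p0 : 0 < 2 ^+ j :> R by rewrite exprn_gt0.
apply: (@le_trans _ _ (2 ^+ j * (qf (spec (fun t => iter j Num.sqrt (a t)) u) x - nrm x))).
  rewrite !qf_spec (parseval x hu) -sumrB mulr_sumr; apply: ler_sum => t _.
  have := ln_le_root j (ha t); have := nsq_ge0 (ip (u t) x); nra.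
apply: (@le_trans _ _ (2 ^+ j * (qf (spec (fun t => iter j Num.sqrt (b t)) w) x - nrm x))).
  by rewrite ler_pM2l // lerD2r.
rewrite !qf_spec (parseval x hw) -sumrB mulr_sumr mulr_suml -big_split.
apply: ler_sum => t _ /=.
have := root_le_ln j (hb t); have := nsq_ge0 (ip (w t) x).
set N := nsq _; set I := iter _ _ _; set K := _ ^+ 2 * _ => N0.
move=> /(ler_wpM2r N0); lra.
Qed.

(** This is [ln z <= z - 1] at [z = y / x]; the case [x = 0] is the convention [0 ln 0 = 0]. *)
Lemma mul_ln_le (x y : R) : 0 <= x -> 0 < y -> x * ln y <= x * ln x + y - x.
Proof.
rewrite le_eqVlt => /predU1P[<-|x0] y0; first by rewrite !mul0r; lra.
have : ln (y / x) <= y / x - 1.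
  have -> : y / x = 1 + (y / x - 1) by ring.
  apply: le_trans (le_ln1Dx _) _; last by lra.
  have : 0 < y / x by rewrite divr_gt0.
  lra.
rewrite ln_div ?posrE // => h.
have : x * (ln y - ln x) <= x * (y / x - 1) by rewrite ler_pM2l.
have -> : x * (y / x - 1) = y - x by field; lra.
lra.
Qed.

Lemma overlap_sum_l u (v : T -> C) : onb u -> nrm v = 1 -> \sum_s nsq (ip (u s) v) = 1.
Proof. by move=> hu <-; rewrite (parseval v hu). Qed.

Lemma nsq_ipC (x y : T -> C) : nsq (ip x y) = nsq (ip y x).
Proof. by rewrite -ipC nsqJ. Qed.

(** The squared overlaps of two orthonormal bases form a doubly stochastic matrix, and averaging the
    scalar inequality [mul_ln_le] over it gives the operator one. It serves as a bound of
    [tr s ln s] from below by functionals linear in [s]. *)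
Lemma klein a u b w : onb u -> onb w -> (forall t, 0 <= a t) -> (forall t, 0 < b t) ->
  \sum_t ln (b t) * qf (spec a u) (w t)
    <= \sum_t a t * ln (a t) + \sum_t b t - \sum_t a t.
Proof.
move=> hu hw ha hb.
pose p s t := nsq (ip (u s) (w t)).
have p1 t : \sum_s p s t = 1 by apply: overlap_sum_l => //; exact: onb_nrm.
have p2 s : \sum_t p s t = 1.
  under eq_bigr do rewrite /p nsq_ipC.
  by apply: overlap_sum_l => //; exact: onb_nrm.
apply: (@le_trans _ _ (\sum_s \sum_t (a s * ln (a s) + b t - a s) * p s t)).
  rewrite exchange_big /=; apply: ler_sum => t _.
  rewrite qf_spec mulr_sumr; apply: ler_sum => s _.
  rewrite mulrA ler_wpM2r ?nsq_ge0 // mulrC; exact: mul_ln_le.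
rewrite le_eqVlt; apply/orP; left; apply/eqP.
under eq_bigr do under eq_bigr do rewrite -addrA mulrDl mulrBl.
under eq_bigr do rewrite big_split /= sumrB -!mulr_sumr p2 !mulr1.
rewrite big_split sumrB /= addrA; congr (_ + _ - _).
by rewrite exchange_big /=; apply: eq_bigr => t _; rewrite -mulr_sumr p1 mulr1.
Qed.

End Monotone.

(** * Tensor products and partial traces *)

(** Carrying the bijection lets one index type be factored in several ways, by party or by block of
    copies, without casts between types. *)
Record splitting (T T1 T2 : Type) := Splitting {
  sp :> T -> T1 * T2;
  spi : T1 * T2 -> T;
  spK : cancel sp spi;
  spiK : cancel spi sp }.

Definition split_id (T1 T2 : Type) : splitting (T1 * T2) T1 T2 :=
  @Splitting _ _ _ id id (fun=> erefl) (fun=> erefl).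

Lemma split_swapK (T T1 T2 : Type) (e : splitting T T1 T2) :
  cancel (fun i => ((e i).2, (e i).1)) (fun q => spi e (q.2, q.1)).
Proof. by move=> i; rewrite /= -surjective_pairing spK. Qed.
Lemma split_swapKV (T T1 T2 : Type) (e : splitting T T1 T2) :
  cancel (fun q => spi e (q.2, q.1)) (fun i => ((e i).2, (e i).1)).
Proof. by move=> [i j]; rewrite /= spiK. Qed.
Definition split_swap (T T1 T2 : Type) (e : splitting T T1 T2) : splitting T T2 T1 :=
  Splitting (split_swapK e) (split_swapKV e).

Section Local.
Variables (X X1 X2 Y Y1 Y2 : Type) (eX : splitting X X1 X2) (eY : splitting Y Y1 Y2).
(** The regrouping keeps the cut Alice : Bob inside each of the two factors, so separability makes
    sense for both. *)
Definition loc (xy : X * Y) : (X1 * Y1) * (X2 * Y2) :=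
  (((eX xy.1).1, (eY xy.2).1), ((eX xy.1).2, (eY xy.2).2)).
Definition loci (q : (X1 * Y1) * (X2 * Y2)) : X * Y :=
  (spi eX (q.1.1, q.2.1), spi eY (q.1.2, q.2.2)).
Lemma locK : cancel loc loci.
Proof. by case=> x y; rewrite /loc /loci /= -!surjective_pairing !spK. Qed.
Lemma lociK : cancel loci loc.
Proof. by case=> [[? ?] [? ?]]; rewrite /loc /loci /= !spiK. Qed.
Definition split_loc : splitting (X * Y) (X1 * Y1) (X2 * Y2) := Splitting locK lociK.
End Local.

Section Tensor.
Variable R : realType.
Local Notation C := R[i].
Local Notation op := (@op R).
Variables (T T1 T2 : finType) (e : splitting T T1 T2).
Implicit Types (P : op T1) (Q : op T2) (p : T1 -> C) (q : T2 -> C) (s : op T).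

Definition etens P Q : op T := fun i j => P (e i).1 (e j).1 * Q (e i).2 (e j).2.
Definition evec p q : T -> C := fun i => p (e i).1 * q (e i).2.
Definition ebas (u : T1 -> T1 -> C) (w : T2 -> T2 -> C) : T -> T -> C :=
  fun t => evec (u (e t).1) (w (e t).2).

Lemma sum_split (V : nmodType) (F : T -> V) : \sum_i F i = \sum_p \sum_q F (spi e (p, q)).
Proof.
rewrite pair_bigA /= (reindex (spi e)) /=; last first.
  by exists e => x _; [exact: spiK|exact: spK].
by apply: eq_bigr => -[].
Qed.

Lemma evec_spi p q i j : evec p q (spi e (i, j)) = p i * q j.
Proof. by rewrite /evec spiK. Qed.

Lemma ip_evec p q p' q' : ip (evec p q) (evec p' q') = ip p p' * ip q q'.
Proof.
rewrite /ip sum_split mulr_suml; apply: eq_bigr => i _; rewrite mulr_sumr.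
by apply: eq_bigr => j _; rewrite !evec_spi conjcM; ring.
Qed.

Lemma onb_ebas u w : onb u -> onb w -> onb (ebas u w).
Proof.
move=> hu hw s t; rewrite ip_evec hu hw -(inj_eq (can_inj (spK e))).
by case: (e s) (e t) => a b [c d] /=; rewrite xpair_eqE; do 2 case: eqP;
  rewrite /= ?mulr0 ?mul0r ?mulr1.
Qed.

Lemma opapp_etens P Q p q : opapp (etens P Q) (evec p q) = evec (opapp P p) (opapp Q q).
Proof.
apply: funext => i; rewrite /opapp /evec sum_split mulr_suml.
apply: eq_bigr => k _; rewrite mulr_sumr; apply: eq_bigr => l _.
by rewrite /etens !spiK /=; ring.
Qed.

Lemma etens_spec a u b w :
  etens (spec a u) (spec b w) = spec (fun t => a (e t).1 * b (e t).2) (ebas u w).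
Proof.
apply: funext => i; apply: funext => j.
rewrite /etens /spec /osum sum_split mulr_suml; apply: eq_bigr => k _.
rewrite mulr_sumr; apply: eq_bigr => l _.
by rewrite /ketbra /ebas !spiK /= rCM /evec conjcM; ring.
Qed.

Lemma psd_etens P Q : psd P -> psd Q -> psd (etens P Q).
Proof.
move=> /psd_spectral [a [u [_ [ha ->]]]] /psd_spectral [b [w [_ [hb ->]]]].
by rewrite etens_spec; apply: psd_spec => t; rewrite mulr_ge0.
Qed.

Lemma optr_etens P Q : optr (etens P Q) = optr P * optr Q.
Proof.
rewrite /optr sum_split mulr_suml; apply: eq_bigr => k _; rewrite mulr_sumr.
by apply: eq_bigr => l _; rewrite /etens !spiK.
Qed.

Lemma etens_id : etens (@opid R T1) (@opid R T2) = @opid R T.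
Proof.
apply: funext => i; apply: funext => j; rewrite /etens /opid.
rewrite -(inj_eq (can_inj (spK e)) i j); case: (e i) (e j) => a b [c d] /=.
by rewrite xpair_eqE; do 2 case: eqP; rewrite /= ?mulr0 ?mul0r ?mulr1.
Qed.

(** [Tr_1 ((P (x) 1) s)]: the unnormalised state of the second factor after the effect [P] is
    observed on the first. For [P] the identity it is the usual partial trace. *)
Definition ptr1 P s : op T2 := fun i2 j2 =>
  \sum_i1 \sum_j1 P j1 i1 * s (spi e (i1, i2)) (spi e (j1, j2)).

Lemma ptr1_ketbra_ip p s q q' :
  ip q (opapp (ptr1 (ketbra p p) s) q') = ip (evec p q) (opapp s (evec p q')).
Proof.
rewrite /ip sum_split exchange_big /=; apply: eq_bigr => i2 _.
have -> : opapp (ptr1 (ketbra p p) s) q' i2 =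
    \sum_i1 conjc (p i1) * opapp s (evec p q') (spi e (i1, i2)).
  rewrite /opapp /ptr1; under eq_bigr do rewrite mulr_suml.
  rewrite exchange_big /=; apply: eq_bigr => i1 _.
  rewrite sum_split exchange_big mulr_sumr /=; apply: eq_bigr => j2 _.
  rewrite mulr_suml mulr_sumr; apply: eq_bigr => j1 _; rewrite evec_spi /ketbra; ring.
rewrite mulr_sumr; apply: eq_bigr => i1 _; rewrite evec_spi conjcM; ring.
Qed.

Lemma ptr1_osum (I : finType) (c : I -> R) (G : I -> op T1) s :
  ptr1 (osum c G) s = osum c (fun k => ptr1 (G k) s).
Proof.
apply: funext => i2; apply: funext => j2; rewrite /ptr1 /osum.
under eq_bigr do under eq_bigr do rewrite mulr_suml.
under eq_bigr do rewrite exchange_big /=.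
rewrite exchange_big /=; apply: eq_bigr => k _; rewrite mulr_sumr.
apply: eq_bigr => i1 _; rewrite mulr_sumr.
by apply: eq_bigr => j1 _; rewrite mulrA.
Qed.

Lemma qf_ptr1_spec a u s q :
  qf (ptr1 (spec a u) s) q = \sum_t a t * qf s (evec (u t) q).
Proof.
by rewrite ptr1_osum qf_osum; apply: eq_bigr => t _; rewrite /qf ptr1_ketbra_ip.
Qed.

Lemma herm_ptr1_ketbra p s : hermitian s -> hermitian (ptr1 (ketbra p p) s).
Proof.
move=> hs; apply: funext => i; apply: funext => j.
rewrite /opadj /ptr1 conjc_sum; under eq_bigr do rewrite conjc_sum.
rewrite exchange_big /=; apply: eq_bigr => k _; apply: eq_bigr => l _.
by rewrite conjcM (hermitianP hs) (hermitianP (herm_ketbra p)).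
Qed.

Lemma psd_ptr1 P s : psd P -> psd s -> psd (ptr1 P s).
Proof.
move=> /psd_spectral [a [u [hu [ha ->]]]] hs; rewrite ptr1_osum.
apply: psd_osum => // t; apply: psdP; first by apply: herm_ptr1_ketbra; exact: psd_herm.
by move=> v; rewrite /qf ptr1_ketbra_ip -/(qf _ _) psd_qf.
Qed.

(** A product observable may be evaluated by averaging over the first factor first; the second
    factor is then measured in its conditional state. With exponentials for [f1] and [f2] this
    drives the Chernoff bound for correlated states. *)
Lemma sum_qf_ebas f1 f2 u w s :
  \sum_t f1 (e t).1 * f2 (e t).2 * qf s (ebas u w t) =
  \sum_t f2 t * qf (ptr1 (spec f1 u) s) (w t).
Proof.
rewrite sum_split exchange_big /=; apply: eq_bigr => j _.
rewrite qf_ptr1_spec mulr_sumr; apply: eq_bigr => i _.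
rewrite /ebas !spiK /=; ring.
Qed.

Lemma rtr_ptr1 a u s : onb u ->
  rtr (ptr1 (spec a u) s) = \sum_t a (e t).1 * qf s (ebas u (fun j i => if j == i then 1 else 0) t).
Proof.
move=> hu; rewrite (rtr_onb _ (@onb_std R T2)).
transitivity (\sum_t 1 * qf (ptr1 (spec a u) s) (fun i => if t == i then 1 else 0)).
  by apply: eq_bigr => t _; rewrite mul1r.
by rewrite -sum_qf_ebas; apply: eq_bigr => t _; rewrite mulr1.
Qed.

End Tensor.

Section Swap.
Variable R : realType.
Local Notation C := R[i].
Local Notation op := (@op R).
Variables (T T1 T2 : finType) (e : splitting T T1 T2).

Lemma ebas_swap (u : T1 -> T1 -> C) (w : T2 -> T2 -> C) :
  ebas (split_swap e) w u = ebas e u w.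
Proof. by apply: funext => t; apply: funext => i; rewrite /ebas /evec /= mulrC. Qed.

Lemma sum_qf_ebas_l f (u : T1 -> T1 -> C) (w : T2 -> T2 -> C) (s : op T) : onb w ->
  \sum_t f (e t).1 * qf s (ebas e u w t) =
  \sum_t f t * qf (ptr1 (split_swap e) (@opid R T2) s) (u t).
Proof.
move=> hw; rewrite -(spec1 hw) -(sum_qf_ebas (split_swap e)) ebas_swap.
by apply: eq_bigr => t _; rewrite mul1r.
Qed.

Lemma sum_qf_ebas_r f (u : T1 -> T1 -> C) (w : T2 -> T2 -> C) (s : op T) : onb u ->
  \sum_t f (e t).2 * qf s (ebas e u w t) =
  \sum_t f t * qf (ptr1 e (@opid R T1) s) (w t).
Proof.
move=> hu; rewrite -(spec1 hu) -(sum_qf_ebas e).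
by apply: eq_bigr => t _; rewrite mul1r.
Qed.

Lemma rtr_ptr1_id (s : op T) : rtr (ptr1 e (@opid R T1) s) = rtr s.
Proof.
rewrite -(spec1 (@onb_std R T1)) rtr_ptr1; last exact: onb_std.
rewrite (rtr_onb _ (onb_ebas e (@onb_std R T1) (@onb_std R T2))).
by apply: eq_bigr => t _; rewrite mul1r.
Qed.

End Swap.

(** * The cone of separable operators *)

Section SeparableCone.
Variable R : realType.
Local Notation C := R[i].
Local Notation op := (@op R).
Variables X Y : finType.
Implicit Types (a : op X) (b : op Y) (s t : op (X * Y)%type).

Definition op0 (T : finType) : op T := fun _ _ => 0.

(** Leaving out normalisation and the number of terms keeps conditional states inside, and turns
    membership proofs into inductions. *)
Inductive scone : op (X * Y)%type -> Prop :=
| scone_tens a b : psd a -> psd b -> scone (tens a b)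
| scone0 : scone (@op0 _)
| sconeD s t : scone s -> scone t -> scone (opadd s t).

Lemma psd0 (T : finType) : psd (@op0 T).
Proof.
apply: psdP => [|v]; first by apply: funext => i; apply: funext => j; rewrite /opadj /op0 conjc0.
rewrite /qf /ip big1 // => i _; rewrite /opapp big1 ?mulr0 // => j _; by rewrite /op0 mul0r.
Qed.

Lemma scone_psd s : scone s -> psd s.
Proof.
elim=> [a b ha hb||s1 s2 _ h1 _ h2]; [|exact: psd0|exact: psdD].
exact: (psd_etens (split_id X Y)).
Qed.

Lemma sconeZ c s : 0 <= c -> scone s -> scone (opscale (rC c) s).
Proof.
move=> hc; elim=> [a b ha hb||s1 s2 _ h1 _ h2].
- have -> : opscale (rC c) (tens a b) = tens (opscale (rC c) a) b.
    by apply: funext => i; apply: funext => j; rewrite /opscale /tens mulrA.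
  by apply: scone_tens => //; exact: psdZ.
- have -> : opscale (rC c) (@op0 _) = @op0 (X * Y)%type.
    by apply: funext => i; apply: funext => j; rewrite /opscale /op0 mulr0.
  exact: scone0.
- have -> : opscale (rC c) (opadd s1 s2) = opadd (opscale (rC c) s1) (opscale (rC c) s2).
    by apply: funext => i; apply: funext => j; rewrite /opscale /opadd mulrDr.
  exact: sconeD.
Qed.

Lemma scone_osum (I : finType) (c : I -> R) (s : I -> op (X * Y)%type) :
  (forall k, 0 <= c k) -> (forall k, scone (s k)) -> scone (osum c s).
Proof.
move=> hc hs; rewrite /osum; elim: (index_enum I) => [|k r IH].
  have -> : (fun i j => \sum_(k <- [::]) rC (c k) * s k i j) = @op0 (X * Y)%type.
    by apply: funext => i; apply: funext => j; rewrite big_nil.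
  exact: scone0.
have -> : (fun i j => \sum_(k <- k :: r) rC (c k) * s k i j) =
    opadd (opscale (rC (c k)) (s k)) (fun i j => \sum_(k <- r) rC (c k) * s k i j).
  by apply: funext => i; apply: funext => j; rewrite big_cons.
by apply: sconeD => //; exact: sconeZ.
Qed.

Lemma rtrZ (T : finType) c (Z : op T) : rtr (opscale (rC c) Z) = c * rtr Z.
Proof. by rewrite /rtr /optr -mulr_sumr Re_rCM. Qed.
Lemma rtrD (T : finType) (Z W : op T) : rtr (opadd Z W) = rtr Z + rtr W.
Proof. by rewrite /rtr /optr big_split /= ReD. Qed.
Lemma rtr_osum (T I : finType) (c : I -> R) (Z : I -> op T) :
  rtr (osum c Z) = \sum_k c k * rtr (Z k).
Proof.
rewrite /rtr /optr /osum exchange_big Re_sum /=; apply: eq_bigr => k _.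
by rewrite -mulr_sumr Re_rCM.
Qed.

Lemma state_rtr (T : finType) (Z : op T) : state Z -> rtr Z = 1.
Proof. by case=> _; rewrite /rtr => ->. Qed.
Lemma stateP (T : finType) (Z : op T) : psd Z -> rtr Z = 1 -> state Z.
Proof. by move=> h1 h2; split=> //; rewrite optr_herm ?h2 //; exact: psd_herm. Qed.

Lemma psd_rtr0 (T : finType) (Z : op T) : psd Z -> rtr Z = 0 -> Z = @op0 T.
Proof.
move=> /psd_spectral [a [u [hu [ha ->]]]].
rewrite (rtr_onb _ hu); under eq_bigr do rewrite qf_spec_basis //.
move=> /eqP; rewrite psumr_eq0 // => /allP h.
apply: funext => i; apply: funext => j; rewrite /spec /osum big1 // => t _.
by rewrite (eqP (h t (mem_index_enum t))) mul0r.
Qed.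

Lemma scale_state (T : finType) (Z : op T) : psd Z -> 0 < rtr Z ->
  state (opscale (rC (rtr Z)^-1) Z) /\ Z = opscale (rC (rtr Z)) (opscale (rC (rtr Z)^-1) Z).
Proof.
move=> hZ h0; split.
  apply: stateP; first by apply: psdZ; rewrite // invr_ge0 ltW.
  by rewrite rtrZ mulVf ?gt_eqF.
apply: funext => i; apply: funext => j.
by rewrite /opscale mulrA -rCM mulfV ?gt_eqF // rC1 mul1r.
Qed.

(** A product term with a factor of trace zero vanishes and is dropped; in the others both factors
    are rescaled to states. This is the way back from the cone to [separable]. *)
Lemma scone_decomp s : scone s -> exists K (p : 'I_K -> R) (a : 'I_K -> op X) (b : 'I_K -> op Y),
  (forall k, 0 <= p k) /\ (forall k, state (a k) /\ state (b k)) /\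
  s = osum p (fun k => tens (a k) (b k)).
Proof.
have nul s' : s' = @op0 _ -> exists K (p : 'I_K -> R) (a : 'I_K -> op X) (b : 'I_K -> op Y),
  (forall k, 0 <= p k) /\ (forall k, state (a k) /\ state (b k)) /\
  s' = osum p (fun k => tens (a k) (b k)).
  move=> ->; exists 0%N, (fun=> 0), (fun=> @op0 _), (fun=> @op0 _); split=> //.
  split=> [[]//|]; apply: funext => i; apply: funext => j.
  by rewrite /osum big_ord0.
elim=> [a b ha hb||s1 s2 _ [K1 [p1 [a1 [b1 [hp1 [h1 ->]]]]]] _ [K2 [p2 [a2 [b2 [hp2 [h2 ->]]]]]]].
- have := psd_rtr_ge0 ha; rewrite le_eqVlt => /predU1P[a0|a0].
    apply: nul; rewrite (psd_rtr0 ha) //.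
    by apply: funext => i; apply: funext => j; rewrite /tens /op0 mul0r.
  have := psd_rtr_ge0 hb; rewrite le_eqVlt => /predU1P[b0|b0].
    apply: nul; rewrite (psd_rtr0 hb) //.
    by apply: funext => i; apply: funext => j; rewrite /tens /op0 mulr0.
  have [sa ea] := scale_state ha a0; have [sb eb] := scale_state hb b0.
  exists 1%N, (fun=> rtr a * rtr b), (fun=> opscale (rC (rtr a)^-1) a),
    (fun=> opscale (rC (rtr b)^-1) b); split; first by move=> _; rewrite mulr_ge0 ?ltW.
  split=> //; rewrite {1}ea {1}eb; apply: funext => i; apply: funext => j.
  by rewrite /osum big_ord1 /tens {1 3}/opscale rCM; ring.
- exact: nul.
- exists (K1 + K2)%N, (fun k => match fintype.split k with inl i => p1 i | inr i => p2 i end),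
   (fun k => match fintype.split k with inl i => a1 i | inr i => a2 i end),
   (fun k => match fintype.split k with inl i => b1 i | inr i => b2 i end).
  split; first by move=> k; case: (fintype.split k).
  split; first by move=> k; case: (fintype.split k).
  apply: funext => i; apply: funext => j; rewrite /osum /opadd big_split_ord /=.
  congr (_ + _); apply: eq_bigr => k _.
    by rewrite (unsplitK (inl k)).
  by rewrite (unsplitK (inr k)).
Qed.

Lemma sep_scone s : separable s -> scone s.
Proof.
move=> [K [p [a [b [hp [_ [h ->]]]]]]]; apply: (scone_osum hp) => k.
by case: (h k) => -[ha _] [hb _]; exact: scone_tens.
Qed.

Lemma rtr_tens a b : state a -> state b -> rtr (tens a b) = 1.
Proof.
move=> [_ ha] [_ hb]; rewrite /rtr.
by rewrite [optr _](optr_etens (split_id X Y)) ha hb mulr1.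
Qed.

Lemma sep_state s : separable s -> state s.
Proof.
move=> hs; apply: stateP; first by apply: scone_psd; exact: sep_scone.
case: hs => [K [p [a [b [hp [p1 [h ->]]]]]]].
rewrite [LHS]rtr_osum -p1; apply: eq_bigr => k _; case: (h k) => ha hb.
by rewrite rtr_tens // mulr1.
Qed.

Lemma scone_sep s : scone s -> rtr s = 1 -> separable s.
Proof.
move=> /scone_decomp [K [p [a [b [hp [h ->]]]]]] h1.
exists K, p, a, b; split=> //; split=> //.
rewrite -h1 rtr_osum; apply: eq_bigr => k _; case: (h k) => ha hb.
by rewrite rtr_tens // mulr1.
Qed.

Lemma sep_tens a b : state a -> state b -> separable (tens a b).
Proof.
move=> ha hb; apply: scone_sep; last exact: rtr_tens.
by apply: scone_tens; [case: ha|case: hb].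
Qed.

Lemma sep_convex s t l : 0 <= l <= 1 -> separable s -> separable t ->
  separable (opadd (opscale (rC (1 - l)) s) (opscale (rC l) t)).
Proof.
move=> /andP[l0 l1] hs ht; apply: scone_sep.
  by apply: sconeD; apply: sconeZ; rewrite ?subr_ge0 //; exact: sep_scone.
rewrite rtrD !rtrZ !state_rtr; [ring|exact: sep_state|exact: sep_state].
Qed.

(** Homogeneity carries a bound from separable states to conditional states, which are not
    normalised; a positive operator of trace zero is zero, so nothing is lost there. *)
Lemma scone_bound (F : op (X * Y)%type -> R) g s :
  (forall c s, F (opscale (rC c) s) = c * F s) ->
  (forall s, separable s -> F s <= g) -> scone s -> F s <= g * rtr s.
Proof.
move=> hF h hs; have ps := scone_psd hs.
have := psd_rtr_ge0 ps; rewrite le_eqVlt => /predU1P[s0|s0].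
  rewrite -s0 mulr0.
  have -> : s = opscale (rC 0) s.
    rewrite (psd_rtr0 ps) //; apply: funext => i; apply: funext => j.
    by rewrite /opscale /op0 mulr0.
  by rewrite hF mul0r.
have [st e] := scale_state ps s0; rewrite {1}e hF mulrC ler_pM2r //.
apply: h; apply: scone_sep; last exact: state_rtr.
by apply: sconeZ; rewrite ?invr_ge0 ?ltW.
Qed.

Lemma qf_le_rtr (T : finType) (Z : op T) v : psd Z -> qf Z v <= rtr Z * nrm v.
Proof.
move=> /psd_spectral [a [u [hu [ha ->]]]].
rewrite (rtr_onb _ hu) qf_spec (parseval v hu) mulr_suml; apply: ler_sum => t _.
rewrite qf_spec_basis // ler_wpM2l // (bigD1 t) //= lerDl.
by apply: sumr_ge0 => i _; exact: nsq_ge0.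
Qed.

Lemma psd_rtr_sub (T : finType) (Z : op T) : psd Z ->
  psd (opadd (opscale (rC (rtr Z)) (@opid R T)) (opopp Z)).
Proof.
move=> hZ; have hh := psd_herm hZ; apply: psdP.
  by apply: hermD; [apply: hermZ; exact: herm_id|exact: hermN].
by move=> v; rewrite qfD qfN qfZ qf_id subr_ge0 qf_le_rtr.
Qed.

Lemma tens_id : tens (@opid R X) (@opid R Y) = @opid R (X * Y)%type.
Proof. exact: (@etens_id R _ _ _ (split_id X Y)). Qed.

Definition shiftid (T : finType) k (Z : op T) := opadd (opscale (rC k) (@opid R T)) Z.

(* A product operator is bounded by the identity in the order of the cone:
   tr(a)tr(b) 1 - a (x) b = (tr(a) 1 - a) (x) tr(b) 1 + a (x) (tr(b) 1 - b). *)
Lemma scone_sub_tens a b : psd a -> psd b ->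
  scone (shiftid (rtr a * rtr b) (opopp (tens a b))).
Proof.
move=> ha hb.
have -> : shiftid (rtr a * rtr b) (opopp (tens a b)) =
  opadd (tens (opadd (opscale (rC (rtr a)) (@opid R X)) (opopp a)) (opscale (rC (rtr b)) (@opid R Y)))
        (tens a (opadd (opscale (rC (rtr b)) (@opid R Y)) (opopp b))).
  rewrite /shiftid -tens_id; apply: funext => i; apply: funext => j.
  by rewrite /opadd /opscale /opopp /tens rCM; ring.
apply: sconeD; apply: scone_tens => //; try exact: psd_rtr_sub.
by apply: psdZ; [exact: psd_rtr_ge0|exact: psd_id].
Qed.

Lemma scone_shift_tens c a b : psd a -> psd b ->
  scone (shiftid (`|c| * (rtr a * rtr b)) (opscale (rC c) (tens a b))).
Proof.
move=> ha hb; case: (lerP 0 c) => hc; [rewrite ger0_norm //|rewrite ltr0_norm //].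
  apply: sconeD; last by apply: sconeZ => //; exact: scone_tens.
  rewrite -tens_id; apply: sconeZ; first by rewrite !mulr_ge0 ?psd_rtr_ge0.
  by apply: scone_tens; exact: psd_id.
have -> : shiftid (- c * (rtr a * rtr b)) (opscale (rC c) (tens a b)) =
  opscale (rC (- c)) (shiftid (rtr a * rtr b) (opopp (tens a b))).
  apply: funext => i; apply: funext => j.
  by rewrite /shiftid /opadd /opscale /opopp (rCM (- c)) rCN; ring.
by apply: sconeZ; [rewrite oppr_ge0 ltW|exact: scone_sub_tens].
Qed.

Lemma scone_shift_osum (I : finType) (c : I -> R) (a : I -> op X) (b : I -> op Y) :
  (forall k, psd (a k)) -> (forall k, psd (b k)) ->
  exists k, 0 <= k /\ scone (shiftid k (osum c (fun k => tens (a k) (b k)))).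
Proof.
move=> ha hb; pose k := \sum_k `|c k| * (rtr (a k) * rtr (b k)).
exists k; split; first by apply: sumr_ge0 => l _; rewrite !mulr_ge0 ?psd_rtr_ge0.
have -> : shiftid k (osum c (fun k => tens (a k) (b k))) =
  osum (fun=> 1) (fun l => shiftid (`|c l| * (rtr (a l) * rtr (b l))) (opscale (rC (c l)) (tens (a l) (b l)))).
  apply: funext => i; apply: funext => j; rewrite /shiftid /opadd /osum /opscale.
  by rewrite rC_sum mulr_suml -big_split; apply: eq_bigr => l _; rewrite rC1 mul1r.
by apply: scone_osum => // l; exact: scone_shift_tens.
Qed.

End SeparableCone.

(** * The identity is an interior point of the separable cone *)

Section ConeInterior.
Variable R : realType.
Local Notation C := R[i].
Local Notation op := (@op R).

Definition ph (k : 'I_4) : C := 'i%C ^+ k.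

Definition polv (T : finType) (i j : T) (k : 'I_4) : T -> C :=
  fun x => (if x == i then 1 else 0) + ph k * (if x == j then 1 else 0).

(* Polarisation: the matrix unit |i><j| is a combination of four rank-one projections. *)
Lemma polarization (T : finType) (i j p q : T) :
  \sum_k ph k * ketbra (polv i j k) (polv i j k) p q =
  rC 4 * ((if p == i then 1 else 0) * (if q == j then 1 else 0)).
Proof.
rewrite !big_ord_recl big_ord0 /ketbra /polv /ph /= /bump /=.
set A : C := if p == i then 1 else 0; set B : C := if p == j then 1 else 0.
have cr (b b' : bool) (w : C) : conjc ((if b then 1 else 0) + w * (if b' then 1 else 0)) =
    (if b then 1 else 0) + conjc w * (if b' then 1 else 0).
  by rewrite conjcD conjcM !conjc_if.
rewrite !cr; set A' : C := if q == i then 1 else 0; set B' : C := if q == j then 1 else 0.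
have zz : ('i%C : C) * 'i%C = -1 by rewrite -expr2 sqr_i.
have cz : @conjc R 'i%C = - 'i%C by rewrite /=; congr Complex; rewrite oppr0.
rewrite (_ : (1 + (1 + 1))%N = 3%N) // (_ : (1 + 1)%N = 2%N) // (_ : (1 + 0)%N = 1%N) //.
have e2 : ('i%C : C) ^+ 2 = -1 by rewrite expr2.
have e3 : ('i%C : C) ^+ 3 = - 'i%C by rewrite exprS e2 mulrN1.
rewrite expr0 expr1 e2 e3 !conjcN conjc1 cz opprK.
have -> : rC 4 = 4 :> C by rewrite rCE rmorph_nat.
move: zz; clear; move: ('i%C : C) => z zz.
transitivity (2 * (A * B') * (1 - z * z) + 2 * (B * A') * (1 + z * z)); first by ring.
by rewrite zz; ring.
Qed.

Variables X Y : finType.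

(** Polarisation on each side writes [H] as a combination of product projections, with real
    coefficients since [H] is Hermitian. A multiple of the identity absorbs each real multiple of a
    product. *)
Lemma cone_interior (H : op (X * Y)%type) : hermitian H ->
  exists k, 0 <= k /\ scone (shiftid k H).
Proof.
move=> hH.
pose J := ((X * Y) * (X * Y) * ('I_4 * 'I_4))%type.
pose a (n : J) : op X := ketbra (polv n.1.1.1 n.1.2.1 n.2.1) (polv n.1.1.1 n.1.2.1 n.2.1).
pose b (n : J) : op Y := ketbra (polv n.1.1.2 n.1.2.2 n.2.2) (polv n.1.1.2 n.1.2.2 n.2.2).
(* Each of the two polarisations contributes a factor [1 / 4]. *)
pose c (n : J) : C := rC (16^-1) * H n.1.1 n.1.2 * ph n.2.1 * ph n.2.2.
have E i j : H i j = \sum_n c n * tens (a n) (b n) i j.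
  rewrite (sum_split (split_id _ _)) /= (sum_split (split_id _ _)) /=.
  rewrite -[LHS](sum_delta i (fun i' => H i' j)); apply: eq_bigr => i' _.
  rewrite -[H i' j](sum_delta j (H i')) mulr_sumr; apply: eq_bigr => j' _.
  rewrite (sum_split (split_id _ _)) /= /c /tens /a /b /=.
  transitivity (rC (16^-1) * H i' j' *
    ((\sum_k ph k * ketbra (polv i'.1 j'.1 k) (polv i'.1 j'.1 k) i.1 j.1) *
     (\sum_k ph k * ketbra (polv i'.2 j'.2 k) (polv i'.2 j'.2 k) i.2 j.2))).
    rewrite !polarization.
    have -> : rC (16^-1) = (rC 4)^-1 * (rC 4)^-1 :> C.
      rewrite rCE (rmorphV (real_complex R)) ?unitfE ?pnatr_eq0 // -invfM -rCM.
      by congr (rC _)^-1; ring.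
    case: i i' j j' => i1 i2 [i1' i2'] [j1 j2] [j1' j2'].
    rewrite !xpair_eqE /=.
    have n4 : rC 4 != 0 :> C by apply/eqP => -[] h; lra.
    by do 4 (case: eqP => _ /=); rewrite ?(mulr0, mul0r, mulr1, mul1r) //; field.
  rewrite mulr_suml mulr_sumr; apply: eq_bigr => k _; rewrite !mulr_sumr.
  by apply: eq_bigr => l _; ring.
(* The product terms are Hermitian, so averaging the expansion with its adjoint replaces the
   coefficients by their real parts. *)
have -> : H = osum (fun n => complex.Re (c n)) (fun n => tens (a n) (b n)).
  apply: funext => i; apply: funext => j; rewrite /osum.
  have E1 := E i j.
  have E2 : H i j = \sum_n conjc (c n) * tens (a n) (b n) i j.
    rewrite -(hermitianP hH) E conjc_sum; apply: eq_bigr => n _; rewrite conjcM.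
    congr (_ * _); rewrite /tens conjcM.
    by rewrite !(hermitianP (herm_ketbra _)).
  have E3 : H i j + H i j = \sum_n rC (complex.Re (c n)) * tens (a n) (b n) i j +
                            \sum_n rC (complex.Re (c n)) * tens (a n) (b n) i j.
    rewrite {1}E1 E2 -!big_split; apply: eq_bigr => n _ /=.
    by rewrite -!mulrDl; congr (_ * _); case: (c n) => x y; rewrite /rC; simpc.
  move: E3; move: (H i j) (\sum_n _) => [x1 x2] [y1 y2]; simpc => -[] h1 h2.
  by congr Complex; lra.
by apply: scone_shift_osum => n; exact: psd_ketbra.
Qed.

(** Only finitely many operators, the projections onto the basis vectors and their negatives, have
    to be absorbed. The sum [S] of the shifts they need fixes one radius for all perturbations
    diagonal in [u]. *)
Lemma cone_small (u : (X * Y)%type -> (X * Y)%type -> C) : onb u -> exists k, 0 < k /\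
  forall x : (X * Y)%type -> R, (forall t, `|x t| <= k) -> scone (spec (fun t => 1 + x t) u).
Proof.
move=> hu.
have /choice [kp hkp] t : exists k, 0 <= k /\ scone (shiftid k (ketbra (u t) (u t))).
  by apply: cone_interior; exact: herm_ketbra.
have /choice [km hkm] t : exists k, 0 <= k /\ scone (shiftid k (opopp (ketbra (u t) (u t)))).
  by apply: cone_interior; apply: hermN; exact: herm_ketbra.
pose S := \sum_t (kp t + km t).
have S0 : 0 <= S by apply: sumr_ge0 => t _; case: (hkp t) (hkm t) => ? _ [? _]; rewrite addr_ge0.
exists (1 + S)^-1; split; first by rewrite invr_gt0; lra.
move=> x hx.
pose k t := if 0 <= x t then kp t else km t.
have k0 t : 0 <= k t /\ k t <= kp t + km t.
  by rewrite /k; case: (hkp t) (hkm t) => ? _ [? _]; case: ifP => _; lra.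
have h1 : \sum_t `|x t| * k t <= 1.
  apply: (@le_trans _ _ ((1 + S)^-1 * S)).
    rewrite /S mulr_sumr; apply: ler_sum => t _.
    by apply: ler_pM => //; case: (k0 t).
  by rewrite mulrC ler_pdivrMr; lra.
have -> : spec (fun t => 1 + x t) u =
  opadd (opscale (rC (1 - \sum_t `|x t| * k t)) (@opid R (X * Y)%type))
    (osum (fun t => `|x t|) (fun t => shiftid (k t)
       (if 0 <= x t then ketbra (u t) (u t) else opopp (ketbra (u t) (u t))))).
  rewrite -(spec1 hu) -specD; set I := spec (fun=> 1) u.
  apply: funext => i; apply: funext => j.
  rewrite /opadd /opscale /osum rCD rC1 mulrDl mul1r -addrA; congr (_ + _).
  rewrite rCN rC_sum mulNr mulr_suml -sumrN -big_split; apply: eq_bigr => t _ /=.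
  rewrite /shiftid /opadd /opscale /I (spec1 hu) rCM /k; case: (lerP 0 (x t)) => h; first by rewrite ger0_norm //; ring.
  by rewrite ltr0_norm // /opopp !rCN; ring.
apply: sconeD.
  apply: sconeZ; first by rewrite subr_ge0.
  by rewrite -tens_id; apply: scone_tens; exact: psd_id.
apply: scone_osum => // t; rewrite /k; case: ifP => _; first by case: (hkp t).
by case: (hkm t).
Qed.

End ConeInterior.

(** * Conditional states across a cut *)

Section LocalPartialTrace.
Variable R : realType.
Local Notation C := R[i].
Local Notation op := (@op R).
Variables X X1 X2 Y Y1 Y2 : finType.
Variables (eX : splitting X X1 X2) (eY : splitting Y Y1 Y2).
Local Notation e := (split_loc eX eY).

Lemma ptr1_loc (E : op X1) (F : op Y1) (a : op X) (b : op Y) :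
  ptr1 e (tens E F) (tens a b) = tens (ptr1 eX E a) (ptr1 eY F b).
Proof.
apply: funext => i; apply: funext => j; rewrite /tens /ptr1.
rewrite (sum_split (split_id X1 Y1)) /= mulr_suml; apply: eq_bigr => x _.
rewrite mulr_sumr; apply: eq_bigr => y _.
rewrite (sum_split (split_id X1 Y1)) /= mulr_suml; apply: eq_bigr => x' _.
rewrite mulr_sumr; apply: eq_bigr => y' _.
by rewrite /loci /=; ring.
Qed.

Lemma ptr1Dl (T T1 T2 : finType) (e' : splitting T T1 T2) (G H : op T1) (s : op T) :
  ptr1 e' (opadd G H) s = opadd (ptr1 e' G s) (ptr1 e' H s).
Proof.
apply: funext => i; apply: funext => j; rewrite /ptr1 /opadd -big_split.
apply: eq_bigr => k _; rewrite -big_split; apply: eq_bigr => l _.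
by rewrite mulrDl.
Qed.

Lemma ptr1Dr (T T1 T2 : finType) (e' : splitting T T1 T2) (G : op T1) (s t : op T) :
  ptr1 e' G (opadd s t) = opadd (ptr1 e' G s) (ptr1 e' G t).
Proof.
apply: funext => i; apply: funext => j; rewrite /ptr1 /opadd -big_split.
apply: eq_bigr => k _; rewrite -big_split; apply: eq_bigr => l _.
by rewrite mulrDr.
Qed.

(** A product effect on a product operator leaves a product, and the rest is bilinearity. Taking [G]
    in the cone excludes entanglement swapping, by which an entangled effect can create entanglement
    in the remaining systems. *)
Lemma scone_ptr1 (G : op (X1 * Y1)%type) (s : op (X * Y)%type) :
  scone G -> scone s -> scone (ptr1 e G s).
Proof.
move=> hG hs; elim: hG => [E F hE hF||G1 G2 _ h1 _ h2]; last by rewrite ptr1Dl; exact: sconeD.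
- elim: hs => [a b ha hb||s1 s2 _ h1 _ h2]; last by rewrite ptr1Dr; exact: sconeD.
    by rewrite ptr1_loc; apply: scone_tens; exact: psd_ptr1.
  have -> : ptr1 e (tens E F) (@op0 R (X * Y)%type) = @op0 R _; last exact: scone0.
  apply: funext => i; apply: funext => j; rewrite /ptr1 big1 // => k _.
  by rewrite big1 // => l _; rewrite mulr0.
- have -> : ptr1 e (@op0 R _) s = @op0 R _; last exact: scone0.
  apply: funext => i; apply: funext => j; rewrite /ptr1 big1 // => k _.
  by rewrite big1 // => l _; rewrite mul0r.
Qed.

Lemma sep_ptr1_id (s : op (X * Y)%type) : separable s ->
  separable (ptr1 e (@opid R (X1 * Y1)%type) s).
Proof.
move=> hs; apply: scone_sep; last by rewrite rtr_ptr1_id; apply: state_rtr; exact: sep_state.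
apply: scone_ptr1; last exact: sep_scone.
by rewrite -tens_id; apply: scone_tens; exact: psd_id.
Qed.

End LocalPartialTrace.

Lemma split_loc_swap (X X1 X2 Y Y1 Y2 : finType) (eX : splitting X X1 X2) (eY : splitting Y Y1 Y2)
   (R : realType) (G : op R (X2 * Y2)%type) s :
  ptr1 (split_swap (split_loc eX eY)) G s = ptr1 (split_loc (split_swap eX) (split_swap eY)) G s.
Proof. by []. Qed.

Lemma sep_ptr2_id (R : realType) (X X1 X2 Y Y1 Y2 : finType) (eX : splitting X X1 X2)
   (eY : splitting Y Y1 Y2) (s : op R (X * Y)%type) : separable s ->
  separable (ptr1 (split_swap (split_loc eX eY)) (@opid R (X2 * Y2)%type) s).
Proof. by rewrite split_loc_swap; exact: sep_ptr1_id. Qed.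

(** * Independent blocks *)

Notation tpw rho n := (@tpow _ _ _ rho n).

Section Copies.
Variable A : finType.

Definition an_cut k n (f : An A (k + n)) : An A k * An A n :=
  ([ffun i => f (lshift n i)], [ffun i => f (rshift k i)]).
Definition an_paste k n (q : An A k * An A n) : An A (k + n) :=
  [ffun i => match fintype.split i with inl j => q.1 j | inr j => q.2 j end].

Lemma an_catK k n : cancel (@an_cut k n) (@an_paste k n).
Proof.
move=> f; apply/ffunP => i; rewrite ffunE /=.
by rewrite -[i in RHS]splitK; case: (fintype.split i) => j; rewrite ffunE.
Qed.

Lemma an_catKV k n : cancel (@an_paste k n) (@an_cut k n).
Proof.
move=> [g h]; congr (_, _); apply/ffunP => i; rewrite !ffunE.
  by rewrite (unsplitK (inl i)).
by rewrite (unsplitK (inr i)).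
Qed.

Definition an_cat k n : splitting (An A (k + n)) (An A k) (An A n) :=
  Splitting (@an_catK k n) (@an_catKV k n).

Definition an_uncons n (f : An A n.+1) : A * An A n := (f ord0, [ffun i => f (lift ord0 i)]).
Definition an_pcons n (q : A * An A n) : An A n.+1 :=
  [ffun i => if unlift ord0 i is Some j then q.2 j else q.1].

Lemma an_consK n : cancel (@an_uncons n) (@an_pcons n).
Proof.
move=> f; apply/ffunP => i; rewrite ffunE /=.
by case: unliftP => [j ->|->] //; rewrite ffunE.
Qed.

Lemma an_consKV n : cancel (@an_pcons n) (@an_uncons n).
Proof.
move=> [a g]; congr (_, _); first by rewrite ffunE unlift_none.
by apply/ffunP => i; rewrite !ffunE liftK.
Qed.

Definition an_cons n : splitting (An A n.+1) A (An A n) :=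
  Splitting (@an_consK n) (@an_consKV n).

End Copies.

Section Powers.
Variable R : realType.
Local Notation C := R[i].
Local Notation op := (@op R).
Variables A B : finType.
Local Notation ecat k n := (split_loc (an_cat A k n) (an_cat B k n)).
Local Notation econs n := (split_loc (an_cons A n) (an_cons B n)).
Implicit Types (rho : op (A * B)%type) (k n : nat).

Lemma tpow_cat rho k n : tpw rho (k + n)%N = etens (ecat k n) (tpw rho k) (tpw rho n).
Proof.
apply: funext => i; apply: funext => j; rewrite /tpow /etens big_split_ord /=.
by congr (_ * _); apply: eq_bigr => l _; rewrite !ffunE.
Qed.

Lemma tpowS rho n : tpw rho n.+1 = etens (econs n) rho (tpw rho n).
Proof.
apply: funext => i; apply: funext => j; rewrite /tpow /etens big_ord_recl /=.
by congr (_ * _); apply: eq_bigr => l _; rewrite !ffunE.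
Qed.

Lemma tpow0 rho : tpw rho 0 = @opid R _.
Proof.
apply: funext => i; apply: funext => j; rewrite /tpow big_ord0 /opid.
case: eqP => // -[]; case: i j => i1 i2 [j1 j2].
by congr (_, _); apply/ffunP => -[].
Qed.

(** Peeling off one copy at a time lets the lemmas on a two-fold splitting act by induction. [apow]
    and [hpow] multiply and add one-copy values along the same recursion, and [ln_apow] links the
    two. *)
Fixpoint upow (u : (A * B)%type -> (A * B)%type -> C) n :
    (An A n * An B n)%type -> (An A n * An B n)%type -> C :=
  match n with
  | 0 => fun s i => if s == i then 1 else 0
  | n.+1 => ebas (econs n) u (@upow u n)
  end.

Fixpoint apow (a : (A * B)%type -> R) n : (An A n * An B n)%type -> R :=
  match n with
  | 0 => fun=> 1
  | n.+1 => fun t => a (econs n t).1 * apow a (econs n t).2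
  end.

Fixpoint hpow (h : (A * B)%type -> R) n : (An A n * An B n)%type -> R :=
  match n with
  | 0 => fun=> 0
  | n.+1 => fun t => h (econs n t).1 + hpow h (econs n t).2
  end.

Lemma onb_upow u n : onb u -> onb (@upow u n).
Proof. by move=> hu; elim: n => [|n IH]; [exact: onb_std|exact: onb_ebas]. Qed.

Lemma tpow_spec a u n : tpw (spec a u) n = spec (@apow a n) (@upow u n).
Proof.
elim: n => [|n IH]; last by rewrite tpowS IH etens_spec.
by rewrite tpow0 -(spec1 (@onb_std R _)).
Qed.

Lemma apow_gt0 a n t : (forall s, 0 < a s) -> 0 < @apow a n t.
Proof. by move=> h; elim: n t => [|n IH] t //=; rewrite mulr_gt0. Qed.
Lemma apow_ge0 a n t : (forall s, 0 <= a s) -> 0 <= @apow a n t.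
Proof. by move=> h; elim: n t => [|n IH] t //=; rewrite mulr_ge0. Qed.

Lemma ln_apow a n t : (forall s, 0 < a s) -> ln (@apow a n t) = hpow (fun s => ln (a s)) t.
Proof.
move=> h; elim: n t => [|n IH] t /=; first by rewrite ln1.
by rewrite lnM ?posrE // ?apow_gt0 // IH.
Qed.

Lemma qf_etens (T T1 T2 : finType) (e : splitting T T1 T2) (P : op T1) (Q : op T2) p q :
  hermitian P -> hermitian Q -> qf (etens e P Q) (evec e p q) = qf P p * qf Q q.
Proof.
by move=> hP hQ; rewrite {1}/qf opapp_etens ip_evec !qfE // -rCM.
Qed.

Lemma psd_tpow rho n : psd rho -> psd (tpw rho n).
Proof.
move=> h; elim: n => [|n IH]; first by rewrite tpow0; exact: psd_id.
by rewrite tpowS; exact: psd_etens.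
Qed.

Lemma state_tpow rho n : state rho -> state (tpw rho n).
Proof.
move=> [h h1]; split; first exact: psd_tpow.
elim: n => [|n IH]; last by rewrite tpowS optr_etens h1 IH mulr1.
rewrite tpow0 /optr (sum_split (split_id _ _)).
rewrite (bigD1 [ffun i : 'I_0 => match i with Ordinal _ l => False_rect A (notF l) end]) //=.
rewrite [X in _ + X]big1 => [|f /eqP []]; last by apply/ffunP => -[].
rewrite (bigD1 [ffun i : 'I_0 => match i with Ordinal _ l => False_rect B (notF l) end]) //=.
rewrite [X in _ + X + _]big1 => [|f /eqP []]; last by apply/ffunP => -[].
by rewrite /opid eqxx !addr0.
Qed.

(** Expectations of sums of one-copy observables see only marginals, and marginals of a separable
    state are separable even if the state is correlated. This additivity makes a single-letter
    exponent possible. *)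
Lemma hpow_add h1 h2 u v c n (s : op (An A n * An B n)%type) : onb u -> onb v ->
  (forall s0 : op (A * B)%type, separable s0 ->
     c <= \sum_t h1 t * qf s0 (u t) - \sum_t h2 t * qf s0 (v t)) ->
  separable s ->
  n%:R * c <= \sum_t hpow h1 t * qf s (@upow u n t) - \sum_t hpow h2 t * qf s (@upow v n t).
Proof.
move=> hu hv h; elim: n s => [|n IH] s hs.
  by rewrite mul0r !big1 ?subr0 // => t _ /=; rewrite mul0r.
have E g w : onb w -> \sum_t hpow g t * qf s (@upow w n.+1 t) =
    \sum_t g t * qf (ptr1 (split_swap (econs n)) (@opid R _) s) (w t) +
    \sum_t hpow g t * qf (ptr1 (econs n) (@opid R _) s) (@upow w n t).
  move=> hw; rewrite /= -(sum_qf_ebas_l _ _ _ _ (@onb_upow _ n hw)) -(sum_qf_ebas_r _ _ _ _ hw).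
  by rewrite -big_split; apply: eq_bigr => t _ /=; rewrite mulrDl.
have -> : n.+1%:R * c = c + n%:R * c by rewrite -natr1; ring.
rewrite !E // opprD addrACA lerD //.
  by apply: h; exact: sep_ptr2_id.
by apply: IH; exact: sep_ptr1_id.
Qed.

End Powers.

(** * Chernoff bound on correlated separable states *)

Section Blocks.
Variable R : realType.
Local Notation C := R[i].
Local Notation op := (@op R).

(** Data for a two-sided exponential Markov argument: the first moment bounds acceptance on [rho],
    the second bounds rejection on all separable states at once. *)
Definition observable (X Y : finType) (rho : op (X * Y)%type) (eta g : R) := exists u th,
  onb u /\ \sum_t expR (th t) * qf rho (u t) <= 1 /\
  forall s, separable s -> \sum_t expR (- (eta * th t)) * qf s (u t) <= g.

(** The effect [exp (- eta th)] on the first factor is in the cone, so it leaves a multiple of a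
    separable state on the second, to which the bound [g2] applies. The multiple is the exponential
    moment of the first marginal, at most [g1]. No independence of the factors is used. *)
Lemma observable_tensor (X X1 X2 Y Y1 Y2 : finType) (eX : splitting X X1 X2)
    (eY : splitting Y Y1 Y2) (rho1 : op (X1 * Y1)%type) (rho2 : op (X2 * Y2)%type) eta g1 g2 u th :
  psd rho1 -> psd rho2 -> 0 <= g2 -> onb u -> \sum_t expR (th t) * qf rho1 (u t) <= 1 ->
  scone (spec (fun t => expR (- (eta * th t))) u) ->
  (forall s, separable s -> \sum_t expR (- (eta * th t)) * qf s (u t) <= g1) ->
  observable rho2 eta g2 -> observable (etens (split_loc eX eY) rho1 rho2) eta (g1 * g2).
Proof.
move=> h1 h2 g20 hu hr hc hs [w [om [hw [hr2 hs2]]]].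
set e := split_loc eX eY.
exists (ebas e u w), (fun t => th (e t).1 + om (e t).2); split; first exact: onb_ebas.
split.
  have -> : \sum_t expR (th (e t).1 + om (e t).2) * qf (etens e rho1 rho2) (ebas e u w t) =
     (\sum_t expR (th t) * qf rho1 (u t)) * (\sum_t expR (om t) * qf rho2 (w t)).
    rewrite (sum_split e) mulr_suml; apply: eq_bigr => i _; rewrite mulr_sumr.
    apply: eq_bigr => j _; rewrite /ebas spiK expRD qf_etens /=; [exact: mulrACA|exact: psd_herm|exact: psd_herm].
  apply: mulr_ile1 => //; apply: sumr_ge0 => t _;
    by rewrite mulr_ge0 ?expR_ge0 ?psd_qf.
move=> s ss.
have -> : \sum_t expR (- (eta * (th (e t).1 + om (e t).2))) * qf s (ebas e u w t) =
  \sum_t expR (- (eta * om t)) * qf (ptr1 e (spec (fun t => expR (- (eta * th t))) u) s) (w t).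
  rewrite -sum_qf_ebas; apply: eq_bigr => t _.
  by rewrite -expRD; congr (expR _ * _); ring.
set s2 := ptr1 _ _ _.
have c2 : scone s2 by apply: scone_ptr1 => //; exact: sep_scone.
apply: (@le_trans _ _ (g2 * rtr s2)).
  apply: (scone_bound (F := fun s => \sum_t expR (- (eta * om t)) * qf s (w t))) => //.
  move=> c z; rewrite mulr_sumr; apply: eq_bigr => t _; rewrite qfZ; ring.
rewrite mulrC ler_wpM2r // /s2 rtr_ptr1 // (sum_qf_ebas_l e (fun t => expR (- (eta * th t))) u s (@onb_std R _)).
by apply: hs; exact: sep_ptr2_id.
Qed.

(** The length is written with [iter] so that one more block unfolds definitionally to [k + _], the
    form required by [tpow_cat]. *)
Lemma observable_blocks (A B : finType) (rho : op (A * B)%type) k eta g u th :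
  state rho -> 0 <= g -> onb u -> \sum_t expR (th t) * qf (tpw rho k) (u t) <= 1 ->
  scone (spec (fun t => expR (- (eta * th t))) u) ->
  (forall s, separable s -> \sum_t expR (- (eta * th t)) * qf s (u t) <= g) ->
  forall l r, observable (tpw rho (iter l (addn k) r)) eta (g ^+ l).
Proof.
move=> hrho g0 hu hr hc hs; elim=> [|l IH] r.
  (* The [r] leftover copies get the zero observable, for which both exponential moments are [1]. *)
  exists (fun s i => if s == i then 1 else 0), (fun=> 0); split; first exact: onb_std.
  split=> [|s ss].
    under eq_bigr do rewrite expR0 mul1r.
    by rewrite -rtr_onb ?state_rtr //; [exact: state_tpow|exact: onb_std].
  under eq_bigr do rewrite mulr0 oppr0 expR0 mul1r.
  rewrite -rtr_onb ?state_rtr ?expr0 //; [exact: sep_state|exact: onb_std].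
rewrite iterS tpow_cat exprS; have pr m : psd (tpw rho m) by apply: psd_tpow; case: hrho.
have := observable_tensor (an_cat A k _) (an_cat B k _) (pr k) (pr _) (exprn_ge0 l g0) hu hr hc hs (IH r).
exact.
Qed.

Definition test_op (T : finType) (M : op T) := psd M /\ psd (opadd (@opid R T) (opopp M)).

Lemma test_spec (T : finType) (p : T -> R) u : onb u -> (forall t, 0 <= p t <= 1) ->
  test_op (spec p u) /\ opadd (@opid R T) (opopp (spec p u)) = spec (fun t => 1 - p t) u.
Proof.
move=> hu hp.
have E : opadd (@opid R T) (opopp (spec p u)) = spec (fun t => 1 - p t) u.
  rewrite -(spec1 hu); apply: funext => i; apply: funext => j.
  rewrite /opadd /opopp /spec /osum -sumrB; apply: eq_bigr => t _.
  by rewrite rCD rCN mulrBl.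
split=> //; split; first by apply: psd_spec => t; case/andP: (hp t).
by rewrite E; apply: psd_spec => t; rewrite subr_ge0; case/andP: (hp t).
Qed.

Lemma rtr_mulC (T : finType) (P Q : op T) : rtr (opmul P Q) = rtr (opmul Q P).
Proof. by rewrite /rtr optr_mulC. Qed.

(** The test accepts when [lam <= th]. The indicator of acceptance is at most [exp (th - lam)] and
    that of rejection at most [exp (eta (lam - th))]. *)
Lemma observable_test (X Y : finType) (rho : op (X * Y)%type) eta g lam :
  0 <= eta -> psd rho -> observable rho eta g -> exists M, test_op M /\
    rtr (opmul M rho) <= expR (- lam) /\
    forall s, separable s -> rtr (opmul (opadd (@opid R _) (opopp M)) s) <= expR (eta * lam) * g.
Proof.
move=> e0 hrho [u [th [hu [hr hs]]]].
pose p t : R := if lam <= th t then 1 else 0.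
have hp t : 0 <= p t <= 1 by rewrite /p; case: ifP => _; rewrite ?lexx ?ler01.
have [hM E] := test_spec hu hp.
exists (spec p u); split=> //; split.
  rewrite rtr_mulC rtr_mul_spec //.
  apply: (@le_trans _ _ (expR (- lam) * \sum_t expR (th t) * qf rho (u t))).
    rewrite mulr_sumr; apply: ler_sum => t _; rewrite mulrA ler_wpM2r ?psd_qf // -expRD /p.
    case: ifP => h; last exact: expR_ge0.
    by rewrite -expR0 ler_expR addrC subr_ge0.
  by rewrite ler_piMr // expR_ge0.
move=> s ss; rewrite E rtr_mulC rtr_mul_spec //.
apply: (@le_trans _ _ (expR (eta * lam) * \sum_t expR (- (eta * th t)) * qf s (u t))); last first.
  by rewrite ler_wpM2l ?expR_ge0 // hs.
rewrite mulr_sumr; apply: ler_sum => t _; rewrite mulrA ler_wpM2r ?psd_qf //.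
  by apply: scone_psd; exact: sep_scone.
rewrite -expRD /p; case: (lerP lam (th t)) => h; first by rewrite subrr expR_ge0.
by rewrite subr0 -expR0 ler_expR -mulrBr mulr_ge0 // subr_ge0 ltW.
Qed.

(** From [exp y <= 1 / (1 - y)] and [(1 - y) (1 + y + 2 y ^ 2) = 1 + y ^ 2 (1 - 2 y)]. *)
Lemma expR_quad (y : R) : y <= 2^-1 -> expR y <= 1 + y + 2 * y ^+ 2.
Proof.
move=> hy; have h1 : 0 < 1 - y by lra.
have h2 : expR y <= (1 - y)^-1.
  rewrite -[leLHS]invrK -expRN lef_pV2 ?posrE ?expR_gt0 //.
  by have := expR_ge1Dx (- y); lra.
apply: (le_trans h2); rewrite -[leLHS]mul1r ler_pdivrMr //.
have := sqr_ge0 y; nra.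
Qed.

Lemma iter_addn_mul k l r : iter l (addn k) r = (l * k + r)%N.
Proof. by elim: l => [|l IH] //=; rewrite IH mulSn addnA. Qed.

Lemma exists_nat_mul_ge (x y : R) : 0 < x -> exists n : nat, forall m, (n <= m)%N -> y <= m%:R * x.
Proof.
move=> x0; exists (Num.truncn (y / x)).+1 => m hm.
rewrite -ler_pdivrMr //; apply: (@le_trans _ _ (Num.truncn (y / x)).+1%:R); last by rewrite ler_nat.
by apply: ltW; exact: truncnS_gt.
Qed.

(** For a small exponent the exponential moment is [exp (- eta b)] up to second order, so a
    threshold strictly between [k c] and [b] per block is missed with probability exponentially
    small in the number of blocks. *)
Lemma block_achievability (A B : finType) (rho : op (A * B)%type) k u th b c eps :
  state rho -> (0 < k)%N -> onb u -> \sum_t expR (th t) * qf (tpw rho k) (u t) <= 1 ->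
  (forall s, separable s -> b <= \sum_t th t * qf s (u t)) ->
  k%:R * c < b -> 0 < eps ->
  exists N, forall n, (N <= n)%N -> exists M, test_op M /\
    rtr (opmul M (tpw rho n)) <= expR (- (n%:R * c)) /\
    forall s, separable s -> rtr (opmul (opadd (@opid R _) (opopp M)) s) <= eps.
Proof.
move=> hrho k0 hu hr hs hcb eps0.
have [kap [kap0 hkap]] := cone_small hu.
pose K := 1 + \sum_t `|th t|.
have K1 : 1 <= K by rewrite lerDl; apply: sumr_ge0 => t _; exact: normr_ge0.
have thK t : `|th t| <= K.
  rewrite /K (bigD1 t) //= addrCA lerDl addr_ge0 //.
  by apply: sumr_ge0 => i _; exact: normr_ge0.
pose d := b - k%:R * c.
have d0 : 0 < d by rewrite subr_gt0.
(* [m] bounds [|eta * th t|]. The value [1 / 2] is for [expR_quad], [kap / 2] keeps [exp (- eta th)]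
   within [kap] of [1], and [d / (8 K)] makes the second-order term [2 m ^ 2] at most
   [eta d / 4]. *)
pose m := Num.min (Num.min (2^-1) (kap / 2)) (d / (8 * K)).
have m0 : 0 < m.
  by rewrite !lt_min invr_gt0 ltr0n /= !divr_gt0 // mulr_gt0 //; lra.
have [m1 [m2 m3]] : m <= 2^-1 /\ m <= kap / 2 /\ m <= d / (8 * K).
  by rewrite /m !ge_min !lexx !orbT.
pose eta := m / K.
have eta0 : 0 < eta by rewrite divr_gt0 //; lra.
have etath t : `|eta * th t| <= m.
  rewrite normrM gtr0_norm // /eta mulrAC ler_pdivrMr ?ler_pM2l //; lra.
have quad t : expR (- (eta * th t)) <= 1 - eta * th t + 2 * (eta * th t) ^+ 2.
  have := @expR_quad (- (eta * th t)); rewrite sqrrN; apply.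
  by have := etath t; rewrite ler_norml => /andP[]; lra.
have sqb t : (eta * th t) ^+ 2 <= m ^+ 2.
  rewrite -[leLHS]real_normK ?num_real // ler_pXn2r ?nnegrE ?normr_ge0 //.
  exact: ltW.
pose g := expR (- (eta * b) + 2 * m ^+ 2).
have hg s : separable s -> \sum_t expR (- (eta * th t)) * qf s (u t) <= g.
  move=> ss; have ps := scone_psd (sep_scone ss).
  have s1 : \sum_t qf s (u t) = 1 by rewrite -rtr_onb // state_rtr //; exact: sep_state.
  apply: (@le_trans _ _ (\sum_t (1 - eta * th t + 2 * m ^+ 2) * qf s (u t))).
    apply: ler_sum => t _; rewrite ler_wpM2r ?psd_qf //.
    by have := quad t; have := sqb t; lra.
  have -> : \sum_t (1 - eta * th t + 2 * m ^+ 2) * qf s (u t) =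
     (1 + 2 * m ^+ 2) * \sum_t qf s (u t) - eta * \sum_t th t * qf s (u t).
    by rewrite !mulr_sumr -sumrB; apply: eq_bigr => t _; ring.
  rewrite s1 mulr1; apply: le_trans (expR_ge1Dx _).
  have := ler_wpM2l (ltW eta0) (hs s ss); lra.
have hc : scone (spec (fun t => expR (- (eta * th t))) u).
  have -> : (fun t => expR (- (eta * th t))) = (fun t => 1 + (expR (- (eta * th t)) - 1)).
    by apply: funext => t; ring.
  apply: hkap => t; rewrite ler_norml; apply/andP; split.
    have := expR_ge1Dx (- (eta * th t)); have := etath t; rewrite ler_norml => /andP[]; lra.
  have := quad t; have := sqb t; have := etath t; rewrite ler_norml => /andP[].
  have : m ^+ 2 <= m * 2^-1 by rewrite expr2 ler_pM2l.
  lra.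
have obs := observable_blocks hrho (expR_ge0 _) hu hr hc hg.
(* The threshold per block is halfway between [k c] and [b]. One half of the gap pays for the
   leftover copies ([L1]), the other for the second-order term and for [eps] ([L2]). *)
pose tau := k%:R * c + d / 2.
have [L1 hL1] := @exists_nat_mul_ge (d / 2) (k%:R * `|c|) ltac:(lra).
have [L2 hL2] := @exists_nat_mul_ge (eta * (d / 4)) (- ln eps) ltac:(by rewrite mulr_gt0 //; lra).
exists ((maxn L1 L2).+1 * k)%N => n hn.
have En : n = iter (n %/ k)%N (addn k) (n %% k)%N by rewrite iter_addn_mul -divn_eq.
pose l := (n %/ k)%N; pose r := (n %% k)%N.
have hl : (maxn L1 L2 <= l)%N by apply: ltnW; rewrite /l leq_divRL.
have rk : (r < k)%N by rewrite ltn_mod.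
have obsn : observable (tpw rho n) eta (g ^+ l) by have := obs l r; rewrite /l /r -En.
have pn : psd (tpw rho n) by apply: psd_tpow; case: hrho.
have [M [hM [h1 h2]]] := observable_test (l%:R * tau) (ltW eta0) pn obsn; exists M; split=> //; split.
  apply: (le_trans h1); rewrite ler_expR lerN2.
  have -> : n%:R = l%:R * k%:R + r%:R :> R by rewrite -natrM -natrD /l /r -divn_eq.
  rewrite mulrDl /tau.
  have : r%:R * c <= k%:R * `|c|.
    apply: (@le_trans _ _ (r%:R * `|c|)); first by rewrite ler_wpM2l // ler_norm.
    by rewrite ler_wpM2r ?normr_ge0 // ler_nat ltnW.
  have := hL1 l (leq_trans (leq_maxl _ _) hl); lra.
move=> s ss; apply: (le_trans (h2 s ss)).
rewrite /g -expRM_natl -expRD -[leRHS]lnK ?posrE // ler_expR.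
have h3 : 2 * m ^+ 2 <= eta * (d / 4).
  rewrite /eta expr2.
  have -> : m / K * (d / 4) = 2 * (m * (d / (8 * K))) by field; lra.
  by rewrite ler_pM2l // ler_pM2l.
have h4 : eta * (l%:R * tau) + l%:R * (- (eta * b) + 2 * m ^+ 2)
      <= - (l%:R * (eta * (d / 4))).
  have -> : eta * (l%:R * tau) + l%:R * (- (eta * b) + 2 * m ^+ 2) =
     l%:R * (2 * m ^+ 2 - eta * (d / 2)) by rewrite /tau /d; field.
  rewrite -[leRHS]mulrN ler_wpM2l //; lra.
have := hL2 l (leq_trans (leq_maxr _ _) hl).
move: h4; lra.
Qed.

End Blocks.

(** * Pinching *)

Section Pinching.
Variable R : realType.
Local Notation C := R[i].
Local Notation op := (@op R).

Lemma rtr_mul_mono (T : finType) (L M s : op T) : psd s ->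
  (forall x, qf L x <= qf M x) -> rtr (opmul s L) <= rtr (opmul s M).
Proof.
move=> /psd_spectral [a [u [hu [ha ->]]]] h; rewrite !(rtr_mulC (spec _ _)) !rtr_mul_spec //.
by apply: ler_sum => t _; rewrite ler_wpM2l.
Qed.

Lemma ln_trace_mono (T : finType) (a b : T -> R) u w (s : op T) : onb u -> onb w ->
  (forall t, 0 < a t) -> (forall t, 0 < b t) -> psd s ->
  (forall x, qf (spec a u) x <= qf (spec b w) x) ->
  \sum_t ln (a t) * qf s (u t) <= \sum_t ln (b t) * qf s (w t).
Proof.
move=> hu hw ha hb ps h; rewrite -!rtr_mul_spec //.
by apply: rtr_mul_mono => // x; exact: ln_op_mono.
Qed.

(** The squares of all pairwise differences have a nonnegative sum. The factor [#|K|] becomes the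
    cost of pinching. *)
Lemma sqr_sum_le (K : finType) (a : K -> R) : (\sum_k a k) ^+ 2 <= #|K|%:R * \sum_k a k ^+ 2.
Proof.
have h : 0 <= \sum_k \sum_l (a k - a l) ^+ 2.
  by apply: sumr_ge0 => k _; apply: sumr_ge0 => l _; exact: sqr_ge0.
have E : \sum_k \sum_l (a k - a l) ^+ 2 =
    2 * (#|K|%:R * \sum_k a k ^+ 2) - 2 * (\sum_k a k) ^+ 2.
  transitivity (\sum_k (#|K|%:R * a k ^+ 2 + \sum_l a l ^+ 2 - 2 * a k * \sum_l a l)).
    apply: eq_bigr => k _.
    have -> : #|K|%:R * a k ^+ 2 = \sum_(l : K) a k ^+ 2 by rewrite sumr_const mulr_natl.
    rewrite mulr_sumr -big_split -sumrB; apply: eq_bigr => l _ /=; ring.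
  rewrite sumrB big_split /= -mulr_suml -!mulr_sumr sumr_const -[_ *+ _]mulr_natl expr2.
  by rewrite -/(#|K|); ring.
lra.
Qed.

Lemma Im_sum (I : Type) (r : seq I) (P : pred I) (F : I -> C) :
  complex.Im (\sum_(i <- r | P i) F i) = \sum_(i <- r | P i) complex.Im (F i).
Proof. by elim/big_rec2: _ => //= i x y _ <-; case: (F i); case: y. Qed.

Lemma nsq_sum_le (K : finType) (z : K -> C) : nsq (\sum_k z k) <= #|K|%:R * \sum_k nsq (z k).
Proof.
rewrite /nsq Re_sum Im_sum big_split mulrDr.
by apply: lerD; exact: sqr_sum_le.
Qed.

Variables (T K : finType) (v : T -> T -> C) (c : T -> K).
Hypothesis hv : onb v.
Variable Y : op T.
Hypothesis hY : hermitian Y.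

(** Blocks are indexed by labels, not by eigenvalues: different labels may share an eigenvalue, and
    only the number of labels enters the estimates. *)
Definition blk k : op T := spec (fun t => if c t == k then 1 else 0) v.
Definition pinch : op T := osum (fun=> 1) (fun k => opmul (blk k) (opmul Y (blk k))).

Lemma blkM k : opmul (blk k) (blk k) = blk k.
Proof.
rewrite /blk specM //; congr spec; apply: funext => t.
by case: eqP; rewrite ?mulr1 ?mulr0.
Qed.

Lemma blk_sum x : x = fun i => \sum_k opapp (blk k) x i.
Proof.
rewrite -{1}(opapp_id x) -(spec1 hv) spec_app; apply: funext => i.
under [RHS]eq_bigr do rewrite spec_app.
rewrite exchange_big /=; apply: eq_bigr => t _.
rewrite -2!mulr_suml -rC_sum; congr (rC _ * _ * _).
by rewrite -[LHS](sum_delta (c t) (fun=> 1)); apply: eq_bigr => k _; rewrite mulr1.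
Qed.

Lemma herm_pinch : hermitian pinch.
Proof.
apply: herm_osum => k; rewrite /hermitian !opadjM.
by rewrite [opadj (blk k)]herm_spec hY opmulA.
Qed.

Lemma qf_pinch x : qf pinch x = \sum_k qf Y (opapp (blk k) x).
Proof.
rewrite qf_osum; apply: eq_bigr => k _; rewrite mul1r /qf !opapp_mul.
by rewrite ip_herm //; exact: herm_spec.
Qed.

Lemma rtr_pinch : rtr pinch = rtr Y.
Proof.
rewrite rtr_osum (rtr_onb _ hv).
transitivity (\sum_k \sum_t (if c t == k then 1 else 0) * qf Y (v t)).
  apply: eq_bigr => k _; rewrite mul1r rtr_mulC -opmulA blkM rtr_mul_spec //.
rewrite exchange_big /=; apply: eq_bigr => t _.
by rewrite (sum_delta (c t) (fun=> qf Y (v t))).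
Qed.

Lemma pinch_basis t : opapp pinch (v t) = opapp (blk (c t)) (opapp Y (v t)).
Proof.
apply: funext => i; rewrite {1}/opapp /pinch /osum.
under eq_bigr do rewrite mulr_suml.
rewrite exchange_big /= (bigD1 (c t)) //= [X in _ + X]big1 ?addr0 => [|k /negbTE hk].
  rewrite -[RHS]/(opapp _ _ i) -[in RHS](_ : opapp (blk (c t)) (v t) = v t); last first.
    by rewrite spec_eigen // eqxx; apply: funext => j; rewrite mul1r.
  rewrite -!opapp_mul -opmulA; apply: eq_bigr => j _; by rewrite mul1r.
under eq_bigr do rewrite mul1r.
rewrite -[LHS]/(opapp (opmul (blk k) (opmul Y (blk k))) (v t) i) !opapp_mul spec_eigen //.
rewrite eq_sym hk /opapp big1 // => j _; rewrite big1 ?mulr0 // => l _.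
by rewrite mul0r mulr0.
Qed.

(** The diagonal operator is a scalar on each block, and the pinched operator preserves the
    blocks. *)
Lemma pinch_comm (rr : K -> R) :
  opmul pinch (spec (fun t => rr (c t)) v) = opmul (spec (fun t => rr (c t)) v) pinch.
Proof.
apply: (op_ext_onb hv) => t; rewrite !opapp_mul spec_eigen // pinch_basis.
have E k y : opapp (spec (fun t => rr (c t)) v) (opapp (blk k) y) =
    fun i => rC (rr k) * opapp (blk k) y i.
  rewrite -opapp_mul specM // !spec_app; apply: funext => i; rewrite mulr_sumr.
  by apply: eq_bigr => s _; rewrite rCM; case: eqP => [->|_]; rewrite ?rC0; ring.
rewrite E -pinch_basis; apply: funext => i; rewrite /opapp mulr_sumr.
by apply: eq_bigr => j _; ring.
Qed.

End Pinching.

(** * The block observable and the method of types *)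

Section PinchedObservable.
Variable R : realType.
Local Notation C := R[i].
Local Notation op := (@op R).

Lemma spec_gt0 (T : finType) (a : T -> R) u x : onb u -> (forall t, 0 < a t) -> nrm x = 1 ->
  0 < qf (spec a u) x.
Proof.
move=> hu ha hx; rewrite qf_spec lt_def sumr_ge0 ?andbT => [|t _]; last first.
  by rewrite mulr_ge0 ?nsq_ge0 // ltW.
rewrite psumr_neq0 => [|t _]; last by rewrite mulr_ge0 ?nsq_ge0 // ltW.
apply/hasPn => h; have : nrm x = 0; last by rewrite hx => /eqP; rewrite oner_eq0.
rewrite (parseval x hu) big1 // => t _; have := h t (mem_index_enum t).
rewrite /= -leNgt pmulr_rle0 // => h0.
by apply/eqP; rewrite eq_le h0 nsq_ge0.
Qed.

(** The observable is [ln (pinch Y) - ln r], diagonal in a common eigenbasis. The pinching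
    inequality [Y <= #|K| * pinch Y] and monotonicity of [ln] cost only [ln #|K|]. The exponential
    moment reduces to [tr Y = 1] because [rho <= r]; [rho] itself is not pinched. *)
Lemma pinched_observable (T K : finType) (v w : T -> T -> C) (c : T -> K) (rr : K -> R)
    (y : T -> R) (rho : op T) :
  onb v -> onb w -> (forall k, 0 < rr k) -> (forall t, 0 < y t) -> \sum_t y t = 1 ->
  (forall x, qf rho x <= qf (spec (fun t => rr (c t)) v) x) ->
  exists u th, onb u /\ \sum_t expR (th t) * qf rho (u t) <= 1 /\
  forall s, state s -> \sum_t ln (y t) * qf s (w t) - \sum_t ln (rr (c t)) * qf s (v t)
     - ln #|K|%:R <= \sum_t th t * qf s (u t).
Proof.
move=> hv hw hrr hy hy1 hrho.
set Y := spec y w; set r := fun t => rr (c t).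
have hY : hermitian Y by exact: herm_spec.
have [z [r' [u [hu [EZ ER]]]]] :=
  commuting_spectral (herm_pinch v c hY) (herm_spec r v) (pinch_comm c hv Y rr).
have T0 : (0 < #|T|)%N.
  rewrite lt0n; apply/negP => /eqP/card0_eq T0; move: hy1; rewrite big_pred0 // => /eqP.
  by rewrite eq_sym oner_eq0.
have K0 : 0 < #|K|%:R :> R.
  rewrite ltr0n; case/card_gt0P: T0 => t _; apply/card_gt0P; by exists (c t).
(* The pinching inequality: for each eigenvector of [Y], its inner product with [x] is the sum over
   the blocks, and [nsq_sum_le] bounds the squared modulus. *)
have pin x : qf Y x <= #|K|%:R * qf (pinch v c Y) x.
  rewrite qf_pinch // {1}(blk_sum c hv x) /Y qf_spec.
  under [X in _ <= _ * X]eq_bigr do rewrite qf_spec.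
  rewrite exchange_big /= mulr_sumr; apply: ler_sum => t _.
  rewrite -mulr_sumr mulrCA; apply: (ler_wpM2l (ltW (hy t))).
  have -> : (fun i => \sum_k opapp (blk v c k) x i) = fun i => \sum_k 1 * opapp (blk v c k) x i.
    by apply: funext => i; apply: eq_bigr => k _; rewrite mul1r.
  rewrite ip_sumr; under eq_bigr do rewrite mul1r.
  exact: nsq_sum_le.
have z0 t : 0 < z t.
  have := pin (u t); rewrite EZ qf_spec_basis // => h.
  have : 0 < #|K|%:R * z t by apply: lt_le_trans h; apply: spec_gt0 => //; exact: onb_nrm.
  by rewrite pmulr_rgt0.
have r0 t : 0 < r' t.
  by rewrite -(qf_spec_basis r' t hu) -ER; apply: spec_gt0 => [//|t'|]; [exact: hrr|exact: onb_nrm].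
exists u, (fun t => ln (z t) - ln (r' t)); split=> //; split.
  apply: (@le_trans _ _ (\sum_t z t)).
    apply: ler_sum => t _; rewrite expRD expRN !lnK ?posrE //.
    rewrite -mulrA; apply: ler_piMr; first exact: ltW.
    rewrite mulrC ler_pdivrMr // mul1r.
    by rewrite -[leRHS](qf_spec_basis r' t hu) -ER.
  have -> : \sum_t z t = 1; last by [].
  have := rtr_pinch c hv Y; rewrite EZ (rtr_onb _ hu) /Y (rtr_onb _ hw).
  under eq_bigr do rewrite qf_spec_basis //.
  by under [in RHS]eq_bigr do rewrite qf_spec_basis //; rewrite hy1.
move=> s ss; have ps : psd s by case: ss.
under [leRHS]eq_bigr do rewrite mulrBl.
rewrite sumrB.
(* Both sides belong to the same operator with two spectral decompositions; monotonicity shows that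
   the choice of decomposition is harmless. *)
have h1 : \sum_t ln (r' t) * qf s (u t) <= \sum_t ln (r t) * qf s (v t).
  by apply: ln_trace_mono => // [t|x]; [exact: hrr|rewrite -ER].
have h2 : \sum_t ln (y t) * qf s (w t) <= \sum_t ln (#|K|%:R * z t) * qf s (u t).
  apply: ln_trace_mono => // [t|x]; first by rewrite mulr_gt0.
  apply: (le_trans (pin x)); rewrite EZ !qf_spec mulr_sumr.
  by under eq_bigr do rewrite mulrA.
have h3 : \sum_t ln (#|K|%:R * z t) * qf s (u t) = ln #|K|%:R + \sum_t ln (z t) * qf s (u t).
  have <- : \sum_t ln #|K|%:R * qf s (u t) = ln #|K|%:R.
    by rewrite -mulr_sumr -rtr_onb // (state_rtr ss) mulr1.
  rewrite -big_split; apply: eq_bigr => t _ /=.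
  have -> : ln (#|K|%:R * z t) = ln #|K|%:R + ln (z t) by rewrite lnM ?posrE.
  by rewrite mulrDl.
move: h1 h2 h3; rewrite /r; lra.
Qed.

Variables A B : finType.

(** The type of a string of eigenvector labels. The eigenvalue of a tensor power depends on the type
    only, and the number of types is polynomial in [n]. *)
Fixpoint cnt n : (An A n * An B n)%type -> (A * B)%type -> nat :=
  match n with
  | 0 => fun _ _ => 0%N
  | n.+1 => fun t s => let q := split_loc (an_cons A n) (an_cons B n) t in
      ((q.1 == s) + cnt q.2 s)%N
  end.

Lemma cnt_le n t s : (@cnt n t s <= n)%N.
Proof.
elim: n t => [|n IH] t //=; apply: (@leq_add _ _ 1 n); last exact: IH.
by case: (_ == s).
Qed.

Lemma apow_cnt (a : (A * B)%type -> R) n t : @apow R A B a n t = \prod_s a s ^+ @cnt n t s.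
Proof.
elim: n t => [|n IH] t /=; first by rewrite big1.
rewrite IH; set q1 := (_, _).
under [RHS]eq_bigr do rewrite exprD.
rewrite big_split /=; congr (_ * _); rewrite (bigD1 q1) //= eqxx expr1 big1 ?mulr1 // => s.
by rewrite eq_sym => /negbTE ->.
Qed.

Lemma sum_apow (a : (A * B)%type -> R) n : \sum_t @apow R A B a n t = (\sum_s a s) ^+ n.
Proof.
elim: n => [|n IH].
  have <- : rtr (@opid R (An A 0 * An B 0)%type) = \sum_t @apow R A B a 0 t.
    rewrite (rtr_onb _ (@onb_std R _)); apply: eq_bigr => t _.
    by rewrite qf_id; exact: (onb_nrm t (@onb_std R _)).
  rewrite expr0 /rtr /optr (bigD1 ([ffun i : 'I_0 => match i with Ordinal _ l => False_rect A (notF l) end],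
     [ffun i : 'I_0 => match i with Ordinal _ l => False_rect B (notF l) end])) //=.
  rewrite big1 => [|[f g] /eqP []]; last by congr (_, _); apply/ffunP => -[].
  by rewrite /opid eqxx addr0.
set e := split_loc (an_cons A n) (an_cons B n).
have E t : @apow R A B a n.+1 t = a (e t).1 * apow a (e t).2 by [].
rewrite (sum_split e) exprS -IH mulr_suml.
apply: eq_bigr => p _; rewrite mulr_sumr; apply: eq_bigr => q _.
by rewrite E spiK.
Qed.

(** For [k = 4 ^ i - 1] the logarithm of [k + 1] is linear in [i], while [k >= i ^ 2 + i]. *)
Lemma exists_log_lt (D : R) : exists k : nat, (0 < k)%N /\ D * ln (k.+1)%:R < k%:R.
Proof.
pose i := (Num.truncn (2 * `|D|)).+1.
have hi : 2 * `|D| < i%:R by exact: truncnS_gt.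
exists (2 ^ (2 * i) - 1)%N.
have e1 : (i.+1 <= 2 ^ i)%N by exact: ltn_expl.
have e2 : (i.+1 ^ 2 <= 2 ^ (2 * i))%N by rewrite mulnC expnM leq_sqr.
have e3 : (0 < 2 ^ (2 * i))%N by rewrite expn_gt0.
split; first by rewrite subn_gt0; apply: leq_trans e2; rewrite /i.
rewrite subn1 prednK //.
have : (i * i + i <= (2 ^ (2 * i)).-1)%N.
  rewrite -ltnS prednK //; apply: leq_trans e2; rewrite expnS expn1; lia.
rewrite -(ler_nat R) natrD natrM => h; apply: lt_le_trans h.
rewrite natrX lnXn ?ltr0n // -[ln _ *+ _]mulr_natl natrM.
have l2 : ln (2 : R) <= 1.
  have := @le_ln1Dx R 1 ltac:(lra); rewrite (_ : 1 + 1 = 2) //; lra.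
have l0 : 0 <= ln (2 : R) by rewrite ln_ge0 //; lra.
have i0 : 0 < i%:R :> R by rewrite ltr0n.
have d0 := ler_norm D; have d1 := normr_ge0 D.
set L := ln 2 in l2 l0 *; set I := i%:R in hi i0 *.
apply: (@le_lt_trans _ _ (`|D| * (2 * I))).
  apply: (@le_trans _ _ (`|D| * (2 * I * L))).
    by apply: ler_wpM2r => //; rewrite !mulr_ge0 // ltW.
  by apply: ler_wpM2l => //; apply: ler_piMr => //; rewrite mulr_ge0 // ltW.
nra.
Qed.

Lemma dual_achievability (r : (A * B)%type -> R) v b w eta c1 c0 eps :
  let rho : op (A * B)%type := spec r v in
  state rho -> onb v -> onb w -> 0 < eta -> (forall t, 0 < b t) -> \sum_t b t = 1 ->
  (forall s, separable s ->
     c1 <= \sum_t ln (b t) * qf s (w t) - \sum_t ln (r t + eta) * qf s (v t)) ->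
  c0 < c1 -> 0 < eps ->
  exists N, forall n, (N <= n)%N -> exists M, test_op M /\
    rtr (opmul M (tpw rho n)) <= expR (- (n%:R * c0)) /\
    forall s, separable s -> rtr (opmul (opadd (@opid R _) (opopp M)) s) <= eps.
Proof.
move=> rho hrho hv hw eta0 hb hb1 hs hc eps0.
have r0 t : 0 <= r t by apply: (psd_spec_ge0 _ hv); case: hrho.
have re0 t : 0 < r t + eta by have := r0 t; lra.
(* The block is long enough for the pinching cost [ln #|K|], which is [#|A * B| * ln (k + 1)], to
   stay below the gap [k (c1 - c0)]. *)
have [k [k0 hk]] := exists_log_lt (#|{: A * B}|%:R / (c1 - c0)).
pose K := {ffun (A * B)%type -> 'I_k.+1}.
pose c (t : (An A k * An B k)%type) : K := [ffun s => inord (cnt t s)].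
pose rr (q : K) : R := \prod_s (r s + eta) ^+ q s.
have rrc t : rr (c t) = apow (fun s => r s + eta) t.
  rewrite apow_cnt; apply: eq_bigr => s _; rewrite ffunE inordK //.
  by rewrite ltnS; exact: cnt_le.
have rr0 q : 0 < rr q by apply: prodr_gt0 => s _; rewrite exprn_gt0.
have [||||||u [th [hu [h1 h2]]]] := @pinched_observable _ _ (@upow R A B v k) (@upow R A B w k) c rr
  (@apow R A B b k) (tpw rho k) => //.
- exact: onb_upow.
- exact: onb_upow.
- by move=> t; exact: apow_gt0.
- by rewrite sum_apow hb1 expr1n.
- move=> x; rewrite tpow_spec !qf_spec; apply: ler_sum => t _.
  rewrite ler_wpM2r ?nsq_ge0 // rrc.
  elim: (k) t => [|n IH] t //=; apply: ler_pM => //; first exact: apow_ge0.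
  by rewrite lerDl ltW.
apply: (block_achievability hrho k0 hu h1 (b := k%:R * c1 - ln #|K|%:R)) => //.
  move=> s ss; apply: le_trans (h2 s (sep_state ss)).
  rewrite lerD2r.
  under [X in _ <= X - _]eq_bigr do rewrite ln_apow //.
  under [X in _ <= _ - X]eq_bigr do rewrite rrc ln_apow //.
  exact: hpow_add.
rewrite card_ffun card_ord natrX lnXn ?ltr0n // -[ln _ *+ _]mulr_natl.
move: hk; rewrite mulrAC ltr_pdivrMr ?subr_gt0 //; lra.
Qed.

End PinchedObservable.

(** * Compactness of the set of separable states *)

Section Caratheodory.
Variable R : realType.

(** A matrix with more rows than columns has a nonzero left kernel vector, extended here by zero
    outside [S]. *)
Lemma dependent_family (I J : finType) (V : I -> J -> R) (S : {set I}) : (#|J| < #|S|)%N ->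
  exists d : I -> R, (forall i, i \notin S -> d i = 0) /\ (exists i, d i != 0) /\
    forall j, \sum_i d i * V i j = 0.
Proof.
move=> hJS.
pose M : 'M[R]_(#|S|, #|J|) := \matrix_(k, j) V (enum_val k) (enum_val j).
have : kermx M != 0.
  rewrite kermx_eq0 /row_free neq_ltn; apply/orP; left.
  exact: leq_ltn_trans (rank_leq_col M) hJS.
move=> /rowV0Pn [x /sub_kermxP xM x0].
pose d i := \sum_(k < #|S|) (if enum_val k == i then x 0 k else 0).
have dv k : d (enum_val k) = x 0 k.
  rewrite /d (bigD1 k) //= eqxx big1 ?addr0 // => l /negbTE hl.
  by rewrite (inj_eq enum_val_inj) hl.
exists d; split=> [i iS|].
  rewrite /d big1 // => k _; case: eqP => // e.
  by move: iS; rewrite -e enum_valP.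
split.
  have [k hk] : exists k, x 0 k != 0.
    apply/existsP; apply: contraNT x0; rewrite negb_exists => /forallP h.
    by apply/eqP/rowP => k; rewrite mxE; apply/eqP; rewrite -[_ == _]negbK.
  by exists (enum_val k); rewrite dv.
move=> j; have /rowP/(_ (enum_rank j)) := xM; rewrite !mxE => E.
rewrite -[RHS]E /d; under eq_bigr do rewrite mulr_suml.
rewrite exchange_big /=; apply: eq_bigr => k _.
rewrite !mxE enum_rankK (bigD1 (enum_val k)) //= eqxx big1 ?addr0 // => i /negbTE hi.
by rewrite eq_sym hi mul0r.
Qed.

(** The weights move along a linear dependence until the first one vanishes. In this conic form the
    total weight is not a constraint, so [#|J|] terms suffice. *)
Lemma caratheodory (I J : finType) (V : I -> J -> R) (p : I -> R) : (forall i, 0 <= p i) ->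
  exists q : I -> R, (forall i, 0 <= q i) /\ (#|[set i | q i != 0%R]%SET| <= #|J|)%N /\
    forall j, \sum_i q i * V i j = \sum_i p i * V i j.
Proof.
move: {2}#|_|.+1 (ltnSn #|[set i | p i != 0%R]%SET|) => n; elim: n p => // n IH p hn hp.
have [hJ|hJ] := leqP #|[set i | p i != 0%R]%SET| #|J|; first by exists p.
have [d [dS [[i0 di0] dV]]] := dependent_family V hJ.
wlog [i1 di1] : d dS di0 dV / exists i, 0 < d i.
  move=> W; case: (ltrgtP 0 (d i0)) => [h|h|h].
  - by apply: (W d) => //; exists i0.
  - apply: (W (fun i => - d i)) => [i /dS ->||j|]; rewrite ?oppr0 ?oppr_eq0 //.
      by under eq_bigr do rewrite mulNr; rewrite sumrN dV oppr0.
    by exists i0; rewrite oppr_gt0.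
  - by rewrite -h eqxx in di0.
(* The smallest ratio [p i / d i] is the longest step that keeps all weights nonnegative, and it
   annihilates the weight at [i2]. *)
have [i2 di2 hmin] := @arg_minP _ _ _ i1 (fun i => 0 < d i) (fun i => p i / d i) di1.
have hS i : 0 < d i -> p i != 0.
  move=> h; have := dS i; rewrite inE => dS'; apply/negP => pi0.
  by move: h; rewrite dS' ?ltxx // negbK.
pose lam := p i2 / d i2.
have lam0 : 0 <= lam by apply: divr_ge0 => //; exact: ltW.
have [||q [hq [hq2 hq3]]] := IH (fun i => p i - lam * d i).
- rewrite ltnS in hn; apply: leq_trans hn; apply: proper_card; apply/properP; split.
    apply/fintype.subsetP => i; rewrite !inE; apply: contraNN => pi0.
    by rewrite (eqP pi0) dS ?mulr0 ?subr0 // inE pi0.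
  exists i2; rewrite !inE ?hS // negbK /lam divfK ?subrr //; exact: lt0r_neq0.
- move=> i; rewrite subr_ge0; have [h|h] := lerP (d i) 0.
    by apply: le_trans (hp i); rewrite mulr_ge0_le0.
  by rewrite -ler_pdivlMr //; exact: hmin.
exists q; split=> //; split=> // j; rewrite hq3.
under eq_bigr do rewrite mulrBl -mulrA.
by rewrite sumrB -mulr_sumr dV mulr0 subr0.
Qed.

End Caratheodory.

Section Compactness.
Variable R : realType.
Local Notation C := R[i].
Local Notation op := (@op R).

(** Along an ultrafilter all bounded sequences converge simultaneously, which replaces repeated
    extraction of subsequences. *)
Lemma ultra_bounded (U : set_system nat) (f : nat -> R) M : UltraFilter U ->
  (forall n, `|f n| <= M) -> exists l : R, f @ U --> l.
Proof.
move=> hU hf; have pU := @ultra_proper _ _ hU.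
have uf : UltraFilter (f @ U).
  split=> [|G pG sG]; first exact: fmap_proper_filter.
  apply/seteqP; split=> A; last exact: sG.
  move=> GA; case: (in_ultra_setVsetC (f @^-1` A) hU) => // hc.
  have : G (~` A) by exact: sG.
  move=> GC; have : G (A `&` ~` A) by exact: filterI.
  by rewrite setICr => /filter_not_empty.
have := @segment_compact R (- M) M; rewrite compact_ultra => /(_ (f @ U) uf) [].
  apply: (@filterE _ U) => n /=; rewrite in_itv /= -ler_norml; exact: hf.
by move=> l [_ hl]; exists l.
Qed.

Section CLimits.
Variable U : set_system nat.
Hypothesis pU : ProperFilter U.

Definition ccvg (z : nat -> C) (l : C) :=
  (fun n => complex.Re (z n)) @ U --> complex.Re l /\
  (fun n => complex.Im (z n)) @ U --> complex.Im l.

Lemma cvg_sumR (I : Type) (r : seq I) (f : I -> nat -> R) (l : I -> R) :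
  (forall k, f k @ U --> l k) -> (fun n => \sum_(k <- r) f k n) @ U --> \sum_(k <- r) l k.
Proof.
move=> h; elim: r => [|k r IH].
  by under eq_fun do rewrite big_nil; rewrite big_nil; exact: cvg_cst.
by under eq_fun do rewrite big_cons; rewrite big_cons; apply: cvgD.
Qed.

Lemma ccvg_sum (I : Type) (r : seq I) (f : I -> nat -> C) (l : I -> C) :
  (forall k, ccvg (f k) (l k)) -> ccvg (fun n => \sum_(k <- r) f k n) (\sum_(k <- r) l k).
Proof.
move=> h; split.
  by under eq_fun do rewrite Re_sum; rewrite Re_sum; apply: cvg_sumR => k; case: (h k).
by under eq_fun do rewrite Im_sum; rewrite Im_sum; apply: cvg_sumR => k; case: (h k).
Qed.

Lemma ccvgM f g l m : ccvg f l -> ccvg g m -> ccvg (fun n => f n * g n) (l * m).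
Proof.
move=> [f1 f2] [g1 g2].
have ReM (z w : C) : complex.Re (z * w) = complex.Re z * complex.Re w - complex.Im z * complex.Im w.
  by case: z; case: w.
have ImM (z w : C) : complex.Im (z * w) = complex.Re z * complex.Im w + complex.Im z * complex.Re w.
  by case: z; case: w.
split.
  by under eq_fun do rewrite ReM; rewrite ReM; apply: cvgB; apply: cvgM.
by under eq_fun do rewrite ImM; rewrite ImM; apply: cvgD; apply: cvgM.
Qed.

Lemma ccvgJ f l : ccvg f l -> ccvg (fun n => conjc (f n)) (conjc l).
Proof.
move=> [f1 f2].
have ReJ (z : C) : complex.Re (conjc z) = complex.Re z by case: z.
have ImJ (z : C) : complex.Im (conjc z) = - complex.Im z by case: z.
split.
  by under eq_fun do rewrite ReJ; rewrite ReJ.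
by under eq_fun do rewrite ImJ; rewrite ImJ; apply: cvgN.
Qed.

Lemma ccvg_cst l : ccvg (fun=> l) l.
Proof. by split; exact: cvg_cst. Qed.

End CLimits.

Variables X Y : finType.

Definition prodop (x : X -> C) (y : Y -> C) : op (X * Y)%type :=
  tens (ketbra x x) (ketbra y y).

Lemma optr_ketbra (T : finType) (z : T -> C) : optr (ketbra z z) = rC (nrm z).
Proof. by rewrite -ip_nrm; apply: eq_bigr => i _; rewrite mulrC. Qed.

Lemma rtr_prodop x y : rtr (prodop x y) = nrm x * nrm y.
Proof. by rewrite /rtr [optr _](optr_etens (split_id X Y)) !optr_ketbra -rCM. Qed.

Lemma scone_rank1 (s : op (X * Y)%type) : scone s ->
  exists (I : finType) (p : I -> R) (x : I -> X -> C) (y : I -> Y -> C),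
    (forall i, 0 <= p i) /\ (forall i, nrm (x i) = 1) /\ (forall i, nrm (y i) = 1) /\
    s = osum p (fun i => prodop (x i) (y i)).
Proof.
elim=> [a b /psd_spectral [c [u [hu [hc ->]]]] /psd_spectral [d [w [hw [hd ->]]]]||
  s1 s2 _ [I1 [p1 [x1 [y1 [hp1 [hx1 [hy1 ->]]]]]]] _ [I2 [p2 [x2 [y2 [hp2 [hx2 [hy2 ->]]]]]]]].
- exists (X * Y)%type, (fun q => c q.1 * d q.2), (fun q => u q.1), (fun q => w q.2).
  split=> [q|]; first by rewrite mulr_ge0.
  split=> [q|]; first exact: onb_nrm.
  split=> [q|]; first exact: onb_nrm.
  apply: funext => i; apply: funext => j; rewrite /osum (sum_split (split_id _ _)) /tens /spec /osum mulr_suml.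
  apply: eq_bigr => t _; rewrite mulr_sumr; apply: eq_bigr => t' _.
  by rewrite /prodop /tens /= rCM; ring.
- exists void, (fun=> 0), (fun=> fun=> 0), (fun=> fun=> 0); split=> [[]|]; split=> [[]|]; split=> [[]|].
  by apply: funext => i; apply: funext => j; rewrite /osum big1 // => -[].
- exists (I1 + I2)%type, (fun i => match i with inl i => p1 i | inr i => p2 i end),
   (fun i => match i with inl i => x1 i | inr i => x2 i end),
   (fun i => match i with inl i => y1 i | inr i => y2 i end).
  split=> [[]//|]; split=> [[]//|]; split=> [[]//|].
  by apply: funext => i; apply: funext => j; rewrite /osum big_sumType.
Qed.

(** Number of real coordinates of an operator: the real and the imaginary part of each entry. *)
Definition dimT := #|{: (X * Y) * (X * Y) * bool}|.

Lemma sep_bounded_rank (s : op (X * Y)%type) : separable s ->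
  exists (x : 'I_dimT -> X -> C) (y : 'I_dimT -> Y -> C),
    (forall k, nrm (x k) <= 1) /\ (forall k, nrm (y k) <= 1) /\
    s = osum (fun=> 1) (fun k => prodop (x k) (y k)).
Proof.
move=> ss; have [I [p [x [y [hp [hx [hy E]]]]]]] := scone_rank1 (sep_scone ss).
pose V i (j : (X * Y) * (X * Y) * bool) : R :=
  if j.2 then complex.Re (prodop (x i) (y i) j.1.1 j.1.2)
  else complex.Im (prodop (x i) (y i) j.1.1 j.1.2).
have [q [hq [hcard hqV]]] := caratheodory V hp.
have Eq : s = osum q (fun i => prodop (x i) (y i)).
  rewrite E; apply: funext => i; apply: funext => j; apply: complexP.
    rewrite !Re_sum; under eq_bigr do rewrite Re_rCM.
    by under [RHS]eq_bigr do rewrite Re_rCM; rewrite -(hqV (i, j, true)).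
  have Im_rCM (a : R) (z : C) : complex.Im (rC a * z) = a * complex.Im z.
    by case: z => b c /=; rewrite mul0r addr0.
  rewrite !Im_sum; under eq_bigr do rewrite Im_rCM.
  by under [RHS]eq_bigr do rewrite Im_rCM; rewrite -(hqV (i, j, false)).
have q1 : \sum_i q i = 1.
  rewrite -(state_rtr (sep_state ss)) Eq rtr_osum; apply: eq_bigr => i _.
  by rewrite rtr_prodop hx hy !mulr1.
have qle i : q i <= 1 by rewrite -q1 (bigD1 i) //= lerDl sumr_ge0.
set S := [set i | q i != 0%R]%SET in hcard.
pose ev (k : 'I_dimT) : option I := if insub (k : nat) is Some l then Some (@enum_val _ (mem S) l) else None.
exists (fun k i => if ev k is Some l then rC (Num.sqrt (q l)) * x l i else 0).
exists (fun k i => if ev k is Some l then y l i else 0).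
have nrm0 (T : finType) : nrm ((fun=> 0) : T -> C) = 0.
  by rewrite /nrm big1 // => i _; apply/eqP; rewrite nsq_eq0.
have nrmZ (T : finType) (c : R) (z : T -> C) : nrm (fun i => rC c * z i) = c ^+ 2 * nrm z.
  by rewrite /nrm mulr_sumr; apply: eq_bigr => i _; rewrite nsqM nsq_rC.
split=> [k|]; first by case: (ev k) => [l|]; rewrite ?nrm0 // nrmZ sqr_sqrtr // hx mulr1.
split=> [k|]; first by case: (ev k) => [l|]; rewrite ?nrm0 // hy.
rewrite Eq; apply: funext => i; apply: funext => j; rewrite /osum.
have -> : \sum_l rC (q l) * prodop (x l) (y l) i j = \sum_(l in S) rC (q l) * prodop (x l) (y l) i j.
  rewrite [RHS]big_mkcond /=; apply: eq_bigr => l _; rewrite inE.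
  by case: eqP => // ->; rewrite rC0 mul0r.
rewrite big_enum_val /=.
pose F (k : nat) : C := if insub k is Some l then
  rC (q (@enum_val _ (mem S) l)) * prodop (x (@enum_val _ (mem S) l)) (y (enum_val l)) i j else 0.
transitivity (\sum_(k < #|S|) F k).
  by apply: eq_bigr => k _; rewrite /F valK.
rewrite (big_ord_widen _ F hcard) big_mkcond /=; apply: eq_bigr => k _.
rewrite rC1 mul1r /prodop /tens /ketbra /ev /F.
case: insubP => [l hl El|/negbTE ->]; last by rewrite !mul0r.
rewrite hl conjcM conjc_rC.
have -> : rC (q (enum_val l)) = rC (Num.sqrt (q (enum_val l))) * rC (Num.sqrt (q (enum_val l))) :> C.
  by rewrite -rCM -expr2 sqr_sqrtr.
by rewrite /prodop /tens /ketbra; ring.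
Qed.

(** Coordinates of the product vectors converge along [U], and the state is polynomial in them and
    their conjugates. The limit has trace one as a limit of ones. *)
Lemma sep_compact (U : set_system nat) (s : nat -> op (X * Y)%type) : UltraFilter U ->
  (forall n, separable (s n)) ->
  exists2 l, separable l & forall v, (fun n => qf (s n) v) @ U --> qf l v.
Proof.
move=> hU hs; have pU := @ultra_proper _ _ hU.
have /choice [x] n := sep_bounded_rank (hs n).
move=> /choice [y hxy].
have climit (z : nat -> C) : (forall n, nsq (z n) <= 1) -> exists l, ccvg U z l.
  move=> hz.
  have sq1 (a b : R) : a ^+ 2 + b ^+ 2 <= 1 -> `|a| <= 1.
    by move=> h; rewrite -(@ler_pXn2r _ 2) ?nnegrE // expr1n real_normK ?num_real //;
       have := sqr_ge0 b; lra.
  have [|a ha] := @ultra_bounded U (fun n => complex.Re (z n)) 1 hU.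
    by move=> n; apply: sq1 (hz n).
  have [|b hb] := @ultra_bounded U (fun n => complex.Im (z n)) 1 hU.
    by move=> n; apply: (sq1 _ (complex.Re (z n))); rewrite addrC; exact: hz.
  by exists (Complex a b).
have nle (T : finType) (z : T -> C) i : nrm z <= 1 -> nsq (z i) <= 1.
  move=> h; apply: le_trans h; rewrite /nrm (bigD1 i) //= lerDl.
  by apply: sumr_ge0 => j _; exact: nsq_ge0.
have /choice [xl hxl] (k : 'I_dimT) : exists l : X -> C, forall i, ccvg U (fun n => x n k i) (l i).
  have /choice [l hl] i : exists l, ccvg U (fun n => x n k i) l; last by exists l.
  by apply: climit => n; apply: nle; case: (hxy n).
have /choice [yl hyl] (k : 'I_dimT) : exists l : Y -> C, forall i, ccvg U (fun n => y n k i) (l i).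
  have /choice [l hl] i : exists l, ccvg U (fun n => y n k i) l; last by exists l.
  by apply: climit => n; apply: nle; case: (hxy n) => _ [].
pose l := osum (fun=> 1) (fun k => prodop (xl k) (yl k)).
have cl i j : ccvg U (fun n => s n i j) (l i j).
  have -> : (fun n => s n i j) = (fun n => \sum_k rC 1 * prodop (x n k) (y n k) i j).
    by apply: funext => n; case: (hxy n) => _ [_ {1}->].
  apply: ccvg_sum => k; apply: ccvgM; first exact: ccvg_cst.
  rewrite /prodop /tens /ketbra.
  by apply: ccvgM; apply: ccvgM => //; apply: ccvgJ.
have cq v : (fun n => qf (s n) v) @ U --> qf l v.
  rewrite /qf /ip /opapp.
  suff [] : ccvg U (fun n => \sum_i conjc (v i) * \sum_j s n i j * v j)
    (\sum_i conjc (v i) * \sum_j l i j * v j) by [].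
  apply: ccvg_sum => i; apply: ccvgM; first exact: ccvg_cst.
  by apply: ccvg_sum => j; apply: ccvgM => //; exact: ccvg_cst.
exists l => //; apply: scone_sep.
  apply: scone_osum => // k; apply: scone_tens; exact: psd_ketbra.
have std := @onb_std R (X * Y)%type.
rewrite (rtr_onb _ std).
have h1 : (fun n => \sum_t qf (s n) (fun i => if t == i then 1 else 0)) @ U -->
     \sum_t qf l (fun i => if t == i then 1 else 0).
  by apply: cvg_sumR => t; exact: cq.
have h2 : (fun n => \sum_t qf (s n) (fun i => if t == i then 1 else 0)) = fun=> 1.
  by apply: funext => n; rewrite -(rtr_onb _ std) state_rtr //; exact: sep_state.
rewrite h2 in h1.
exact: (cvg_unique (@norm_hausdorff _ R) h1 (cvg_cst _)).
Qed.

End Compactness.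

(** * Achievability *)

Section RelativeEntropy.
Variable R : realType.
Local Notation C := R[i].
Local Notation op := (@op R).

Lemma some_spectral_decP (T : finType) (X : op T) : hermitian X ->
  onb (some_spectral_dec X).2 /\ X = spec (some_spectral_dec X).1 (some_spectral_dec X).2.
Proof.
move=> /hermitian_spectral [a [u [hu E]]].
apply: (Stdlib.Logic.ClassicalEpsilon.epsilon_spec (inhabits ((fun=> 0), (fun _ _ => 0))) (spectral_dec X)).
by exists (a, u).
Qed.

(** [ln] is [0] on nonpositive reals, so the convention on the kernel is built into it. *)
Lemma oplogE (T : finType) (X : op T) :
  oplog X = spec (fun t => ln ((some_spectral_dec X).1 t)) (some_spectral_dec X).2.
Proof.
rewrite /oplog /fcalc /spec /osum; apply: funext => i; apply: funext => j.
by apply: eq_bigr => t _; case: ltP => // h; rewrite ln0.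
Qed.

Lemma psd_qf0 (T : finType) (s : op T) v : psd s -> qf s v = 0 -> opapp s v = fun=> 0.
Proof.
move=> /psd_spectral [a [u [hu [ha ->]]]]; rewrite qf_spec => /eqP.
rewrite psumr_eq0 => [/allP h|t _]; last by rewrite mulr_ge0 ?nsq_ge0.
rewrite spec_app; apply: funext => i; rewrite big1 // => t _.
have := h t (mem_index_enum t); rewrite /= mulf_eq0 nsq_eq0 => /orP[]/eqP->.
  by rewrite rC0 !mul0r.
by rewrite mulr0 mul0r.
Qed.

Lemma ip0r (T : finType) (v : T -> C) : ip v (fun=> 0) = 0.
Proof. by rewrite /ip big1 // => i _; rewrite mulr0. Qed.

(** In an eigenbasis of the second operator, inclusion of supports means that [s] has no weight on
    the kernel vectors, since [qf s v = 0] forces [s v = 0] for positive [s]. *)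
Lemma supp_inclP (T : finType) (s : op T) r v : psd s -> onb v ->
  supp_incl s (spec r v) <-> forall t, r t = 0 -> qf s (v t) = 0.
Proof.
move=> ps hv; have hs := psd_herm ps; split=> [h t rt|h y [x <-]].
  have [w hw] := h (opapp s (v t)) (ex_intro _ (v t) erefl).
  rewrite /qf -hw ip_herm; last exact: herm_spec.
  rewrite spec_eigen // rt /ip big1 // => i _.
  by rewrite mul0r conjc0 mul0r.
have ip0 t : r t = 0 -> ip (v t) (opapp s x) = 0.
  move=> rt; rewrite ip_herm // (psd_qf0 ps (h t rt)).
  by rewrite -ipC ip0r conjc0.
(* The preimage under the pseudo-inverse; with [0 ^-1 = 0] the kernel directions drop out. *)
exists (fun i => \sum_t (rC (r t)^-1 * ip (v t) (opapp s x)) * v t i).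
rewrite spec_app; apply: funext => i.
rewrite [RHS](congr1 (fun f => f i) (onb_expand (opapp s x) hv)).
apply: eq_bigr => t _; rewrite ip_sumr (bigD1 t) //= hv eqxx mulr1.
rewrite big1 ?addr0 => [|t' /negbTE h']; last by rewrite hv eq_sym h' mulr0.
have [r0|r0] := eqVneq (r t) 0; first by rewrite r0 rC0 (ip0 t r0) !mul0r.
by rewrite mulrA -rCM mulfV // rC1 mul1r.
Qed.

Lemma relentE (T : finType) (s rho : op T) : psd s -> psd rho ->
  let a := (some_spectral_dec s).1 in let r := (some_spectral_dec rho).1 in
  let v := (some_spectral_dec rho).2 in
  supp_incl s rho ->
  relent s rho = (\sum_t a t * ln (a t) - \sum_t ln (r t) * qf s (v t))%:E.
Proof.
move=> ps pr a r v hsupp; rewrite /relent; case: asboolP => // _; congr (_%:E).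
have [hu Es] := some_spectral_decP (psd_herm ps).
have [hv Er] := some_spectral_decP (psd_herm pr).
have -> : rtr (opmul s (opadd (oplog s) (opopp (oplog rho)))) =
   rtr (opmul s (oplog s)) - rtr (opmul s (oplog rho)).
  rewrite /rtr -ReN -ReD; congr complex.Re; rewrite /optr -sumrB; apply: eq_bigr => i _.
  rewrite /opmul -sumrB; apply: eq_bigr => j _.
  by rewrite /opadd /opopp mulrBr.
rewrite !oplogE !rtr_mul_spec // -/r -/v; congr (_ - _).
apply: eq_bigr => t _; have := qf_spec_basis a t hu.
by rewrite /a -Es => ->; rewrite mulrC.
Qed.

Lemma le_of_small (x y K e1 : R) : 0 < e1 -> (forall e, 0 < e -> e <= e1 -> x <= y + e * K) -> x <= y.
Proof.
move=> e10 h; apply/ler_addgt0Pr => d d0.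
pose e := Num.min e1 (d / (1 + `|K|)).
have K0 : 0 < 1 + `|K| by have := normr_ge0 K; lra.
have e0 : 0 < e by rewrite lt_min e10 divr_gt0.
apply: (le_trans (h e e0 _)); first by rewrite /e ge_min lexx.
rewrite lerD2l; apply: (@le_trans _ _ (e * (1 + `|K|))).
  by apply: ler_wpM2l; [exact: ltW|have := ler_norm K; lra].
by rewrite -ler_pdivlMr // /e ge_min lexx orbT.
Qed.

Lemma sum_qf_lin (T : finType) (h : T -> R) (u : T -> T -> C) (s s' : op T) x y :
  \sum_t h t * qf (opadd (opscale (rC x) s) (opscale (rC y) s')) (u t) =
  x * (\sum_t h t * qf s (u t)) + y * (\sum_t h t * qf s' (u t)).
Proof.
rewrite !mulr_sumr -big_split; apply: eq_bigr => t _ /=; rewrite qfD !qfZ; ring.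
Qed.

Variables A B : finType.
Variable rho : op (A * B)%type.
Hypothesis hrho : state rho.
Let r := (some_spectral_dec rho).1.
Let v := (some_spectral_dec rho).2.

Lemma rho_dec : onb v /\ rho = spec r v.
Proof. by apply: some_spectral_decP; apply: psd_herm; case: hrho. Qed.

Lemma rho_ge0 t : 0 <= r t.
Proof.
have [hv E] := rho_dec; apply: (psd_spec_ge0 _ hv); rewrite -E; by case: hrho.
Qed.

Lemma rho_le1 t : r t <= 1.
Proof.
have [hv E] := rho_dec.
have <- : \sum_s r s = 1.
  rewrite -(state_rtr hrho) (rtr_onb _ hv) E; apply: eq_bigr => s _.
  by rewrite qf_spec_basis.
by rewrite (bigD1 t) //= lerDl sumr_ge0 // => s _; exact: rho_ge0.
Qed.

(** If every shift failed, the counterexamples for [eta = 1 / (n + 1)] would have a separable limit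
    point [l] with relative entropy at most [c] to [rho], against the hypothesis. The infinite case
    is covered because the support inclusion for [l] is derived, not assumed. *)
Lemma regularized_bound (c : R) : (c%:E < rev_rel_ent rho)%E ->
  exists eta : R, 0 < eta /\ forall s a u, separable s -> onb u -> s = spec a u ->
    c <= \sum_t a t * ln (a t) - \sum_t ln (r t + eta) * qf s (v t).
Proof.
move=> hc; apply: contrapT => hn.
have [hv Er] := rho_dec.
have /choice [s /choice [a /choice [u h]]] (n : nat) : exists s a u, separable s /\ onb u /\ s = spec a u /\
  \sum_t a t * ln (a t) - \sum_t ln (r t + n.+1%:R^-1) * qf s (v t) < c.
  apply: contrapT => hn2; apply: hn; exists n.+1%:R^-1; split; first by rewrite invr_gt0.
  move=> s a u ss hu E; rewrite leNgt; apply/negP => hlt; apply: hn2.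
  by exists s, a, u.
have [U [hU sU]] := ultraFilterLemma (T := nat) (F := \oo) _.
have pU := @ultra_proper _ _ hU.
have [l sl hl] := sep_compact hU (fun n => proj1 (h n)).
have pl : psd l by case: (sep_state sl).
pose al := (some_spectral_dec l).1; pose ul := (some_spectral_dec l).2.
have [hul El] := some_spectral_decP (psd_herm pl).
rewrite -/al -/ul in hul El.
have al0 t : 0 <= al t by apply: (psd_spec_ge0 _ hul); rewrite -El.
have ql t : qf l (ul t) = al t by have := qf_spec_basis al t hul; rewrite -El.
set E := \sum_t al t * ln (al t).
(* Klein's inequality against the fixed operator [l + kap] replaces the entropy of [s n] by a linear
   functional, which passes to the limit. For [n] large the shift [1 / (n + 1)] may be enlarged to
   the fixed [eta]. *)
have key1 kap eta : 0 < kap -> 0 < eta ->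
    E - \sum_t ln (r t + eta) * qf l (v t) <= c + kap * #|{: A * B}|%:R.
  move=> k0 e0.
  have lim : (fun n => \sum_t ln (al t + kap) * qf (s n) (ul t) -
      \sum_t ln (r t + eta) * qf (s n) (v t)) @ U -->
      \sum_t ln (al t + kap) * qf l (ul t) - \sum_t ln (r t + eta) * qf l (v t).
    by apply: cvgB; apply: cvg_sumR => t; apply: cvgM; [exact: cvg_cst|exact: hl|exact: cvg_cst|exact: hl].
  apply: (@le_trans _ _ (\sum_t ln (al t + kap) * qf l (ul t) - \sum_t ln (r t + eta) * qf l (v t))).
    rewrite lerD2r; apply: ler_sum => t _; rewrite ql mulrC.
    have := al0 t; rewrite le_eqVlt => /predU1P[<-|p0]; first by rewrite !mulr0.
    by apply: ler_wpM2r; [exact: ltW|rewrite ler_ln ?posrE; lra].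
  apply: (cvgr_to_le lim); apply: sU.
  have [N hN] := @exists_nat_mul_ge _ eta 1 e0.
  exists N => // n /= /leqW hNn.
  have [ss [hu [Es hlt]]] := h n.
  have en : n.+1%:R^-1 <= eta :> R.
    by rewrite -[leLHS]mul1r ler_pdivrMr ?ltr0Sn // mulrC; exact: hN.
  have as0 t : 0 <= a n t.
    by apply: (psd_spec_ge0 _ hu); rewrite -Es; case: (sep_state ss).
  have as1 : \sum_t a n t = 1.
    rewrite -(state_rtr (sep_state ss)) (rtr_onb _ hu) Es.
    by apply: eq_bigr => t _; rewrite qf_spec_basis.
  have alk t : 0 < al t + kap by have := al0 t; lra.
  have al1 : \sum_t al t = 1.
    rewrite -(state_rtr (sep_state sl)) (rtr_onb _ hul).
    by apply: eq_bigr => t _; rewrite ql.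
  have := klein hu hul as0 alk.
  rewrite -Es as1 big_split /= al1 sumr_const -[kap *+ _]mulr_natr => kl.
  have ml : \sum_t ln (r t + n.+1%:R^-1) * qf (s n) (v t) <= \sum_t ln (r t + eta) * qf (s n) (v t).
    apply: ler_sum => t _; apply: ler_wpM2r; first by apply: psd_qf; case: (sep_state ss).
    have r0 := rho_ge0 t; have : 0 < n.+1%:R^-1 :> R by rewrite invr_gt0.
    by move: en; move: (n.+1%:R^-1) => z zeta z0; rewrite ler_ln ?posrE; lra.
  move: kl ml hlt; rewrite -[#|{: A * B}|]/(#|_|); lra.
have key2 eta : 0 < eta -> E - \sum_t ln (r t + eta) * qf l (v t) <= c.
  move=> e0; apply: (@le_of_small _ _ #|{: A * B}|%:R 1 ltr01) => e h0 _.
  exact: key1.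
have ql0 t : 0 <= qf l (v t) by exact: psd_qf.
have supp : supp_incl l rho.
  rewrite Er; apply/supp_inclP => // t0 rt0.
  apply/eqP; rewrite eq_le ql0 andbT leNgt; apply/negP => q0.
  (* With the shift [exp (- M)] a kernel vector of [rho] contributes [M * qf l (v t0)], which beats
     all other terms; these are at most [ln 2] because [r t + exp (- M) <= 2]. *)
  pose M := (`|c| + `|E| + ln 2 + 1) / qf l (v t0).
  have l2 : 0 <= ln (2 : R) by rewrite ln_ge0 //; lra.
  have M0 : 0 < M.
    by rewrite divr_gt0 //; have := normr_ge0 c; have := normr_ge0 E; lra.
  have := key2 (expR (- M)) (expR_gt0 _).
  have em1 : expR (- M) <= 1 by rewrite -expR0 ler_expR; lra.
  rewrite (bigD1 t0) //= rt0 add0r expRK.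
  have hb : \sum_(t | t != t0) ln (r t + expR (- M)) * qf l (v t) <= ln 2.
    apply: (@le_trans _ _ (\sum_(t | t != t0) ln 2 * qf l (v t))).
      apply: ler_sum => t _; rewrite ler_wpM2r //.
      have r0 := rho_ge0 t; have r1 := rho_le1 t; have := expR_gt0 (- M).
      by move=> eM; rewrite ler_ln ?posrE; lra.
    rewrite -mulr_sumr ler_piMr //.
    have <- : \sum_t qf l (v t) = 1 by rewrite -rtr_onb // state_rtr //; exact: sep_state.
    by rewrite [leRHS](bigD1 t0) //= lerDr.
  have : M * qf l (v t0) = `|c| + `|E| + ln 2 + 1 by rewrite /M divfK // gt_eqF.
  have := ler_norm c; have := ler_norm (- E); rewrite normrN; lra.
(* By concavity [ln (r + e) <= ln r + e / r] where [r > 0]; where [r = 0] the weight vanishes by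
   [supp]. So the shift can be sent to zero. *)
have fin : E - \sum_t ln (r t) * qf l (v t) <= c.
  apply: (@le_of_small _ _ (\sum_t qf l (v t) / r t) 1 ltr01) => e e0 _.
  suff : \sum_t ln (r t + e) * qf l (v t) <=
      \sum_t ln (r t) * qf l (v t) + e * \sum_t qf l (v t) / r t by have := key2 e e0; lra.
  rewrite mulr_sumr -big_split; apply: ler_sum => t _ /=.
  have := rho_ge0 t; rewrite le_eqVlt => /predU1P[r0|r0].
    have -> : qf l (v t) = 0.
      by move: supp; rewrite Er supp_inclP // => /(_ t); apply.
    by rewrite mul0r !mulr0 addr0.
  have : ln (r t + e) <= ln (r t) + e / r t.
    have -> : r t + e = r t * (1 + e / r t) by field; exact: lt0r_neq0.
    rewrite lnM ?posrE //; last by rewrite addr_gt0 // divr_gt0.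
    by rewrite lerD2l le_ln1Dx // (lt_trans _ (divr_gt0 e0 r0)) // ltrN10.
  move=> /(ler_wpM2r (ql0 t)); lra.
have : (rev_rel_ent rho <= c%:E)%E.
  apply: (@le_trans _ _ (relent l rho)); last by rewrite relentE // ?lee_fin //; case: hrho.
  by apply: ereal_inf_lbound; exists l.
by rewrite leNgt hc.
Qed.

Lemma sep_exists : exists s : op (A * B)%type, separable s.
Proof.
have : rtr rho != 0 by rewrite (state_rtr hrho) oner_eq0.
have [a|hA] := pickP (fun _ : A => true); last first.
  rewrite /rtr /optr big1 ?eqxx // => -[a b] _; by have := hA a.
have [b|hB] := pickP (fun _ : B => true); last first.
  rewrite /rtr /optr big1 ?eqxx // => -[? b] _; by have := hB b.
move=> _ _ _.
have st (T : finType) (t : T) : state (ketbra (fun i => if t == i then 1 else 0) (fun i => if t == i then 1 else 0) : op T).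
  apply: stateP; first exact: psd_ketbra.
  rewrite (rtr_onb _ (@onb_std R T)) (bigD1 t) //= qf_ketbra [ip _ _](onb_std R t t) eqxx.
  rewrite big1 => [|i /negbTE hi]; last by rewrite qf_ketbra [ip _ _](onb_std R t i) eq_sym hi /nsq /= expr0n addr0.
  by rewrite /nsq /= expr1n expr0n !addr0.
by exists (tens (ketbra (fun i => if a == i then 1 else 0) (fun i => if a == i then 1 else 0))
   (ketbra (fun i => if b == i then 1 else 0) (fun i => if b == i then 1 else 0))); apply: sep_tens.
Qed.

(** First-order optimality: mixing a near-minimiser [s1] with an arbitrary separable [s] at weight
    [t] cannot lower the value much. Since [s <= 1], the mixture is dominated by an operator that
    does not depend on [s], and the logarithm of that operator serves all [s] at once. *)
Lemma dual_observable (c eta del : R) : 0 < eta -> 0 < del ->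
  (forall s a u, separable s -> onb u -> s = spec a u ->
    c <= \sum_t a t * ln (a t) - \sum_t ln (r t + eta) * qf s (v t)) ->
  exists b w, onb w /\ (forall t, 0 < b t) /\ \sum_t b t = 1 /\
   forall s, separable s ->
     c - del <= \sum_t ln (b t) * qf s (w t) - \sum_t ln (r t + eta) * qf s (v t).
Proof.
move=> eta0 del0 hc.
pose L s := \sum_t ln (r t + eta) * qf s (v t).
pose E := [set x | exists s a u, separable s /\ onb u /\ s = spec a u /\
   x = \sum_t a t * ln (a t) - L s].
have hE : has_inf E.
  split; last by exists c => x [s [a [u [ss [hu [Es ->]]]]]]; exact: (hc s a u).
  have [s ss] := sep_exists.
  have [a [u [hu Es]]] := hermitian_spectral (psd_herm (proj1 (sep_state ss))).
  by exists (\sum_t a t * ln (a t) - L s), s, a, u.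
set m := inf E.
have hm s a u : separable s -> onb u -> s = spec a u -> m <= \sum_t a t * ln (a t) - L s.
  by move=> ss hu Es; apply: ge_inf; [case: hE|exists s, a, u].
have cm : c <= m.
  apply: lb_le_inf; first by case: hE.
  by move=> x [s [a [u [ss [hu [Es ->]]]]]]; exact: (hc s a u).
set D : R := #|{: A * B}|%:R.
have D1 : 1 <= D.
  rewrite /D ler1n lt0n; apply/negP => /eqP/card0_eq D0.
  have := state_rtr hrho; rewrite /rtr /optr big_pred0 // => /eqP.
  by rewrite eq_sym oner_eq0.
(* The bound [t D <= del / 8] keeps the normalisation of [y] cheap. [kap] is then chosen so that
   [kap D = t del / 8], the same as the slack of the near-minimiser: both must be of order [t del],
   since the final inequality is divided by [t]. *)
pose t := Num.min (2^-1) (del / (8 * D)).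
have t0 : 0 < t by rewrite lt_min invr_gt0 ltr0n /= divr_gt0 // mulr_gt0 //; lra.
have [t1 t2] : t <= 2^-1 /\ t <= del / (8 * D) by rewrite /t !ge_min !lexx !orbT.
have tD : t * D <= del / 8.
  have -> : del / 8 = del / (8 * D) * D by field; lra.
  by rewrite ler_pM2r //; lra.
pose kap := t * del / (8 * D).
have kap0 : 0 < kap by rewrite divr_gt0 ?mulr_gt0 //; lra.
have kD : kap * D = t * (del / 8) by rewrite /kap; field; lra.
have tau0 : 0 < t * (del / 8) by rewrite mulr_gt0 // divr_gt0 //; lra.
have [x [s1 [a1 [u1 [ss1 [hu1 [Es1 ->]]]]]] hx] := inf_adherent tau0 hE.
rewrite -/m in hx.
have st1 := sep_state ss1.
have a10 i : 0 <= a1 i by apply: (psd_spec_ge0 _ hu1); rewrite -Es1; case: st1.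
have a11 : \sum_i a1 i = 1.
  rewrite -(state_rtr st1) (rtr_onb _ hu1) [in RHS]Es1.
  by apply: eq_bigr => i _; rewrite qf_spec_basis.
pose y i := (1 - t) * a1 i + (t + kap).
have y0 i : 0 < y i by rewrite /y; have := a10 i; nra.
set N0 := \sum_i y i.
have EN0 : N0 = 1 - t + (t + kap) * D.
  by rewrite /N0 /y big_split /= -mulr_sumr a11 mulr1 sumr_const -[(t + kap) *+ _]mulr_natr.
have N0p : 0 < N0 by rewrite EN0; nra.
exists (fun i => y i / N0), u1; split=> //; split; first by move=> i; rewrite divr_gt0.
split; first by rewrite -mulr_suml divff ?gt_eqF.
move=> s ss; have st := sep_state ss; have ps : psd s by case: st.
have -> : \sum_i ln (y i / N0) * qf s (u1 i) = \sum_i ln (y i) * qf s (u1 i) - ln N0.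
  transitivity (\sum_i ln (y i) * qf s (u1 i) - \sum_i ln N0 * qf s (u1 i)).
    by rewrite -sumrB; apply: eq_bigr => i _; rewrite ln_div ?posrE // mulrBl.
  by rewrite -mulr_sumr -rtr_onb // (state_rtr st) mulr1.
have lnN : ln N0 <= (t + kap) * D.
  have -> : N0 = 1 + (N0 - 1) by ring.
  apply: (le_trans (le_ln1Dx _)); [lra|rewrite EN0; lra].
have t01 : 0 <= t <= 1 by apply/andP; split; lra.
have sst := sep_convex t01 ss1 ss.
set s2 := opadd _ _ in sst.
have pst := proj1 (sep_state sst).
have [a2 [u2 [hu2 Es2]]] := hermitian_spectral (psd_herm pst).
have a20 i : 0 <= a2 i by apply: (psd_spec_ge0 _ hu2); rewrite -Es2.
have a2k i : 0 < a2 i + kap by have := a20 i; lra.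
have f1 := hm s2 a2 u2 sst hu2 Es2.
have f2 : \sum_i a2 i * ln (a2 i) <= \sum_i ln (a2 i + kap) * qf s2 (u2 i).
  apply: ler_sum => i _; rewrite Es2 qf_spec_basis // mulrC.
  have := a20 i; rewrite le_eqVlt => /predU1P[<-|p0]; first by rewrite !mulr0.
  by apply: ler_wpM2r; [exact: ltW|rewrite ler_ln ?posrE; lra].
have f3 : \sum_i ln (a2 i + kap) * qf s1 (u2 i) <= \sum_i a1 i * ln (a1 i) + kap * D.
  have := klein hu1 hu2 a10 a2k; rewrite -Es1 a11 big_split /= sumr_const -[kap *+ _]mulr_natr -/D.
  have -> : \sum_i a2 i = 1; last by lra.
  rewrite -(state_rtr (sep_state sst)) (rtr_onb _ hu2) [in RHS]Es2.
  by apply: eq_bigr => i _; rewrite qf_spec_basis.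
(* [s2 + kap <= (1 - t) s1 + (t + kap)] because [s <= 1], and the logarithm is operator monotone. *)
have f4 : \sum_i ln (a2 i + kap) * qf s (u2 i) <= \sum_i ln (y i) * qf s (u1 i).
  apply: ln_trace_mono => // z.
  have e1 : qf (spec (fun i => a2 i + kap) u2) z = (1 - t) * qf s1 z + t * qf s z + kap * nrm z.
    rewrite -specD qfD -Es2 qfD !qfZ; congr (_ + _).
    by rewrite qf_spec -mulr_sumr -parseval.
  have e2 : qf (spec y u1) z = (1 - t) * qf s1 z + (t + kap) * nrm z.
    rewrite /y -specD qfD Es1; congr (_ + _).
      by rewrite !qf_spec mulr_sumr; apply: eq_bigr => i _; rewrite mulrA.
    by rewrite qf_spec -mulr_sumr -parseval.
  have : qf s z <= nrm z by have := qf_le_rtr z ps; rewrite (state_rtr st) mul1r.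
  rewrite e1 e2 => h; have := ler_wpM2l (ltW t0) h; lra.
have f5 : L s2 = (1 - t) * L s1 + t * L s by exact: sum_qf_lin.
rewrite sum_qf_lin in f2.
rewrite -/(L s) in f1 f5 *.
set Q := \sum_i ln (y i) * _ in f4 *.
have t1' : 0 <= 1 - t by lra.
have g3 := ler_wpM2l t1' f3.
have g4 := ler_wpM2l (ltW t0) f4.
have gx : (1 - t) * (\sum_i a1 i * ln (a1 i) - L s1) <= (1 - t) * (m + t * (del / 8)).
  by apply: ler_wpM2l => //; exact: ltW.
(* The infimum [m] is at most the value at the mixture [s2], which [f2] to [f5] bound by [(1 - t)]
   times the value at [s1], plus [t (Q - L s)] and the small terms. *)
have main : t * (m - del / 4) <= t * (Q - L s).
  rewrite f5 in f1; rewrite kD in g3.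
  have w1 : t * (t * (del / 8)) >= 0 by rewrite mulr_ge0 // ltW.
  lra.
rewrite ler_pM2l // in main.
have kD2 : kap * D <= del / 8 by rewrite kD ler_piMl //; lra.
lra.
Qed.

Lemma achievability (c eps : R) : (c%:E < rev_rel_ent rho)%E -> 0 < eps ->
  exists N, forall n, (N <= n)%N -> exists M, test_op M /\
    rtr (opmul M (tpw rho n)) <= expR (- (n%:R * c)) /\
    forall s, separable s -> rtr (opmul (opadd (@opid R _) (opopp M)) s) <= eps.
Proof.
move=> hc eps0.
(* Room for the two losses that follow: half of [c' - c] is spent on the dual operator and half on
   the rate. *)
have [c' [cc' hc']] : exists c', c < c' /\ (c'%:E < rev_rel_ent rho)%E.
  case: (rev_rel_ent rho) hc => [d| |//]; rewrite ?lte_fin.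
    by move=> h; exists ((c + d) / 2); rewrite lte_fin; lra.
  by move=> _; exists (c + 1); rewrite ltry; split=> //; lra.
have [eta [eta0 he]] := regularized_bound hc'.
have d0 : 0 < (c' - c) / 2 by lra.
have [b [w [hw [hb [hb1 hs]]]]] := dual_observable eta0 d0 he.
have [hv Er] := rho_dec.
have := @dual_achievability R A B r v b w eta (c' - (c' - c) / 2) c eps.
rewrite /= -Er => /(_ hrho hv hw eta0 hb hb1 hs); apply=> //.
by clear hc hc'; lra.
Qed.

End RelativeEntropy.

(** * Strong converse for a fixed separable state *)

Section Converse.
Variable R : realType.
Local Notation C := R[i].
Local Notation op := (@op R).

(** The eigenvalues of a test lie in [[0, 1]], so [M ^ 2 <= M]. *)
Lemma test_app_le (T : finType) (M : op T) x : test_op M -> nrm (opapp M x) <= qf M x.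
Proof.
move=> [/psd_spectral [m [w [hw [hm E]]]] h1]; rewrite nrm_herm_app E; last exact: herm_spec.
rewrite specM // !qf_spec; apply: ler_sum => t _; rewrite ler_wpM2r ?nsq_ge0 //.
have : 0 <= qf (opadd (@opid R T) (opopp M)) (w t) by exact: psd_qf.
rewrite qfD qfN qf_id onb_nrm // E qf_spec_basis // => h.
by rewrite ler_piMr //; lra.
Qed.

Lemma test_opC (T : finType) (M : op T) : test_op M ->
  test_op (opadd (@opid R T) (opopp M)).
Proof.
move=> [h1 h2]; split=> //.
have -> : opadd (@opid R T) (opopp (opadd (@opid R T) (opopp M))) = M; last by [].
by apply: funext => i; apply: funext => j; rewrite /opadd /opopp; ring.
Qed.

(* Nussbaum-Szkola: the error probabilities of a quantum test are bounded below by those of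
   the two classical distributions a_i |<u_i|v_j>|^2 and r_j |<u_i|v_j>|^2. *)
Lemma nussbaum_szkola (T : finType) (a r : T -> R) u v (M : op T) gam :
  onb u -> onb v -> (forall t, 0 <= a t) -> (forall t, 0 <= r t) -> 0 <= gam -> test_op M ->
  \sum_i \sum_j Num.min (a i) (gam * r j) * nsq (ip (u i) (v j)) <=
  2 * (rtr (opmul (opadd (@opid R T) (opopp M)) (spec a u)) + gam * rtr (opmul M (spec r v))).
Proof.
move=> hu hv ha hr g0 hM; set N := opadd _ _.
have hN : test_op N by exact: test_opC.
rewrite !rtr_mul_spec //.
apply: (@le_trans _ _ (2 * (\sum_i \sum_j a i * nsq (ip (v j) (opapp N (u i))) +
    gam * \sum_j \sum_i r j * nsq (ip (u i) (opapp M (v j)))))); last first.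
  rewrite ler_pM2l //; apply: lerD.
    apply: ler_sum => i _; rewrite -mulr_sumr -parseval // ler_wpM2l //.
    exact: test_app_le.
  rewrite ler_wpM2l //; apply: ler_sum => j _; rewrite -mulr_sumr -parseval // ler_wpM2l //.
  exact: test_app_le.
rewrite [X in gam * X]exchange_big /= [gam * _]mulr_sumr -big_split mulr_sumr /=.
apply: ler_sum => i _; rewrite [gam * _]mulr_sumr -big_split mulr_sumr /=.
apply: ler_sum => j _.
have -> : nsq (ip (u i) (opapp M (v j))) = nsq (ip (v j) (opapp M (u i))).
  by rewrite nsq_ipC -ip_herm //; case: hM => /psd_herm.
(* The overlap splits through [N + M = 1]. The minimum is at most [a i] for the part with [N] and at
   most [gam * r j] for the part with [M]; [nsqD_le] gives the factor [2]. *)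
have E : ip (v j) (u i) = ip (v j) (opapp N (u i)) + ip (v j) (opapp M (u i)).
  rewrite -ipDr; congr ip; apply: funext => k.
  by rewrite /N opappB opapp_id subrK.
rewrite nsq_ipC E.
have := nsqD_le (ip (v j) (opapp N (u i))) (ip (v j) (opapp M (u i))).
have := nsq_ge0 (ip (v j) (opapp N (u i))); have := nsq_ge0 (ip (v j) (opapp M (u i))).
have := nsq_ge0 (ip (v j) (opapp N (u i)) + ip (v j) (opapp M (u i))).
move: (nsq (_ + _)) (nsq (ip _ (opapp N _))) (nsq (ip _ (opapp M _))) => x y z x0 y0 z0 xyz.
have m1 : Num.min (a i) (gam * r j) <= a i by rewrite ge_min lexx.
have m2 : Num.min (a i) (gam * r j) <= gam * r j by rewrite ge_min lexx orbT.
have m0 : 0 <= Num.min (a i) (gam * r j) by rewrite le_min ha mulr_ge0.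
move: (Num.min _ _) m0 m1 m2 => m m0 m1 m2; rewrite mulrA.
have := ler_wpM2l m0 xyz; have := ler_wpM2r z0 m1; have := ler_wpM2r y0 m2; lra.
Qed.

(* Markov's inequality for the positive part of the log-likelihood ratio z, whose
   negative part has expectation at most 1. *)
Lemma test_lower_bound (T : finType) (a r : T -> R) u v (M : op T) (z : T -> T -> R) tau :
  onb u -> onb v -> (forall t, 0 <= a t) -> (forall t, 0 <= r t) -> 0 < tau -> test_op M ->
  \sum_t a t = 1 -> \sum_t r t = 1 ->
  (forall i j, 0 < a i -> 0 < nsq (ip (u i) (v j)) -> 0 < r j /\ z i j = ln (a i) - ln (r j)) ->
  tau * (1 - 2 * (rtr (opmul (opadd (@opid R T) (opopp M)) (spec a u)) +
     expR tau * rtr (opmul M (spec r v)))) <=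
  \sum_i \sum_j a i * nsq (ip (u i) (v j)) * z i j + 1.
Proof.
move=> hu hv ha hr tau0 hM a1 r1 hz.
have NS := nussbaum_szkola hu hv ha hr (expR_ge0 tau) hM.
have w1 i : \sum_j nsq (ip (u i) (v j)) = 1.
  under eq_bigr do rewrite nsq_ipC.
  by rewrite -parseval // onb_nrm.
have w2 j : \sum_i nsq (ip (u i) (v j)) = 1 by rewrite -parseval // onb_nrm.
apply: (@le_trans _ _ (tau * (1 - \sum_i \sum_j Num.min (a i) (expR tau * r j) * nsq (ip (u i) (v j))))).
  by rewrite ler_pM2l //; lra.
have -> : tau * (1 - \sum_i \sum_j Num.min (a i) (expR tau * r j) * nsq (ip (u i) (v j))) =
  \sum_i \sum_j (tau * (a i - Num.min (a i) (expR tau * r j)) * nsq (ip (u i) (v j))).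
  transitivity (tau * (\sum_i \sum_j (a i * nsq (ip (u i) (v j))) -
     \sum_i \sum_j Num.min (a i) (expR tau * r j) * nsq (ip (u i) (v j)))).
    congr (_ * (_ - _)); rewrite -a1; apply: eq_bigr => i _.
    by rewrite -mulr_sumr w1 mulr1.
  rewrite -sumrB mulr_sumr; apply: eq_bigr => i _; rewrite -sumrB mulr_sumr.
  by apply: eq_bigr => j _; ring.
(* With the constant [1] spread as [r j] times the overlaps, the claim holds term by term. *)
have -> : 1 = \sum_i \sum_j r j * nsq (ip (u i) (v j)).
  by rewrite exchange_big /= -r1; apply: eq_bigr => j _; rewrite -mulr_sumr w2 mulr1.
rewrite -big_split; apply: ler_sum => i _; rewrite -big_split; apply: ler_sum => j _ /=.
have := nsq_ge0 (ip (u i) (v j)); rewrite le_eqVlt => /predU1P[<-|w0].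
  by rewrite !mulr0 mul0r addr0.
have := ha i; rewrite le_eqVlt => /predU1P[<-|p0].
  rewrite min_l ?mulr_ge0 ?expR_ge0 // subrr mulr0 !mul0r add0r.
  by rewrite mulr_ge0 // ltW.
have [r0 ->] := hz i j p0 w0.
have kl := mul_ln_le (ltW p0) r0.
suff : tau * (a i - Num.min (a i) (expR tau * r j)) <= a i * (ln (a i) - ln (r j)) + r j.
  by move=> /(ler_wpM2r (ltW w0)); lra.
case: (lerP (a i) (expR tau * r j)) => h; first by rewrite subrr mulr0; lra.
have : tau <= ln (a i) - ln (r j).
  rewrite lerBrDr -(expRK tau) -lnM ?posrE ?expR_gt0 // ler_ln ?posrE ?mulr_gt0 ?expR_gt0 //.
  exact: ltW.
have e0 : 0 <= expR tau * r j by rewrite mulr_ge0 ?expR_ge0 // ltW.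
move=> /(ler_wpM2l (ltW p0)) h2.
have : tau * (a i - expR tau * r j) <= tau * a i by rewrite ler_pM2l //; lra.
lra.
Qed.

Variables A B : finType.

Lemma qf_tpow (s : op (A * B)%type) v n t : hermitian s ->
  qf (tpw s n) (@upow R A B v n t) = @apow R A B (fun t => qf s (v t)) n t.
Proof.
move=> hs; have hsn m : hermitian (tpw s m).
  elim: m => [|m IH]; first by rewrite tpow0; exact: herm_id.
  rewrite tpowS; apply: funext => i; apply: funext => j.
  by rewrite /opadj /etens conjcM !hermitianP.
elim: n t => [|n IH] t.
  by rewrite tpow0 qf_id; exact: (onb_nrm t (@onb_std R _)).
by rewrite tpowS /= -IH qf_etens //=; exact: hsn.
Qed.

Lemma hpow_tpow (s : op (A * B)%type) h v n : state s -> onb v ->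
  \sum_t @hpow R A B h n t * qf (tpw s n) (@upow R A B v n t) = n%:R * \sum_t h t * qf s (v t).
Proof.
move=> hs hv; have hh := psd_herm (proj1 hs).
under eq_bigr do rewrite qf_tpow //.
have q1 : \sum_t qf s (v t) = 1 by rewrite -rtr_onb // state_rtr.
elim: n => [|n IH]; first by rewrite mul0r big1 // => t _ /=; rewrite mul0r.
set e := split_loc (an_cons A n) (an_cons B n).
have E t : @hpow R A B h n.+1 t * apow (fun t => qf s (v t)) t =
    (h (e t).1 + hpow h (e t).2) * (qf s (v (e t).1) * apow (fun t => qf s (v t)) (e t).2) by [].
under eq_bigr do rewrite E.
rewrite (sum_split e).
transitivity (\sum_p \sum_q (h p * qf s (v p) * @apow R A B (fun t => qf s (v t)) n q +
   qf s (v p) * (@hpow R A B h n q * apow (fun t => qf s (v t)) q))).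
  apply: eq_bigr => p _; apply: eq_bigr => q _; rewrite spiK /=; ring.
under eq_bigr do rewrite big_split /= -!mulr_sumr sum_apow q1 expr1n mulr1 IH.
by rewrite big_split /= -mulr_suml q1 mul1r -natr1; ring.
Qed.

Lemma apow_pos (a : (A * B)%type -> R) n t : (forall s, 0 <= a s) -> 0 < @apow R A B a n t ->
  ln (@apow R A B a n t) = hpow (fun s => ln (a s)) t.
Proof.
move=> ha; elim: n t => [|n IH] t; first by rewrite /= ln1.
set e := split_loc (an_cons A n) (an_cons B n).
rewrite -[apow a t]/(a (e t).1 * apow a (e t).2) -[hpow _ t]/(ln (a (e t).1) + hpow (fun s => ln (a s)) (e t).2).
move=> h; have h2 : 0 <= apow a (e t).2 by exact: apow_ge0.
have [p1 p2] : 0 < a (e t).1 /\ 0 < apow a (e t).2.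
  move: h; rewrite lt_def mulf_eq0 negb_or => /andP[/andP[n1 n2] _].
  by rewrite !lt_def n1 n2 ha h2.
by rewrite lnM ?posrE // IH.
Qed.

Lemma apow_zero (a q : (A * B)%type -> R) n t : (forall s, a s = 0 -> q s = 0) ->
  @apow R A B a n t = 0 -> @apow R A B q n t = 0.
Proof.
move=> h; elim: n t => [|n IH] t /=; first by move=> /eqP; rewrite oner_eq0.
by move=> /eqP; rewrite mulf_eq0 => /orP[]/eqP => [/h ->|/IH ->]; rewrite ?mul0r ?mulr0.
Qed.

(** Under the Nussbaum-Szkola distributions of the tensor powers the log-likelihood ratio has mean
    [n d]. A threshold slightly above this mean in [test_lower_bound] leaves a fixed positive amount
    of total error, which the small error on [s] cannot account for. *)
Lemma converse (s rho : op (A * B)%type) (d del : R) : state s -> state rho ->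
  relent s rho = d%:E -> 0 < del ->
  exists2 eps0 : R, 0 < eps0 & exists N, forall n, (N <= n)%N -> forall M, test_op M ->
    rtr (opmul (opadd (@opid R _) (opopp M)) (tpw s n)) <= eps0 ->
    expR (- (n%:R * (d + del))) <= rtr (opmul M (tpw rho n)).
Proof.
move=> ss sr hd del0.
have ps := proj1 ss; have pr := proj1 sr.
have hsupp : supp_incl s rho by move: hd; rewrite /relent; case: asboolP.
have := relentE ps pr hsupp; rewrite hd; clear hd.
have [hu Es] := some_spectral_decP (psd_herm ps).
have [hv Er] := some_spectral_decP (psd_herm pr).
move: hu hv Es Er.
set a := (some_spectral_dec s).1; set u := (some_spectral_dec s).2.
set r := (some_spectral_dec rho).1; set v := (some_spectral_dec rho).2.
move=> hu hv Es Er [Ed].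
have a0 t : 0 <= a t by apply: (psd_spec_ge0 _ hu); rewrite -Es.
have r0 t : 0 <= r t by apply: (psd_spec_ge0 _ hv); rewrite -Er.
have qa t : qf s (u t) = a t by have := qf_spec_basis a t hu; rewrite -Es.
have qr t : qf rho (v t) = r t by have := qf_spec_basis r t hv; rewrite -Er.
have a1 : \sum_t a t = 1.
  by rewrite -(state_rtr ss) (rtr_onb _ hu); apply: eq_bigr => t _; rewrite qa.
have r1 : \sum_t r t = 1.
  by rewrite -(state_rtr sr) (rtr_onb _ hv); apply: eq_bigr => t _; rewrite qr.
have supp t : r t = 0 -> qf s (v t) = 0.
  by move: hsupp; rewrite [in X in supp_incl _ X]Er supp_inclP // => /(_ t).
have main n tau M : 0 < tau -> test_op M ->
  tau * (1 - 2 * (rtr (opmul (opadd (@opid R _) (opopp M)) (tpw s n)) +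
     expR tau * rtr (opmul M (tpw rho n)))) <= n%:R * d + 1.
  move=> tau0 hM.
  have hun := onb_upow (n := n) hu; have hvn := onb_upow (n := n) hv.
  have Esn : tpw s n = spec (@apow R A B a n) (@upow R A B u n) by rewrite {1}Es tpow_spec.
  have Ern : tpw rho n = spec (@apow R A B r n) (@upow R A B v n) by rewrite {1}Er tpow_spec.
  pose z i j := @hpow R A B (fun t => ln (a t)) n i - @hpow R A B (fun t => ln (r t)) n j.
  have := @test_lower_bound _ (@apow R A B a n) (@apow R A B r n) _ _ M z tau hun hvn
    (fun t => apow_ge0 t a0) (fun t => apow_ge0 t r0) tau0 hM.
  rewrite -Esn -Ern !sum_apow a1 r1 !expr1n => /(_ erefl erefl) h.
  apply: le_trans (h _) _.
    move=> i j ai wij.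
    have rj : 0 < apow r j.
      rewrite lt_def apow_ge0 // andbT; apply/eqP => rj0.
      have := apow_zero supp rj0; rewrite -qf_tpow; last exact: psd_herm.
      rewrite Esn qf_spec => /eqP; rewrite psumr_eq0 => [/allP/(_ i (mem_index_enum i)) /=|t _]; last first.
        by rewrite mulr_ge0 ?nsq_ge0 ?apow_ge0.
      by rewrite mulf_eq0 (gt_eqF ai) (gt_eqF wij).
    by split=> //; rewrite /z !apow_pos.
  rewrite lerD2r le_eqVlt; apply/orP; left; apply/eqP.
  transitivity (\sum_i @hpow R A B (fun t => ln (a t)) n i * qf (tpw s n) (@upow R A B u n i) -
    \sum_j @hpow R A B (fun t => ln (r t)) n j * qf (tpw s n) (@upow R A B v n j)).
    rewrite /z; under eq_bigr do under eq_bigr do rewrite mulrBr.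
    under eq_bigr do rewrite sumrB.
    rewrite sumrB; congr (_ - _).
      apply: eq_bigr => i _; rewrite -mulr_suml -mulr_sumr Esn qf_spec_basis //.
      under eq_bigr do rewrite nsq_ipC.
      by rewrite -parseval // onb_nrm // mulr1 mulrC.
    rewrite exchange_big /=; apply: eq_bigr => j _.
    by rewrite -mulr_suml mulrC Esn qf_spec.
  rewrite !hpow_tpow // -mulrBr; congr (_ * _); rewrite Ed; congr (_ - _).
  by apply: eq_bigr => t _; rewrite qa mulrC.
(* Nonnegativity makes the threshold [tau] below positive. [klein] asks for positive eigenvalues of
   the second operator, so its argument is repeated with the support condition. *)
have d0 : 0 <= d.
  rewrite Ed subr_ge0.
  apply: (@le_trans _ _ (\sum_t \sum_i ln (r t) * (a i * nsq (ip (u i) (v t))))).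
    apply: ler_sum => t _.
    by rewrite -mulr_sumr -qf_spec -Es.
  have w1 i : \sum_t nsq (ip (u i) (v t)) = 1.
    by under eq_bigr do rewrite nsq_ipC; rewrite -parseval // onb_nrm.
  have w2 t : \sum_i nsq (ip (u i) (v t)) = 1 by rewrite -parseval // onb_nrm.
  apply: (@le_trans _ _ (\sum_t \sum_i (a i * ln (a i) + r t - a i) * nsq (ip (u i) (v t)))).
    apply: ler_sum => t _; apply: ler_sum => i _.
    have := nsq_ge0 (ip (u i) (v t)); rewrite le_eqVlt => /predU1P[<-|w0]; first by rewrite !mulr0.
    rewrite mulrCA mulrA; have := a0 i; rewrite le_eqVlt => /predU1P[<-|p0].
      by rewrite !mul0r add0r subr0 mulr_ge0 // ltW.
    apply: ler_wpM2r; first exact: ltW.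
    apply: mul_ln_le => //.
    rewrite lt_def r0 andbT; apply/eqP => /supp; rewrite Es qf_spec => /eqP.
    rewrite psumr_eq0 => [/allP/(_ i (mem_index_enum i)) /=|l _]; last by rewrite mulr_ge0 ?nsq_ge0.
    by rewrite mulf_eq0 (gt_eqF p0) (gt_eqF w0).
  rewrite le_eqVlt; apply/orP; left; apply/eqP.
  transitivity (\sum_t \sum_i a i * ln (a i) * nsq (ip (u i) (v t)) +
     \sum_t \sum_i r t * nsq (ip (u i) (v t)) - \sum_t \sum_i a i * nsq (ip (u i) (v t))).
    rewrite -big_split -sumrB; apply: eq_bigr => t _; rewrite -big_split -sumrB.
    by apply: eq_bigr => i _ /=; ring.
  rewrite exchange_big [X in _ - X]exchange_big /=.
  have E1 (f : (A * B)%type -> R) : \sum_i \sum_t f i * nsq (ip (u i) (v t)) = \sum_i f i.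
    by apply: eq_bigr => i _; rewrite -mulr_sumr w1 mulr1.
  rewrite !E1 a1.
  under [X in _ + X - _]eq_bigr do rewrite -mulr_sumr w2 mulr1.
  by rewrite r1 addrK.
pose tau := d + del / 2.
have tau0 : 0 < tau by rewrite /tau; lra.
(* For large [n], [main] bounds the sum of the error on [s] and [exp (n tau)] times the acceptance
   on [rho] below by [del / (8 tau) = 2 eps0]. An error of at most [eps0] on [s] leaves at least
   [eps0] for the other term. *)
pose eps0 := del / (16 * tau).
have eps0p : 0 < eps0 by rewrite divr_gt0 // mulr_gt0.
exists eps0 => //.
have [N1 hN1] := @exists_nat_mul_ge R (del / 4) 1 ltac:(lra).
have [N2 hN2] := @exists_nat_mul_ge R (del / 2) (- ln eps0) ltac:(lra).
exists (maxn (maxn N1 N2) 1) => n; rewrite !geq_max => /andP[/andP[n1 n2] n3] M hM hle.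
have n0 : 0 < n%:R :> R by rewrite ltr0n.
have nt0 : 0 < n%:R * tau by rewrite mulr_gt0.
have := main n (n%:R * tau) M nt0 hM.
set al := rtr _ in hle *; set be := rtr _; move=> h.
have h1 : n%:R * tau * (1 - 2 * (al + expR (n%:R * tau) * be)) <= n%:R * (tau - del / 4).
  apply: (le_trans h); have := hN1 n n1; rewrite /tau; lra.
rewrite -mulrA ler_pM2l // in h1.
have h2 : del / 4 <= tau * (2 * (al + expR (n%:R * tau) * be)) by lra.
have h3 : 4 * (tau * eps0) = del / 4 by rewrite /eps0; field; rewrite gt_eqF.
have h4 : eps0 <= expR (n%:R * tau) * be.
  have : 4 * eps0 <= 2 * (al + expR (n%:R * tau) * be).
    rewrite -(ler_pM2l tau0); move: h2 h3; lra.
  lra.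
apply: (@le_trans _ _ (expR (- (n%:R * tau)) * eps0)); last first.
  by rewrite expRN mulrC ler_pdivrMr ?expR_gt0 // mulrC.
rewrite -[eps0 in leRHS]lnK ?posrE // -expRD ler_expR /tau.
have := hN2 n n2; lra.
Qed.

Lemma etens_loc (X X1 X2 Y Y1 Y2 : finType) (eX : splitting X X1 X2) (eY : splitting Y Y1 Y2)
  (a : op X1) (b : op Y1) (a' : op X2) (b' : op Y2) :
  etens (split_loc eX eY) (tens a b) (tens a' b') = tens (etens eX a a') (etens eY b b').
Proof. by apply: funext => i; apply: funext => j; rewrite /etens /tens /=; ring. Qed.

Lemma scone_etens (X X1 X2 Y Y1 Y2 : finType) (eX : splitting X X1 X2) (eY : splitting Y Y1 Y2)
  (s1 : op (X1 * Y1)%type) (s2 : op (X2 * Y2)%type) :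
  scone s1 -> scone s2 -> scone (etens (split_loc eX eY) s1 s2).
Proof.
move=> h1 h2; elim: h1 => [a b ha hb||t1 t2 _ k1 _ k2].
- elim: h2 => [a' b' ha' hb'||t1 t2 _ k1 _ k2].
  + by rewrite etens_loc; apply: scone_tens; exact: psd_etens.
  + have -> : etens (split_loc eX eY) (tens a b) (@op0 R _) = @op0 R _; last exact: scone0.
    by apply: funext => i; apply: funext => j; rewrite /etens /op0 mulr0.
  + have -> : etens (split_loc eX eY) (tens a b) (opadd t1 t2) =
      opadd (etens (split_loc eX eY) (tens a b) t1) (etens (split_loc eX eY) (tens a b) t2).
      by apply: funext => i; apply: funext => j; rewrite /etens /opadd mulrDr.
    exact: sconeD.
- have -> : etens (split_loc eX eY) (@op0 R _) s2 = @op0 R _; last exact: scone0.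
  by apply: funext => i; apply: funext => j; rewrite /etens /op0 mul0r.
- have -> : etens (split_loc eX eY) (opadd t1 t2) s2 =
    opadd (etens (split_loc eX eY) t1 s2) (etens (split_loc eX eY) t2 s2).
    by apply: funext => i; apply: funext => j; rewrite /etens /opadd mulrDl.
  exact: sconeD.
Qed.

Lemma tpow_sep (s : op (A * B)%type) n : separable s -> separable (tpw s n).
Proof.
move=> ss; apply: scone_sep; last by apply: state_rtr; apply: state_tpow; exact: sep_state.
elim: n => [|n IH].
  by rewrite tpow0 -tens_id; apply: scone_tens; exact: psd_id.
by rewrite tpowS; apply: scone_etens => //; exact: sep_scone.
Qed.

End Converse.

(** * Fidelity and isotropic states *)

Section Fidelity.
Variable R : realType.
Local Notation C := R[i].
Local Notation op := (@op R).
Variable T : finType.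

Lemma opsqrtE (X : op T) :
  opsqrt X = spec (fun t => Num.sqrt ((some_spectral_dec X).1 t)) (some_spectral_dec X).2.
Proof. by []. Qed.

Lemma opsqrt_sqr (X : op T) : psd X -> opmul (opsqrt X) (opsqrt X) = X.
Proof.
move=> hX; have [hu E] := some_spectral_decP (psd_herm hX).
rewrite opsqrtE specM // [RHS]E; congr spec; apply: funext => t.
by rewrite -expr2 sqr_sqrtr //; apply: (psd_spec_ge0 _ hu); rewrite -E.
Qed.

Lemma opmul_ketbra (X : op T) v : hermitian X ->
  opmul (ketbra v v) (opmul X (ketbra v v)) = opscale (rC (qf X v)) (ketbra v v).
Proof.
move=> hX; rewrite -qfE //; apply: funext => i; apply: funext => j.
rewrite /opmul /opscale /ketbra /ip mulr_suml; apply: eq_bigr => k _.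
rewrite /opapp mulr_sumr mulr_sumr mulr_suml; apply: eq_bigr => l _; ring.
Qed.

(** The square root is defined through an unspecified spectral decomposition. This relation confines
    its eigenvalues to [0] and [q], which is all that the fidelity computation needs. *)
Lemma quasi_idem_eigen (X : op T) q t : hermitian X -> opmul X X = opscale (rC q) X ->
  (some_spectral_dec X).1 t ^+ 2 = q * (some_spectral_dec X).1 t.
Proof.
move=> hX; have [hu] := some_spectral_decP hX.
set a := (some_spectral_dec X).1; set u := (some_spectral_dec X).2 => E.
have Eq : qf (opmul X X) (u t) = a t ^+ 2.
  by rewrite [X in opmul X X]E specM // qf_spec_basis // expr2.
have Eq2 : qf X (u t) = a t by rewrite [X in qf X _]E qf_spec_basis.
by move=> h; rewrite -Eq h qfZ Eq2.
Qed.

Lemma rtr_ketbra (v : T -> C) : rtr (ketbra v v) = nrm v.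
Proof. by rewrite /rtr optr_ketbra. Qed.

Lemma ketbra_idem (v : T -> C) : nrm v = 1 -> opmul (ketbra v v) (ketbra v v) = ketbra v v.
Proof.
move=> h; apply: funext => i; apply: funext => j; rewrite /opmul /ketbra.
transitivity (v i * ip v v * conjc (v j)); last by rewrite ip_nrm h rC1 mulr1.
by rewrite /ip mulr_sumr mulr_suml; apply: eq_bigr => k _; ring.
Qed.

Lemma opscale1 (X : op T) : opscale (rC 1) X = X.
Proof. by apply: funext => i; apply: funext => j; rewrite /opscale mul1r. Qed.

Lemma opsqrt_proj (v : T -> C) : nrm v = 1 -> opsqrt (ketbra v v) = ketbra v v.
Proof.
move=> hv; have hK := herm_ketbra v.
have [hu E] := some_spectral_decP hK.
rewrite opsqrtE [RHS]E; congr spec; apply: funext => t.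
have := @quasi_idem_eigen _ 1 t hK; rewrite ketbra_idem // opscale1 mul1r => /(_ erefl).
set a := (some_spectral_dec _).1 t => h.
have : a * (a - 1) = 0 by rewrite mulrBr -expr2 h mulr1 subrr.
move=> /eqP; rewrite mulf_eq0 subr_eq0 => /orP[]/eqP->; first exact: sqrtr0.
exact: sqrtr1.
Qed.

(** All eigenvalues are [0] or [q] and they add up to [q]. The equation
    [Num.sqrt x * Num.sqrt q = x] at [x = 0] and [x = q] then gives the sum of the roots. *)
Lemma rtr_opsqrt_scaled (v : T -> C) q : nrm v = 1 -> 0 <= q ->
  rtr (opsqrt (opscale (rC q) (ketbra v v))) = Num.sqrt q.
Proof.
move=> hv q0; set X := opscale _ _.
have hX : hermitian X by apply: hermZ; exact: herm_ketbra.
have XX : opmul X X = opscale (rC q) X.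
  rewrite /X -[in RHS](ketbra_idem hv); apply: funext => i; apply: funext => j.
  by rewrite /opmul /opscale !mulr_sumr; apply: eq_bigr => k _; ring.
have [hu E] := some_spectral_decP hX.
have ev t := quasi_idem_eigen t hX XX.
move: hu E ev; set a := (some_spectral_dec X).1; set u := (some_spectral_dec X).2 => hu E ev.
have tX : \sum_t a t = q.
  transitivity (rtr X); last by rewrite rtrZ rtr_ketbra hv mulr1.
  rewrite (rtr_onb _ hu); apply: eq_bigr => t _.
  by rewrite [X in qf X _]E qf_spec_basis.
rewrite opsqrtE -/a -/u (rtr_onb _ hu).
under eq_bigr do rewrite qf_spec_basis //.
have ad t : a t = 0 \/ a t = q.
  have : a t * (a t - q) = 0 by rewrite mulrBr -expr2 ev mulrC subrr.
  by move=> /eqP; rewrite mulf_eq0 subr_eq0 => /orP[]/eqP; [left|right].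
have [q00|qn0] := eqVneq q 0.
  rewrite q00 sqrtr0 big1 // => t _.
  by case: (ad t) => ->; rewrite ?q00 sqrtr0.
have sq0 : Num.sqrt q != 0 by rewrite sqrtr_eq0 -ltNge lt_def qn0.
apply: (mulIf sq0); rewrite -[RHS]expr2 sqr_sqrtr // -[RHS]tX mulr_suml.
apply: eq_bigr => t _; case: (ad t) => ->; first by rewrite sqrtr0 mul0r.
by rewrite -expr2 sqr_sqrtr.
Qed.

(** A rank-one projection is its own square root, and sandwiching [r] by it gives the multiple
    [qf r v] of the projection. *)
Lemma fidelity_pure (r : op T) v : psd r -> nrm v = 1 -> fidelity r (ketbra v v) = qf r v.
Proof.
move=> hr hv; rewrite /fidelity /trnorm opsqrt_proj // opadjM.
rewrite [opadj (ketbra v v)]herm_ketbra.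
have -> : opadj (opsqrt r) = opsqrt r by rewrite opsqrtE herm_spec.
rewrite -opmulA (opmulA (opsqrt r) (opsqrt r)) opsqrt_sqr // opmul_ketbra; last exact: psd_herm.
by rewrite rtr_opsqrt_scaled ?psd_qf // sqr_sqrtr // psd_qf.
Qed.

Lemma cauchy_schwarz (x y : T -> C) : nsq (ip x y) <= nrm x * nrm y.
Proof. by rewrite -qf_ketbra -rtr_ketbra; apply: qf_le_rtr; exact: psd_ketbra. Qed.

End Fidelity.

(** * The maximally entangled state and its separable admixtures *)

Section MaximallyEntangled.
Variable R : realType.
Local Notation C := R[i].
Local Notation op := (@op R).
Variable Q : finType.
Let D : R := #|Q|%:R.
Hypothesis hD : (1 < #|Q|)%N.

Definition maxent : (Q * Q)%type -> C := fun q => if q.1 == q.2 then rC (Num.sqrt D^-1) else 0.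

Lemma D_gt0 : 0 < D. Proof. by rewrite ltr0n ltnW. Qed.

Lemma sqrtD : Num.sqrt D^-1 * Num.sqrt D^-1 = D^-1.
Proof. by rewrite -expr2 sqr_sqrtr // invr_ge0 ltW // D_gt0. Qed.

Lemma maxent_nrm : nrm maxent = 1.
Proof.
rewrite /nrm (sum_split (split_id Q Q)) /maxent /=.
transitivity (\sum_(p : Q) D^-1).
  apply: eq_bigr => p _; rewrite (bigD1 p) //= eqxx nsq_rC expr2 sqrtD.
  rewrite big1 ?addr0 // => q /negbTE h; rewrite eq_sym h.
  by apply/eqP; rewrite nsq_eq0.
by rewrite sumr_const -[_ *+ _]mulr_natr mulVf // gt_eqF // D_gt0.
Qed.

Lemma maxentE i j : ketbra maxent maxent i j =
  if (i.1 == i.2) && (j.1 == j.2) then rC D^-1 else 0.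
Proof.
rewrite /ketbra /maxent; case: eqP => _ /=; last by rewrite mul0r.
case: eqP => _; last by rewrite conjc0 mulr0.
by rewrite conjc_rC -rCM sqrtD.
Qed.

(** A product vector overlaps with [maxent] in [D ^ (-1/2) <x, conj y>]; Cauchy-Schwarz and
    convexity do the rest. *)
Lemma maxent_sep (s : op (Q * Q)%type) : separable s -> qf s maxent <= D^-1.
Proof.
move=> ss; have [I [p [x [y [hp [hx [hy E]]]]]]] := scone_rank1 (sep_scone ss).
have p1 : \sum_i p i = 1.
  rewrite -(state_rtr (sep_state ss)) E rtr_osum; apply: eq_bigr => i _.
  by rewrite rtr_prodop hx hy !mulr1.
rewrite E qf_osum -[leRHS]mul1r -p1 mulr_suml; apply: ler_sum => i _.
rewrite ler_wpM2l //.
have -> : prodop (x i) (y i) = ketbra (evec (split_id Q Q) (x i) (y i)) (evec (split_id Q Q) (x i) (y i)).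
  apply: funext => k; apply: funext => l.
  by rewrite /prodop /tens /ketbra /evec conjcM /=; ring.
rewrite qf_ketbra.
have -> : ip (evec (split_id Q Q) (x i) (y i)) maxent =
   rC (Num.sqrt D^-1) * ip (x i) (fun k => conjc (y i k)).
  rewrite /ip (sum_split (split_id Q Q)) mulr_sumr; apply: eq_bigr => k _.
  rewrite (bigD1 k) //= big1 ?addr0 => [|l /negbTE h].
    by rewrite /maxent /= eqxx /evec conjcM /=; ring.
  by rewrite /maxent /= eq_sym h mulr0.
rewrite nsqM nsq_rC expr2 sqrtD; apply: ler_piMr; first by rewrite invr_ge0 ltW // D_gt0.
apply: le_trans (cauchy_schwarz _ _) _; rewrite hx mul1r.
have <- : nrm (y i) = nrm (fun k => conjc (y i k)); last by rewrite hy.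
by apply: eq_bigr => k _; rewrite nsqJ.
Qed.

Definition tauc : R := (D * (D - 1))^-1.
(** Uniform on the [D (D - 1)] product basis states with different labels: diagonal, hence
    separable, and orthogonal to [maxent]. With this choice an average over diagonal phases produces
    its mixture with [maxent]. *)
Definition tau : op (Q * Q)%type := fun i j => if (i == j) && (i.1 != i.2) then rC tauc else 0.

Lemma D_gt1 : 1 < D. Proof. by rewrite ltr1n. Qed.

Lemma tauc_ge0 : 0 <= tauc.
Proof. by have := D_gt1; rewrite /tauc => h; rewrite invr_ge0 mulr_ge0 //; lra. Qed.

Lemma tau_scone : scone tau.
Proof.
have -> : tau = osum (fun q : (Q * Q)%type => if q.1 != q.2 then tauc else 0)
   (fun q => tens (ketbra (fun k => if q.1 == k then 1 else 0) (fun k => if q.1 == k then 1 else 0))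
                  (ketbra (fun k => if q.2 == k then 1 else 0) (fun k => if q.2 == k then 1 else 0))).
  apply: funext => -[i1 i2]; apply: funext => -[j1 j2]; rewrite /osum (bigD1 (i1, i2)) //=.
  rewrite big1 ?addr0 => [|[q1 q2] h]; last first.
    rewrite /tens /ketbra /=; move: h; rewrite xpair_eqE.
    by do 2 case: eqP => //= _; rewrite ?(mul0r, mulr0).
  rewrite /tau /tens /ketbra /= !eqxx xpair_eqE !conjc_if !mul1r.
  by do 3 case: eqP => //= _; rewrite ?(mul0r, mulr0, mulr1).
apply: scone_osum => q; first by case: ifP => // _; exact: tauc_ge0.
by apply: scone_tens; exact: psd_ketbra.
Qed.

Lemma tau_rtr : rtr tau = 1.
Proof.
rewrite /rtr /optr Re_sum (sum_split (split_id Q Q)) /tau /=.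
transitivity (\sum_(p : Q) (D - 1) * tauc).
  apply: eq_bigr => p _.
  have -> : (D - 1) * tauc = \sum_(q : Q) tauc - tauc.
    by rewrite sumr_const -[_ *+ _]mulr_natl mulrBl mul1r.
  rewrite [in RHS](bigD1 p) //= [tauc + _]addrC addrK (bigD1 p) //= !eqxx /= add0r.
  by apply: eq_bigr => q h; rewrite eqxx eq_sym h.
rewrite sumr_const -[_ *+ _]mulr_natl /tauc mulrA mulfV // -/D mulf_neq0 //.
  by rewrite gt_eqF // D_gt0.
by rewrite subr_eq0 gt_eqF // D_gt1.
Qed.

Lemma tau_sep : separable tau.
Proof. by apply: scone_sep; [exact: tau_scone|exact: tau_rtr]. Qed.

Lemma qf_tau_maxent : qf tau maxent = 0.
Proof.
rewrite /qf /ip big1 // => -[i1 i2] _; rewrite /opapp big1 ?mulr0 // => -[j1 j2] _.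
rewrite /tau /maxent /=; case: ifP => [/andP[/eqP [<- <-] /negbTE ->]|_]; last by rewrite mul0r.
by rewrite mulr0.
Qed.

(** By [maxent_sep] the weight [1 / D] on the maximally entangled state is the largest one
    compatible with separability. *)
Definition iso : op (Q * Q)%type :=
  opadd (opscale (rC (1 - D^-1)) tau) (opscale (rC D^-1) (ketbra maxent maxent)).

(** Fourth roots of unity make the phases and also their squares average to zero, which signs alone
    would not do; the average remains a finite sum. *)
Definition phv (z : {ffun Q -> 'I_4}) : Q -> C := fun q => ph R (z q).

Lemma nsq_ph k : ph R k * conjc (ph R k) = 1.
Proof.
have ii : ('i%C : C) * conjc 'i%C = 1.
  by rewrite /=; simpc; congr Complex; rewrite ?(mul0r, mulr0); ring.
rewrite /ph; elim: (nat_of_ord k) => [|n IH]; first by rewrite expr0 conjc1 mulr1.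
by rewrite exprS conjcM mulrACA IH ii mulr1.
Qed.

Lemma ph_sums : [/\ \sum_k ph R k = 0, \sum_k ph R k * ph R k = 0 & \sum_k conjc (ph R k) = 0].
Proof.
have i2 : ('i%C : C) ^+ 2 = -1 by exact: sqr_i.
have i3 : ('i%C : C) ^+ 3 = - 'i%C by rewrite exprS i2 mulrN1.
have s1 : \sum_k ph R k = 0.
  rewrite !big_ord_recl big_ord0 /ph /= /bump /=.
  rewrite (_ : (1 + (1 + 1))%N = 3%N) // (_ : (1 + 1)%N = 2%N) // (_ : (1 + 0)%N = 1%N) //.
  by rewrite expr0 expr1 i2 i3; ring.
split=> //.
  under eq_bigr do rewrite /ph -exprD addnn -muln2 mulnC exprM i2.
  rewrite !big_ord_recl big_ord0 /= /bump /=.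
  rewrite (_ : (1 + (1 + 1))%N = 3%N) // (_ : (1 + 1)%N = 2%N) // (_ : (1 + 0)%N = 1%N) //.
  by ring.
by rewrite -conjc_sum s1 conjc0.
Qed.

Lemma prod_at (a : Q) (f : Q -> C) : \prod_t (if t == a then f t else 1) = f a.
Proof. by rewrite (bigD1 a) //= eqxx big1 ?mulr1 // => t /negbTE ->. Qed.

(* Averaging the product vectors phv z (x) conj (phv z) over all phases z in {1, i, -1, -i}
   leaves only the entries whose phases cancel identically. *)
Lemma phase_average (i1 i2 j1 j2 : Q) :
  \sum_z phv z i1 * conjc (phv z j1) * (conjc (phv z i2) * phv z j2) =
  if ((i1 == j1) && (i2 == j2)) || ((i1 == i2) && (j1 == j2)) then (#|{ffun Q -> 'I_4}|%:R : C) else 0.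
Proof.
have [s1 s2 s3] := ph_sums.
case: ifP => [h|h].
  have one z : phv z i1 * conjc (phv z j1) * (conjc (phv z i2) * phv z j2) = 1.
    have nJ k : conjc (ph R k) * ph R k = 1 by rewrite mulrC nsq_ph.
    rewrite /phv; case/orP: h => /andP[/eqP -> /eqP ->]; first by rewrite nsq_ph nJ mulr1.
    by rewrite mulrACA nsq_ph nJ mulr1.
  by under eq_bigr do rewrite one; rewrite sumr_const.
pose F (t : Q) (k : 'I_4) : C := (if t == i1 then ph R k else 1) * (if t == j1 then conjc (ph R k) else 1) *
  ((if t == i2 then conjc (ph R k) else 1) * (if t == j2 then ph R k else 1)).
transitivity (\sum_(z : {ffun Q -> 'I_4}) \prod_t F t (z t)).
  by apply: eq_bigr => z _; rewrite /F !big_split /= !prod_at.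
rewrite -bigA_distr_bigA /=.
(* The average factors over positions, so one position with unbalanced phases suffices. The net
   exponent found there is [1], [-1] or [2], the cases of [ph_sums]. *)
suff [t ht] : exists t, \sum_k F t k = 0 by rewrite (bigD1 t) //= ht mul0r.
move: h; rewrite /F.
have [e1|n1] := eqVneq i1 j1.
  have [e2|n2] := eqVneq i2 j2 => //= h.
  have [e3|n3] := eqVneq i1 i2.
    exists j2; rewrite -e1 -e3 [j2 == i1]eq_sym e3 (negbTE n2) eqxx.
    by under eq_bigr do rewrite !mul1r; exact: s1.
  exists i2; rewrite -e1 [i2 == i1]eq_sym (negbTE n3) eqxx (negbTE n2).
  by under eq_bigr do rewrite !mul1r mulr1; exact: s3.
have [e3|n3] := eqVneq i1 i2 => /= h.
  exists j1; rewrite -e3 [j1 == i1]eq_sym (negbTE n1) eqxx h.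
  by under eq_bigr do rewrite !mul1r !mulr1; exact: s3.
exists i1; rewrite eqxx (negbTE n1) (negbTE n3).
case: eqP => _; under eq_bigr do rewrite mulr1 mul1r ?mulr1; [exact: s2|exact: s1].
Qed.

(** [iso] is the phase average of product vectors: both have all surviving entries equal to
    [1 / D ^ 2], on the diagonal and on the block spanned by equal labels. *)
Lemma iso_sep : separable iso.
Proof.
have hD0 := D_gt0; have hD1 := D_gt1.
apply: scone_sep; last first.
  by rewrite rtrD !rtrZ tau_rtr rtr_ketbra maxent_nrm; ring.
pose N : R := #|{ffun Q -> 'I_4}|%:R.
have N0 : 0 < N.
  by rewrite ltr0n; apply/card_gt0P; exists [ffun=> ord0].
have -> : iso = osum (fun=> (N * D ^+ 2)^-1)
    (fun z => prodop (phv z) (fun q => conjc (phv z q))).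
  apply: funext => -[i1 i2]; apply: funext => -[j1 j2]; rewrite /osum -mulr_sumr.
  transitivity (rC (N * D ^+ 2)^-1 *
    \sum_z phv z i1 * conjc (phv z j1) * (conjc (phv z i2) * phv z j2)); last first.
    by congr (_ * _); apply: eq_bigr => z _; rewrite /prodop /tens /ketbra /= conjcK.
  rewrite phase_average /iso /opadd /opscale maxentE /tau /= xpair_eqE.
  have -> : (#|{ffun Q -> 'I_4}|%:R : C) = rC N by rewrite rCE rmorph_nat.
  have K1 : rC (N * D ^+ 2)^-1 * rC N = rC (D ^+ 2)^-1 :> C.
    by rewrite -rCM; congr rC; field; rewrite !gt_eqF.
  have K2 : rC (1 - D^-1) * rC tauc = rC (D ^+ 2)^-1 :> C.
    rewrite -rCM; congr rC; rewrite /tauc; field.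
    by rewrite gt_eqF //= subr_eq0 gt_eqF.
  have K3 : rC D^-1 * rC D^-1 = rC (D ^+ 2)^-1 :> C.
    by rewrite -rCM; congr rC; rewrite expr2 invfM.
  case: (i1 =P j1) => e1; case: (i2 =P j2) => e2; case: (i1 =P i2) => e3; case: (j1 =P j2) => e4;
    rewrite /= ?(mulr0, add0r, addr0, K1, K2, K3) //; exfalso; congruence.
apply: scone_osum => z; first by rewrite invr_ge0 mulr_ge0 ?sqr_ge0 // ltW.
by apply: scone_tens; exact: psd_ketbra.
Qed.

(** Interpolation between [tau] and [iso] with weight [p D], since [iso] carries weight [1 / D] on
    the entangled state. *)
Lemma maxent_tau_sep p : 0 <= p <= D^-1 ->
  separable (opadd (opscale (rC p) (ketbra maxent maxent)) (opscale (rC (1 - p)) tau)).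
Proof.
move=> /andP[p0 p1]; have hD0 := D_gt0.
have pD : 0 <= p * D <= 1.
  apply/andP; split; first by rewrite mulr_ge0 // ltW.
  by rewrite -ler_pdivlMr // mul1r.
have := sep_convex pD tau_sep iso_sep; congr separable.
apply: funext => i; apply: funext => j; rewrite /iso /opadd /opscale.
have -> : rC p = rC (p * D) * rC D^-1 :> C by rewrite -rCM; congr rC; field; rewrite gt_eqF.
have -> : rC (1 - p) = rC (1 - p * D) + rC (p * D) * rC (1 - D^-1) :> C.
  by rewrite -rCM -rCD; congr rC; field; rewrite gt_eqF.
by ring.
Qed.

End MaximallyEntangled.

(** * Tests and non-entangling channels *)

Section TestsAndChannels.
Variable R : realType.
Local Notation C := R[i].
Local Notation op := (@op R).

(** Polarisation with the vectors [e i + e j] and [e i + 'i e j]. It recovers hermiticity of an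
    operator known only through its quadratic form. *)
Lemma hermitian_of_real (T : finType) (X : op T) :
  (forall v, complex.Im (ip v (opapp X v)) = 0) -> hermitian X.
Proof.
move=> h; apply: funext => i; apply: funext => j; rewrite /opadj.
pose e (k : T) : T -> C := fun l => if k == l then 1 else 0.
have ipe k (y : T -> C) : ip (e k) y = y k.
  by rewrite /ip; under eq_bigr do rewrite conjc_if; rewrite sum_delta.
have ape k l : opapp X (e l) k = X k l.
  by rewrite /opapp /e; under eq_bigr do rewrite eq_sym; rewrite sum_delta2.
have E (c : C) : ip (fun l => e i l + c * e j l) (opapp X (fun l => e i l + c * e j l)) =
  X i i + c * X i j + conjc c * (X j i + c * X j j).
  have -> : opapp X (fun l => e i l + c * e j l) = fun k => X k i + c * X k j.
    apply: funext => k; rewrite -!ape /opapp mulr_sumr -big_split.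
    by apply: eq_bigr => l _ /=; ring.
  by rewrite ipDl ipZl !ipe.
have h1 := h (fun l => e i l + 1 * e j l); rewrite E in h1.
have h2 := h (fun l => e i l + 'i%C * e j l); rewrite E in h2.
have h3 : complex.Im (X i i) = 0 by have := h (e i); rewrite ipe ape.
have h4 : complex.Im (X j j) = 0 by have := h (e j); rewrite ipe ape.
move: h1 h2 h3 h4; case: (X i i) (X i j) (X j i) (X j j) => a1 a2 [b1 b2] [c1 c2] [d1 d2].
by simpc => /= h1 h2 h3 h4; congr Complex; lra.
Qed.

Section LinearMaps.
Variables (X Y : finType) (L : op X -> op Y).
Hypothesis hL : linear_map L.

Lemma linear_map0 : L (@op0 R X) = @op0 R Y.
Proof.
have := hL 1 (@op0 R X) (@op0 R X).
have -> : opadd (opscale 1 (@op0 R X)) (@op0 R X) = @op0 R X.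
  by apply: funext => i; apply: funext => j; rewrite /opadd /opscale /op0 mulr0 addr0.
move=> h; apply: funext => i; apply: funext => j.
have := congr1 (fun Z : op Y => Z i j) h; rewrite /= /opadd /opscale mul1r => e.
by rewrite /op0; apply: (addrI (L (@op0 R X) i j)); rewrite addr0 -e.
Qed.

Lemma linear_map_sum (I : Type) (s : seq I) (c : I -> C) (Z : I -> op X) :
  L (fun i j => \sum_(k <- s) c k * Z k i j) = fun i j => \sum_(k <- s) c k * L (Z k) i j.
Proof.
elim: s => [|k s IH].
  have -> : (fun i j => \sum_(k <- [::]) c k * Z k i j) = @op0 R X.
    by apply: funext => i; apply: funext => j; rewrite big_nil.
  by rewrite linear_map0; apply: funext => i; apply: funext => j; rewrite big_nil.
have -> : (fun i j => \sum_(k <- k :: s) c k * Z k i j) =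
    opadd (opscale (c k) (Z k)) (fun i j => \sum_(k <- s) c k * Z k i j).
  by apply: funext => i; apply: funext => j; rewrite big_cons.
by rewrite hL IH; apply: funext => i; apply: funext => j; rewrite big_cons.
Qed.

Definition unitop (p : X * X) : op X := fun i j => if p == (i, j) then 1 else 0.

Lemma unitop_expand (Z : op X) : Z = fun i j => \sum_p Z p.1 p.2 * unitop p i j.
Proof.
apply: funext => i; apply: funext => j.
by rewrite /unitop (sum_delta2 (i, j) (fun p => Z p.1 p.2)).
Qed.

(* The Heisenberg dual of L, evaluated at the projection onto v. *)
Definition heis (v : Y -> C) : op X := fun i j => ip v (opapp (L (unitop (j, i))) v).

Lemma heisE v Z : optr (opmul (heis v) Z) = ip v (opapp (L Z) v).
Proof.
rewrite {2}(unitop_expand Z) linear_map_sum /optr /opmul /heis.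
transitivity (\sum_(p : X * X) Z p.1 p.2 * ip v (opapp (L (unitop p)) v)).
  rewrite (sum_split (split_id X X)) exchange_big /=; apply: eq_bigr => i _.
  by apply: eq_bigr => j _; rewrite mulrC.
rewrite -ip_sumr; congr ip; apply: funext => i; rewrite /opapp.
under [RHS]eq_bigr do rewrite mulr_suml.
rewrite exchange_big /=; apply: eq_bigr => p _; rewrite mulr_sumr.
by apply: eq_bigr => j _; rewrite mulrA.
Qed.

Lemma ip_heis v x : ip x (opapp (heis v) x) = ip v (opapp (L (ketbra x x)) v).
Proof.
rewrite -heisE /optr /ip /opapp /opmul; apply: eq_bigr => i _; rewrite mulr_sumr.
by apply: eq_bigr => j _; rewrite /ketbra; ring.
Qed.

(** Positivity of [L] gives positivity of the dual effect; trace preservation and [qf_le_rtr] bound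
    it by the identity. The converse turns a channel into a test in this way. *)
Lemma heis_test v : trace_preserving L -> positive_map L -> nrm v = 1 -> test_op (heis v).
Proof.
move=> tL pL hv.
have pk x : psd (L (ketbra x x)) by apply: pL; exact: psd_ketbra.
have hh : hermitian (heis v).
  by apply: hermitian_of_real => x; rewrite ip_heis qfE //; exact: psd_herm.
have E x : qf (heis v) x = qf (L (ketbra x x)) v by rewrite /qf ip_heis.
split; first by apply: psdP => // x; rewrite E psd_qf.
apply: psdP; first by apply: hermD; [exact: herm_id|exact: hermN].
move=> x; rewrite qfD qfN qf_id E subr_ge0.
apply: (le_trans (qf_le_rtr v (pk x))); rewrite hv mulr1.
by rewrite /rtr tL -/(rtr _) rtr_ketbra.
Qed.

End LinearMaps.

Lemma cp_positive (X Y : finType) (L : op X -> op Y) : completely_positive L -> positive_map L.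
Proof.
move=> h P hP.
pose P1 : op (X * 'I_1)%type := fun i j => P i.1 j.1.
have pP1 : psd P1.
  have -> : P1 = etens (split_id X 'I_1) P (@opid R _).
    by apply: funext => i; apply: funext => j; rewrite /etens /opid !ord1 eqxx mulr1.
  by apply: psd_etens => //; exact: psd_id.
have pA := h 1%N P1 pP1.
have E v : ip v (opapp (L P) v) = ip (fun q : Y * 'I_1 => v q.1)
    (opapp (ampl L P1) (fun q => v q.1)).
  rewrite /ip (sum_split (split_id Y 'I_1)); apply: eq_bigr => i _ /=.
  rewrite big_ord1; congr (_ * _); rewrite /opapp (sum_split (split_id Y 'I_1)).
  by apply: eq_bigr => j _ /=; rewrite big_ord1.
have hL : hermitian (L P).
  by apply: hermitian_of_real => v; rewrite E qfE //; exact: psd_herm.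
by apply: psdP => // v; rewrite /qf E -/(qf _ _) psd_qf.
Qed.

Lemma optr_mul_herm (T : finType) (N s : op T) : hermitian N -> hermitian s ->
  optr (opmul N s) = rC (rtr (opmul N s)).
Proof.
move=> hN hs; apply: conjc_fix.
have -> : conjc (optr (opmul N s)) = optr (opadj (opmul N s)).
  by rewrite /optr conjc_sum.
by rewrite opadjM hN hs optr_mulC.
Qed.

Section MeasureAndPrepare.
Variables (X1 Y1 : finType) (Q : finType).
Hypothesis hQ : (1 < #|Q|)%N.
Variable M : op (X1 * Y1)%type.
Hypothesis hM : test_op M.
Local Notation K := (ketbra (@maxent R Q) (@maxent R Q)).
Local Notation N := (opadd (@opid R (X1 * Y1)%type) (opopp M)).

(** The outcome [N] prepares the maximally entangled state and [M] prepares [tau]: the error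
    probability of the test on separable inputs becomes the entangled weight of the output. *)
Definition prep (Z : op (X1 * Y1)%type) : op (Q * Q)%type :=
  opadd (opscale (optr (opmul N Z)) K) (opscale (optr (opmul M Z)) (@tau R Q)).

Lemma optr_mulDr (T : finType) (G Z W : op T) (a : C) :
  optr (opmul G (opadd (opscale a Z) W)) = a * optr (opmul G Z) + optr (opmul G W).
Proof.
rewrite /optr /opmul mulr_sumr -big_split; apply: eq_bigr => i _.
by rewrite mulr_sumr -big_split; apply: eq_bigr => j _ /=; rewrite /opadd /opscale; ring.
Qed.

Lemma prep_linear : linear_map prep.
Proof.
move=> a Z W; apply: funext => i; apply: funext => j.
by rewrite /prep !optr_mulDr /opadd /opscale; ring.
Qed.

Lemma optr_compl Z : optr (opmul N Z) + optr (opmul M Z) = optr Z.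
Proof.
rewrite /optr -big_split; apply: eq_bigr => i _; rewrite /opmul -big_split /=.
rewrite -[RHS](sum_delta i (fun k => Z k i)); apply: eq_bigr => j _.
by rewrite /opadd /opopp /opid; ring.
Qed.

Lemma prep_tp : trace_preserving prep.
Proof.
move=> Z; rewrite -[RHS]optr_compl.
have oK : optr K = 1.
  by rewrite optr_herm; [rewrite rtr_ketbra maxent_nrm|exact: herm_ketbra].
have ot : optr (@tau R Q) = 1 by case: (sep_state (tau_sep R hQ)).
rewrite /prep; transitivity (optr (opmul N Z) * optr K + optr (opmul M Z) * optr (@tau R Q)).
  by rewrite /optr mulr_sumr [X in _ + X]mulr_sumr -big_split.
by rewrite oK ot !mulr1.
Qed.

(** The amplified map is a sum of two products of a prepared state with the conditional state of the
    ancilla, and [psd_ptr1] makes the latter positive. *)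
Lemma prep_cp : completely_positive prep.
Proof.
move=> k P hP.
have hpt G : ptr1 (split_id (X1 * Y1)%type 'I_k) G P =
    fun c c' => optr (opmul G (fun x x' => P (x, c) (x', c'))).
  apply: funext => c; apply: funext => c'; rewrite /ptr1 /optr /opmul exchange_big.
  by [].
have -> : ampl (k := k) prep P = opadd
  (etens (split_id (Q * Q)%type 'I_k) K (ptr1 (split_id (X1 * Y1)%type 'I_k) N P))
  (etens (split_id (Q * Q)%type 'I_k) (@tau R Q) (ptr1 (split_id (X1 * Y1)%type 'I_k) M P)).
  rewrite !hpt; apply: funext => i; apply: funext => j.
  by rewrite /ampl /prep /opadd /opscale /etens /=; congr (_ + _); exact: mulrC.
case: hM => pM pN.
apply: psdD; apply: psd_etens; try exact: psd_ptr1.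
  exact: psd_ketbra.
by apply: scone_psd; exact: tau_scone.
Qed.

Lemma prep_ne : (forall s, separable s -> rtr (opmul N s) <= (#|Q|%:R)^-1) ->
  non_entangling prep.
Proof.
move=> hs; split; first by split; [exact: prep_linear|split; [exact: prep_tp|exact: prep_cp]].
move=> s ss; case: hM => pM pN; have ps := scone_psd (sep_scone ss).
have hp : 0 <= rtr (opmul N s) <= (#|Q|%:R)^-1.
  rewrite hs // andbT; have [a [u [hu [ha ->]]]] := psd_spectral ps.
  by rewrite rtr_mul_spec //; apply: sumr_ge0 => t _; rewrite mulr_ge0 ?psd_qf.
have := maxent_tau_sep hQ hp; congr separable; rewrite /prep.
have e1 := optr_mul_herm (psd_herm pN) (psd_herm ps).
rewrite e1; congr (opadd _ (opscale _ _)).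
have := optr_compl s; rewrite e1 (proj2 (sep_state ss)) => e2.
by rewrite rCD rCN rC1 -e2; ring.
Qed.

(** Exact because [tau] is orthogonal to the maximally entangled state: the infidelity is the error
    exponent's quantity [tr M Z] itself. *)
Lemma prep_fidelity Z : state Z -> fidelity (prep Z) K = 1 - rtr (opmul M Z).
Proof.
move=> [pZ tZ]; case: hM => pM pN.
have pos : positive_map prep by apply: cp_positive; exact: prep_cp.
rewrite fidelity_pure ?maxent_nrm //; last exact: pos.
have e1 := optr_mul_herm (psd_herm pN) (psd_herm pZ).
have e2 := optr_mul_herm (psd_herm pM) (psd_herm pZ).
rewrite /prep e1 e2 qfD !qfZ qf_tau_maxent mulr0 addr0 qf_ketbra ip_nrm maxent_nrm //.
rewrite nsq_rC expr1n mulr1; apply: rC_inj.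
have := optr_compl Z; rewrite e1 e2 tZ => e3.
by rewrite rCD rCN rC1 -e3; ring.
Qed.

End MeasureAndPrepare.

Lemma card_qubits m : #|qubits m| = (2 ^ m)%N.
Proof. by rewrite card_ffun card_bool card_ord. Qed.

Lemma qubits_gt1 m : (0 < m)%N -> (1 < #|qubits m|)%N.
Proof. by move=> m0; rewrite card_qubits -{1}(expn0 2) ltn_exp2l. Qed.

Lemma PhiE m : (0 < m)%N -> @Phi R m = ketbra (@maxent R (qubits m)) (@maxent R (qubits m)).
Proof.
move=> /qubits_gt1 hQ; apply: funext => i; apply: funext => j; rewrite maxentE // /Phi.
have Dm : (#|qubits m|%:R : R)^-1 = (2^-1) ^+ m.
  by rewrite card_ffun card_bool card_ord natrX exprVn.
case: ifP => [/andP[/eqP e1 /eqP e2]|h].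
  under eq_bigr do rewrite e1 e2 !eqxx /=.
  by rewrite -rC_prod prodr_const card_ord Dm.
have [k hk] : exists k, (i.1 k == i.2 k) && (j.1 k == j.2 k) = false.
  suff : ~~ [forall k, (i.1 k == i.2 k) && (j.1 k == j.2 k)].
    by rewrite negb_forall => /existsP [k /negbTE hk]; exists k.
  apply/negP => /forallP hk; move: h.
  suff -> : (i.1 == i.2) && (j.1 == j.2) by [].
  by apply/andP; split; apply/eqP/ffunP => k; case/andP: (hk k) => /eqP h1 /eqP h2.
by rewrite (bigD1 k) //= hk mul0r.
Qed.

End TestsAndChannels.

(** * Inferior limits and convergence in the extended reals *)

Section Limits.
Variable R : realType.

Lemma limn_einf_ge (u : nat -> \bar R) c N : (forall n, (N <= n)%N -> (c <= u n)%E) ->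
  (c <= limn_einf u)%E.
Proof.
move=> h; rewrite limn_einf_lim (cvg_lim _ (@cvg_einfs_sup R u)) //.
apply: le_ereal_sup_tmp; exists (einfs u N); first by exists N.
by apply/ereal_infP => _ [n /= hn <-]; exact: h.
Qed.

Lemma limn_einf_le (u : nat -> \bar R) c N : (forall n, (N <= n)%N -> (u n <= c)%E) ->
  (limn_einf u <= c)%E.
Proof.
move=> h; rewrite limn_einf_lim (cvg_lim _ (@cvg_einfs_sup R u)) //.
apply/ereal_supP => _ [n _ <-]; apply: ge_ereal_inf; exists (u (maxn n N)).
  by exists (maxn n N) => //=; exact: leq_maxl.
by apply: h; exact: leq_maxr.
Qed.

Lemma lee_of_lt (D x : \bar R) : (forall c : R, (c%:E < D)%E -> (c%:E <= x)%E) -> (D <= x)%E.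
Proof.
move=> h; rewrite leNgt; apply/negP => xD.
case: x D xD h => [y| |] [d| |] //= xD h.
- rewrite lte_fin in xD; have := h ((y + d) / 2); rewrite lte_fin lee_fin => /(_ ltac:(lra)); lra.
- have := h (y + 1) (ltry _); rewrite lee_fin; lra.
- have := h (d - 1); rewrite lte_fin leeNy_eq => /(_ ltac:(lra)) //.
- by have := h 0 (ltry _); rewrite leeNy_eq.
Qed.

(** Testing against real [c] only treats finite and infinite limits uniformly; for [D = +oo] the
    second hypothesis is void. *)
Lemma cvg_from_above (T : Type) (F : set_system T) (f : T -> \bar R) (D : \bar R) :
  ProperFilter F -> (\forall x \near F, (D <= f x)%E) ->
  (forall c : R, (D < c%:E)%E -> \forall x \near F, (f x <= c%:E)%E) -> f @ F --> D.
Proof.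
move=> pF hlo hup; case: D hlo hup => [d| |] hlo hup.
- have hup' (e : R) : 0 < e -> \forall x \near F, (f x <= (d + e)%:E)%E.
    by move=> e0; apply: hup; rewrite lte_fin ltrDl.
  apply/fine_cvgP; split.
    near=> x; rewrite fin_numE; apply/andP; split.
      rewrite gt_eqF // (lt_le_trans (ltNyr d)) //; near: x; exact: hlo.
    rewrite lt_eqF // (le_lt_trans _ (ltry (d + 1))) //; near: x; exact: hup'.
  apply/cvgrPdist_le => e e0; near=> x.
  have h1 : (d%:E <= f x)%E by near: x; exact: hlo.
  have h2 : (f x <= (d + e)%:E)%E by near: x; exact: hup'.
  move: h1 h2 => /=; case: (f x) => [y| |] //=.
  by rewrite !lee_fin => h1 h2; rewrite ler_norml; apply/andP; split; lra.
- apply: cvg_near_cst; near=> x; apply/eqP; rewrite -leye_eq; near: x; exact: hlo.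
- apply/cvgeNyPle => A; apply: hup; exact: ltNyr.
Unshelve. all: by end_near.
Qed.

End Limits.

(** * The four one-sided bounds and their assembly *)

Section Main.
Variable R : realType.
Local Notation C := R[i].
Local Notation op := (@op R).
Variables (A B : finType) (rho : op (A * B)%type).
Hypothesis hrho : state rho.

Lemma rate_ge (n : nat) (eps c : R) : (0 < n)%N -> eps <= expR (- (n%:R * c)) ->
  (c%:E <= rate n eps)%E.
Proof.
move=> n0 h; rewrite /rate; case: ifP => [_|/negbT]; first exact: leey.
rewrite -ltNge => e0; rewrite lee_fin ler_pdivlMr ?ltr0n // lerNr mulrC.
by rewrite -[leRHS]expRK ler_ln ?posrE ?expR_gt0.
Qed.

Lemma rate_le (n : nat) (eps c : R) : (0 < n)%N -> expR (- (n%:R * c)) <= eps ->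
  (rate n eps <= c%:E)%E.
Proof.
move=> n0 h; have e0 : 0 < eps by exact: lt_le_trans (expR_gt0 _) h.
rewrite /rate (leNgt eps) e0 /= lee_fin ler_pdivrMr ?ltr0n // lerNl mulrC.
by rewrite -[leLHS]expRK ler_ln ?posrE ?expR_gt0.
Qed.

(** A non-entangling channel needs a rejection probability of at most [2 ^ - m] on separable states,
    a constant in [n]. So the test of [achievability] applies for each fixed [m]. *)
Lemma Ed_lower m : (0 < m)%N -> (rev_rel_ent rho <= Ed_err_m rho m)%E.
Proof.
move=> m0; apply: lee_of_lt => c hc.
have hQ := qubits_gt1 m0.
have Q0 : 0 < (#|qubits m|%:R)^-1 :> R by rewrite invr_gt0 ltr0n ltnW.
have [N hN] := achievability hrho hc Q0.
have hex n : exists M : op (An A n * An B n)%type, test_op M /\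
  (forall s, separable s -> rtr (opmul (opadd (@opid R _) (opopp M)) s) <= (#|qubits m|%:R)^-1) /\
  ((N <= n)%N -> rtr (opmul M (tpw rho n)) <= expR (- (n%:R * c))).
  have [hn|hn] := leqP N n; first by have [M [h1 [h2 h3]]] := hN n hn; exists M.
  (* For the finitely many small [n] the trivial test that always prepares [tau] fills the
     sequence. *)
  exists (@opid R _).
  have z : opadd (@opid R (An A n * An B n)%type) (opopp (@opid R _)) = @op0 R _.
    by apply: funext => i; apply: funext => j; rewrite /opadd /opopp subrr.
  split; first by split; [exact: psd_id|rewrite z; exact: psd0].
  split=> // s _; rewrite z; apply: (le_trans _ (ltW Q0)).
  rewrite /rtr /optr big1 // => i _; rewrite /opmul big1 // => j _; by rewrite mul0r.
pose M n := projT1 (cid (hex n)); have hM n := projT2 (cid (hex n)).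
apply: le_ereal_sup_tmp.
exists (limn_einf (fun n => rate n (rtr (opmul (M n) (tpw rho n))))).
  exists (fun n => prep (M n)), (fun n => rtr (opmul (M n) (tpw rho n))); split.
    by move=> n; have [h1 [h2 _]] := hM n; exact: prep_ne.
  split=> // n; have [h1 _] := hM n.
  by rewrite /= PhiE // prep_fidelity //; exact: state_tpow.
apply: (@limn_einf_ge _ _ _ (maxn N 1)) => n; rewrite geq_max => /andP[n1 n2].
by have [_ [_ h3]] := hM n; apply: rate_ge => //; exact: h3.
Qed.

(** The fidelity with [Phi m] is the expectation of a dual effect on the input. On the separable
    [tpw s n] it is at most [2 ^ - m], which falls below the constant of [converse] once [m] is
    large. *)
Lemma Ed_upper (d del : R) (s : op (A * B)%type) : separable s -> relent s rho = d%:E -> 0 < del ->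
  exists m0, forall m, (m0 <= m)%N -> (Ed_err_m rho m <= (d + del)%:E)%E.
Proof.
move=> ss hd del0.
have [eps0 e0 [N hN]] := converse (sep_state ss) hrho hd del0.
have [m0 hm0] := @exists_nat_mul_ge R eps0 1 e0.
exists (maxn m0 1) => m; rewrite geq_max => /andP[hm m1].
have hQ := qubits_gt1 m1.
have hm2 : (#|qubits m|%:R)^-1 <= eps0.
  have q0 : 0 < #|qubits m|%:R :> R by rewrite card_qubits ltr0n expn_gt0.
  rewrite -[leLHS]mul1r ler_pdivrMr // mulrC; apply: (le_trans (hm0 m hm)).
  by rewrite ler_pM2r // card_qubits ler_nat; exact: ltnW (ltn_expl _ _).
apply/ereal_supP => _ [L [eps [hL [hF ->]]]].
apply: (@limn_einf_le _ _ _ (maxn N 1)) => n; rewrite geq_max => /andP[n1 n2].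
apply: rate_le => //.
have [[linL [tpL cpL]] neL] := hL n.
have pL := cp_positive cpL.
have hv := maxent_nrm R hQ; set v := @maxent R (qubits m) in hv.
have hT := heis_test linL tpL pL hv.
have E Z : rtr (opmul (heis (L n) v) Z) = qf (L n Z) v by rewrite /rtr heisE.
have cc : opadd (@opid R _) (opopp (opadd (@opid R _) (opopp (heis (L n) v)))) = heis (L n) v.
  by apply: funext => i; apply: funext => j; rewrite /opadd /opopp; ring.
(* The test for [converse] is the complement of the dual effect: its error on [tpw s n] is the
   overlap with [Phi m], and its value on [tpw rho n] is the infidelity. *)
have := hN n n1 _ (test_opC hT); rewrite cc E => /(_ _) h.
apply: le_trans (h _) _.
  by apply: le_trans hm2; apply: (maxent_sep hQ); apply: neL; exact: tpow_sep.
have st := state_tpow n hrho.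
have := hF n; rewrite PhiE // fidelity_pure //; last by apply: pL; case: st.
rewrite -/v -E.
have : rtr (opmul (opadd (@opid R _) (opopp (heis (L n) v))) (tpw rho n)) =
    1 - rtr (opmul (heis (L n) v) (tpw rho n)).
  have := optr_compl (heis (L n) v) (tpw rho n); rewrite (proj2 st) => e.
  have := congr1 (@complex.Re R) e; rewrite ReD /= -!/(rtr _) => <-; ring.
by move=> -> h'; lra.
Qed.

Lemma sanov_lower eps : 0 < eps -> (rev_rel_ent rho <= sanov_eps rho eps)%E.
Proof.
move=> e0; apply: lee_of_lt => c hc.
have [N hN] := achievability hrho hc e0.
apply: (@limn_einf_ge _ _ _ (maxn N 1)) => n; rewrite geq_max => /andP[n1 n2].
have [M [[pM1 pM2] [hr hs]]] := hN n n1.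
have n0 : 0 < n%:R :> R by rewrite ltr0n.
have -> : c%:E = ((n%:R^-1)%:E * (n%:R * c)%:E)%E.
  by rewrite -EFinM mulKf // gt_eqF.
rewrite lee_pmul2l ?lte_fin ?invr_gt0 //.
apply/ereal_infP => _ [s ss <-]; rewrite /DH /eneglog; case: ifP => [_|/negbT]; first exact: leey.
set S := [set x | _]; rewrite -ltNge => i0; rewrite lee_fin lerNr -[leRHS]expRK ler_ln ?posrE ?expR_gt0 //.
apply: le_trans hr; apply: ge_inf; last by exists M; do 3 (split=> //); exact: hs.
exists 0 => _ [M' [p1 [p2 [_ ->]]]].
have [a [u [hu [ha ->]]]] := psd_spectral (psd_tpow n (proj1 hrho)).
by rewrite rtr_mul_spec //; apply: sumr_ge0 => t _; rewrite mulr_ge0 ?psd_qf.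
Qed.

(** The fixed product state [tpw s n] is one candidate in the infimum over separable states, and
    [converse] bounds all of its admissible tests from below. *)
Lemma sanov_upper (d del : R) (s : op (A * B)%type) : separable s -> relent s rho = d%:E -> 0 < del ->
  exists2 e1 : R, 0 < e1 & forall eps, 0 < eps -> eps <= e1 -> (sanov_eps rho eps <= (d + del)%:E)%E.
Proof.
move=> ss hd del0.
have [eps0 e0 [N hN]] := converse (sep_state ss) hrho hd del0.
exists eps0 => // eps eps_gt0 he.
apply: (@limn_einf_le _ _ _ (maxn N 1)) => n; rewrite geq_max => /andP[n1 n2].
have n0 : 0 < n%:R :> R by rewrite ltr0n.
have -> : (d + del)%:E = ((n%:R^-1)%:E * (n%:R * (d + del))%:E)%E.
  by rewrite -EFinM mulKf // gt_eqF.
rewrite lee_pmul2l ?lte_fin ?invr_gt0 //.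
apply: ge_ereal_inf; exists (DH eps (tpw s n) (tpw rho n)); first by exists (tpw s n) => //; exact: tpow_sep.
rewrite /DH /eneglog; set S := [set x | _].
have lb : lbound S (expR (- (n%:R * (d + del)))).
  by move=> _ [M [p1 [p2 [h ->]]]]; apply: hN => //; exact: le_trans he.
have S0 : S !=set0.
  exists (rtr (opmul (@opid R _) (tpw rho n))), (@opid R _); split; first exact: psd_id.
  have z : opadd (@opid R (An A n * An B n)%type) (opopp (@opid R _)) = @op0 R _.
    by apply: funext => i; apply: funext => j; rewrite /opadd /opopp subrr.
  rewrite z; split; first exact: psd0.
  split=> //; rewrite /rtr /optr big1 ?(ltW eps_gt0) // => i _.
  by rewrite /opmul big1 // => j _; rewrite mul0r.
have hi : expR (- (n%:R * (d + del))) <= inf S by exact: lb_le_inf.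
have i0 : 0 < inf S by exact: lt_le_trans (expR_gt0 _) hi.
rewrite (leNgt (inf S)) i0 /= lee_fin lerNl -[leLHS]expRK ler_ln ?posrE ?expR_gt0 //.
Qed.

(** No attained minimum is needed for the upper bounds: a separable state below a real [c] has
    finite relative entropy, and the remaining gap serves as the slack [del]. *)
Lemma rev_rel_ent_approx (c : R) : (rev_rel_ent rho < c%:E)%E ->
  exists s d del, separable s /\ relent s rho = d%:E /\ 0 < del /\ d + del <= c.
Proof.
move=> hc.
have [s [ss hs]] : exists s, separable s /\ (relent s rho < c%:E)%E.
  apply: contrapT => hn; move: hc; rewrite ltNge => /negP; apply.
  apply/ereal_infP => _ [s ss <-]; rewrite leNgt; apply/negP => h; apply: hn.
  by exists s.
move: hs; rewrite /relent; case: asboolP => // hsupp; rewrite lte_fin => hs.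
set d := rtr _ in hs; exists s, d, (c - d); split=> //; split.
  by rewrite /relent; case: asboolP.
by split; lra.
Qed.

End Main.

(* E_{d,err}(rho) = lim_m E^{(m)}_{d,err}(rho) = D(S_{A:B} || rho) and
   Sanov(rho || S_{A:B}) = lim_{eps->0+} ... = D(S_{A:B} || rho). *)
Theorem theorem2 (R : realType) (A B : finType) (rho : op R (A * B)%type) :
  state rho ->
  (Ed_err_m rho m @[m --> \oo] --> rev_rel_ent rho) /\
  (sanov_eps rho eps @[eps --> (0 : R)^'+] --> rev_rel_ent rho).
Proof.
move=> hrho; split.
  apply: cvg_from_above; first by exists 1%N => // m /= m0; exact: Ed_lower.
  move=> c /rev_rel_ent_approx [s [d [del [ss [hd [del0 hc]]]]]].
  have [m0 hm0] := Ed_upper hrho ss hd del0.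
  by exists m0 => // m /= hm; apply: (le_trans (hm0 m hm)); rewrite lee_fin.
apply: cvg_from_above.
  by near=> eps; apply: sanov_lower.
move=> c /rev_rel_ent_approx [s [d [del [ss [hd [del0 hc]]]]]].
have [e1 e10 he1] := sanov_upper hrho ss hd del0.
near=> eps; apply: (@le_trans _ _ (d + del)%:E); last by rewrite lee_fin.
apply: he1 => //; near: eps; exact: nbhs_right_le.
Unshelve. all: by end_near.
Qed.
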